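(* Let $\Omega\subset\mathbb{C}$ be a non-empty, open, connected, bounded set such that, for every $z\in\mathbb{C}$ and $r>0$, if $D(z,r)\setminus\{z\}\subset\Omega$ then $z\in\Omega$. Let $X$ be a Banach space such that $X\hookrightarrow\mathrm{Hol}(\Omega)$ and such that $\Omega$ is maximal for $X$. Suppose that $e_1\in X$ and that $X$ satisfies the density condition $(D)$. Let $G\in\mathrm{Hol}(\Omega)$ and let $T$ be a $C_0$-semigroup on $X$ whose generator $A$ satisfies $Af=Gf'$ for all $f\in D(A)$. Then the semiflow $\varphi$ associated with $G$ is global and $$(T(t)f)(z)=f(\varphi(t,z))$$ for all $f\in X$, $z\in\Omega$ and $t\geq 0$. Moreover, $$D(A)=\{f\in X: Gf'\in X\}.$$
   Context: $D(w,r)=\{z\in\mathbb{C}:|z-w|<r\}$. $\mathrm{Hol}(\Omega)$ is the Fréchet space of all holomorphic functions $\Omega\to\mathbb{C}$ (uniform convergence on compact sets). $e_1$ is the identity function, $e_1(z)=z$ for $z\in\Omega$. $X\hookrightarrow\mathrm{Hol}(\Omega)$ means: $X$ is a linear subspace of $\mathrm{Hol}(\Omega)$ which is a complex Banach space for its own norm $\|\cdot\|_X$, and for every $z\in\Omega$ the evaluation $\delta_z: f\mapsto f(z)$ is a bounded linear functional on $X$ (equivalently, the embedding of $X$ in $\mathrm{Hol}(\Omega)$ is continuous). The domain $\Omega$ is maximal for $X$ if for each $w\in\partial\Omega$ and each $\varepsilon>0$ there exists $f\in X$ which does not have a holomorphic extension to $\Omega\cup D(w,\varepsilon)$. Density condition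 $(D)$: for all $w\in\partial\Omega$ there exists $\varepsilon>0$ such that the space $\{f\in X:\exists\,\widetilde f\in\mathrm{Hol}(\Omega\cup D(w,\varepsilon)),\ \widetilde f_{|\Omega}=f\}$ is dense in $X$. Semiflow associated with (generated by) $G$: for $z\in\Omega$, $\varphi(\cdot,z):[0,\tau(z))\to\Omega$, with $0<\tau(z)\le\infty$, is the unique maximal (forward in time) solution of the initial value problem $u'(t)=G(u(t))$, $u(0)=z$. The semiflow is called global if $\tau(z)=\infty$ for all $z\in\Omega$. *)

(* Defs.v *)
From Stdlib Require Export Reals.
From Coquelicot Require Export Coquelicot.

Local Open Scope R_scope.

Definition open_disc (w : C) (r : R) (z : C) : Prop := Cmod (z - w)%C < r.

Definition boundary (S : C -> Prop) (w : C) : Prop :=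
  forall eps : R, 0 < eps ->
    (exists z, S z /\ open_disc w eps z) /\ (exists z, ~ S z /\ open_disc w eps z).

Definition connected (S : C -> Prop) : Prop :=
  forall U V : C -> Prop, open U -> open V ->
    (forall z, S z -> U z \/ V z) ->
    (exists z, S z /\ U z) -> (exists z, S z /\ V z) ->
    exists z, S z /\ U z /\ V z.

Definition bounded_set (S : C -> Prop) : Prop :=
  exists M : R, forall z, S z -> Cmod z <= M.

(** A function on an open set [Omega] is represented by a total function
    [C -> C] whose values outside [Omega] are irrelevant: as [Omega] is open,
    differentiability at a point of [Omega] only depends on the restriction. *)
Definition holomorphic (Omega : C -> Prop) (f : C -> C) : Prop :=
  forall z, Omega z -> ex_derive (K := C_AbsRing) (V := C_NormedModule) f z.

(** [ev f] is the holomorphic function that the vector [f : X] is; thus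
    [X] is identified, through the injective linear map [ev], with a linear
    subspace of Hol(Omega), where functions are equal when they agree on
    [Omega]. *)
Record embeds_in_Hol (Omega : C -> Prop) (X : CompleteNormedModule C_AbsRing)
    (ev : X -> C -> C) : Prop := {
  ev_holomorphic : forall f, holomorphic Omega (ev f);
  ev_plus : forall f g z, Omega z -> ev (plus f g) z = (ev f z + ev g z)%C;
  ev_scal : forall (c : C) f z, Omega z -> ev (scal c f) z = (c * ev f z)%C;
  ev_inj : forall f g, (forall z, Omega z -> ev f z = ev g z) -> f = g;
  ev_bounded : forall z, Omega z ->
    exists M : R, forall f, Cmod (ev f z) <= M * norm f }.

Definition extends_to_disc (Omega : C -> Prop) (w : C) (eps : R)
    (f : C -> C) : Prop :=
  exists g : C -> C, holomorphic (fun z => Omega z \/ open_disc w eps z) g /\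
    forall z, Omega z -> g z = f z.

Definition maximal_domain (Omega : C -> Prop)
    (X : CompleteNormedModule C_AbsRing) (ev : X -> C -> C) : Prop :=
  forall w, boundary Omega w -> forall eps : R, 0 < eps ->
    exists f : X, ~ extends_to_disc Omega w eps (ev f).

Definition density_condition (Omega : C -> Prop)
    (X : CompleteNormedModule C_AbsRing) (ev : X -> C -> C) : Prop :=
  forall w, boundary Omega w ->
    exists eps : R, 0 < eps /\
      forall (f : X) (eta : R), 0 < eta ->
        exists g : X, extends_to_disc Omega w eps (ev g) /\
          norm (minus g f) < eta.

(** Only the operators [T t] with [0 <= t] are meaningful. *)
Record C0_semigroup (X : CompleteNormedModule C_AbsRing)
    (T : R -> X -> X) : Prop := {
  C0_linear : forall t, 0 <= t -> is_linear (T t);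
  C0_zero : forall f, T 0 f = f;
  C0_plus : forall s t f, 0 <= s -> 0 <= t -> T (s + t) f = T s (T t f);
  C0_continuous : forall f, filterlim (fun t => T t f) (at_right 0) (locally f) }.

(** The graph of the generator: [f] is in its domain and is mapped to [g]. *)
Definition generator {X : CompleteNormedModule C_AbsRing} (T : R -> X -> X)
    (f g : X) : Prop :=
  filterlim (fun t : R => scal (RtoC (/ t) : C_AbsRing) (minus (T t f) f))
    (at_right 0) (locally g).

Definition generator_dom {X : CompleteNormedModule C_AbsRing}
    (T : R -> X -> X) (f : X) : Prop :=
  exists g, generator T f g.

(** [u] solves [u' = G (u)], [u 0 = z] on [[0, sigma)], with values in [Omega];
    the derivative at [0] is one-sided. *)
Definition is_solution (Omega : C -> Prop) (G : C -> C) (z : C)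
    (sigma : Rbar) (u : R -> C) : Prop :=
  u 0 = z /\
  forall t : R, 0 <= t -> Rbar_lt t sigma ->
    Omega (u t) /\
    filterdiff (K := R_AbsRing) (U := R_NormedModule) (V := C_R_NormedModule)
      u (within (fun s => 0 <= s) (locally t))
      (fun h : R => scal h (G (u t) : C_R_NormedModule)).

Definition is_maximal_solution (Omega : C -> Prop) (G : C -> C) (z : C)
    (sigma : Rbar) (u : R -> C) : Prop :=
  Rbar_lt 0 sigma /\ is_solution Omega G z sigma u /\
  forall (sigma' : Rbar) (v : R -> C),
    Rbar_le sigma sigma' -> is_solution Omega G z sigma' v ->
    (forall t : R, 0 <= t -> Rbar_lt t sigma -> v t = u t) ->
    sigma' = sigma.

Definition is_semiflow (Omega : C -> Prop) (G : C -> C)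
    (tau : C -> Rbar) (phi : R -> C -> C) : Prop :=
  forall z, Omega z ->
    is_maximal_solution Omega G z (tau z) (fun t => phi t z) /\
    forall (sigma : Rbar) (u : R -> C),
      is_maximal_solution Omega G z sigma u ->
      sigma = tau z /\
      forall t : R, 0 <= t -> Rbar_lt t sigma -> u t = phi t z.

(* Main.v *)
Require Import Defs.
From Stdlib Require Import ssreflect Lra Lia Psatz.
From Stdlib Require Import Classical ClassicalEpsilon IndefiniteDescription.

(**
The semigroup is transported along the solutions [u] of [u' = G (u)]: for [f] in
the domain of the generator [A], the derivative of [s |-> (T (t - s) f) (u s)]
is [- (A T (t - s) f) (u s) + (T (t - s) f)' (u s) * G (u s)], which vanishes
because [A h = G * h'].  Hence [(T (t + r) f) (u 0) = (T r f) (u t)], first for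
the integrals [int_0^eps T s g ds], which lie in the domain together with their
orbits, then for all [f] by density ([transport]).  Taking [r = 0] and for [f]
the identity function [e1] gives [u t = (T t e1) (u 0)].  So the semiflow can
only be [flow t z = (T t e1) z], which is defined for all times, and local
existence ([local_existence]) reduces everything to one claim: this orbit
never leaves [Omega] ([follows_forever]).

Suppose it leaves at the time [tau], at the point [w = flow tau z], which is
then a boundary point.  Restart shortly before, at [z1], with remaining time
[t1].  If [f] extends to [f~] near [w], then [T t1 f = f~ o flow t1] near [z1]:
for [t < t1] the identity [T t f = f~ o flow t] holds close to [z1] by
transport, it spreads to a disc that does not depend on [t] by the identity
principle, and [t] tends to [t1] by continuity ([exit_composition]).  Since
[T t1 e1] tends to [e1] when [t1] tends to [0], the holomorphic map [flow t1] is
not constant for [z1] late enough on the orbit; so it is open, its values near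
[z1] fill a disc around [w], and there [|f~|] is bounded by a fixed multiple of
[norm f] ([exit_bound]).  By the density condition every [f] in [X] is a limit
of extendable functions, whose extensions then converge uniformly near [w]; the
limit extends [f] ([exit_extends]).  All of [X] extends across [w], against the
maximality of [Omega].

Once the orbits stay in [Omega], [T t f = f o flow t], and if [g = G * f'] lies
in [X] then the derivative of [t |-> f (flow t z)] is [(T t g) z], so that
[T t f - f] is the integral of [T s g] over [[0, t]] and [A f = g].

Differentiability is only assumed pointwise, so the argument rests on a
development of function theory from Goursat's lemma: Cauchy's formula on
circles, integrals of Cauchy type, Weierstrass' theorem on uniform limits, the
identity principle and the openness of nonconstant maps.  From functional
analysis it uses the uniform boundedness principle, which makes the
evaluations locally uniformly bounded and the semigroup locally bounded.
*)

Local Open Scope R_scope.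

(** * Complex Banach spaces as real ones *)

Section Restriction.
Context (V : CompleteNormedModule C_AbsRing).

Definition rscal (r : R) (x : V) : V := scal (RtoC r : C_AbsRing) x.

Lemma rscal_assoc (x y : R) (u : V) : rscal x (rscal y u) = rscal (x * y) u.
Proof. unfold rscal. rewrite RtoC_mult. exact (scal_assoc (RtoC x : C_AbsRing) (RtoC y) u). Qed.

Lemma rscal_one (u : V) : rscal 1 u = u.
Proof. exact (scal_one u). Qed.

Lemma rscal_distr_l (x : R) (u v : V) : rscal x (plus u v) = plus (rscal x u) (rscal x v).
Proof. exact (scal_distr_l _ u v). Qed.

Lemma rscal_distr_r (x y : R) (u : V) : rscal (x + y) u = plus (rscal x u) (rscal y u).
Proof. unfold rscal. rewrite RtoC_plus. exact (scal_distr_r (RtoC x : C_AbsRing) (RtoC y) u). Qed.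

Definition restr_ModuleSpace_mixin :=
  ModuleSpace.Mixin R_AbsRing (AbelianGroup.Pack V (ModuleSpace.base _ _ (NormedModuleAux.base _ _ (NormedModule.base _ _ (CompleteNormedModule.base _ _ (CompleteNormedModule.class _ V))))) V) rscal rscal_assoc rscal_one rscal_distr_l rscal_distr_r.

Definition restr_NormedModuleAux : NormedModuleAux R_AbsRing :=
  NormedModuleAux.Pack R_AbsRing V
    (NormedModuleAux.Class R_AbsRing V
      (ModuleSpace.Class R_AbsRing V _ restr_ModuleSpace_mixin)
      (NormedModuleAux.mixin _ _ (NormedModule.base _ _ (CompleteNormedModule.base _ _ (CompleteNormedModule.class _ V))))) V.

Lemma restr_norm_scal (l : R) (x : V) : norm (rscal l x) <= Rabs l * norm x.
Proof. unfold rscal. rewrite <- Cmod_R. apply (norm_scal (RtoC l : C_AbsRing) x). Qed.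

Definition restr_NormedModule_mixin :=
  NormedModule.Mixin R_AbsRing restr_NormedModuleAux (@norm _ V) (@norm_factor _ V)
    (@norm_triangle _ V) restr_norm_scal (@norm_compat1 _ V) (@norm_compat2 _ V) (@norm_eq_zero _ V).

(** Riemann sums only involve real multiples; the norm and the uniform
    structure are kept, so estimates and limits are the same on both sides. *)
Definition restrict_scalars : CompleteNormedModule R_AbsRing :=
  CompleteNormedModule.Pack R_AbsRing V
    (CompleteNormedModule.Class R_AbsRing V
      (NormedModule.Class R_AbsRing V _ restr_NormedModule_mixin)
      (CompleteNormedModule.mixin _ _ (CompleteNormedModule.class _ V))) V.
End Restriction.

(** The cast makes [r] a complex scalar. *)
Notation "r *: x" := (scal (RtoC r : C_AbsRing) x) (at level 40).

(** * Preliminaries on reals, groups and norms *)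

Lemma Rlt_Rmin (x a b : R) : x < Rmin a b -> x < a /\ x < b.
Proof. intro H. pose proof (Rmin_l a b). pose proof (Rmin_r a b). lra. Qed.

Lemma Rlt_div_r (a b e : R) : 0 < b -> a < e / b -> a * b < e.
Proof.
  intros Hb H. apply (Rmult_lt_compat_r b) in H; [|exact Hb].
  replace (e / b * b) with e in H by (field; lra). exact H.
Qed.

Lemma Rlt_div_l (a b e : R) : 0 < b -> a < e / b -> b * a < e.
Proof. rewrite Rmult_comm. apply Rlt_div_r. Qed.

Lemma geometric_small (K e : R) : 0 <= K -> 0 < e -> exists n : nat, K * (1 / 2) ^ n < e.
Proof.
  intros HK He. destruct (pow_lt_1_zero (1 / 2)) with (y := e / (K + 1)) as [n Hn].
  { rewrite Rabs_right; lra. }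
  { apply Rdiv_lt_0_compat; lra. }
  exists n. specialize (Hn n (le_n n)).
  assert (P : 0 < (1 / 2) ^ n) by (apply pow_lt; lra).
  rewrite (Rabs_right ((1 / 2) ^ n)) in Hn; [|lra].
  apply Rlt_div_r in Hn; [|lra]. nra.
Qed.

Lemma lub_approx (S : R -> Prop) m x : is_lub S m -> 0 < x -> exists s, S s /\ m - x < s <= m.
Proof.
  intros [Hub Hl] Hx. apply NNPP. intro H.
  assert (m <= m - x); [|lra].
  apply Hl. intros s Hs. destruct (Rle_dec s (m - x)); [assumption|].
  exfalso. apply H. exists s. split; [exact Hs|]. split; [lra|apply Hub, Hs].
Qed.

Lemma plus_minus_cancel {G : AbelianGroup} (x y : G) : plus y (minus x y) = x.
Proof. unfold minus. rewrite (plus_comm x) plus_assoc plus_opp_r. apply plus_zero_l. Qed.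

Lemma minus_zero_eq {G : AbelianGroup} (x y : G) : minus x y = zero -> x = y.
Proof. intro H. rewrite -(plus_minus_cancel x y) H. apply plus_zero_r. Qed.

Lemma minus_zero_r {G : AbelianGroup} (x : G) : minus x zero = x.
Proof. unfold minus. rewrite opp_zero. apply plus_zero_r. Qed.

Lemma minus_minus_cancel {G : AbelianGroup} (x y : G) : minus x (minus x y) = y.
Proof. unfold minus at 1. rewrite (opp_minus x y). apply plus_minus_cancel. Qed.

Lemma norm_minus_sym {K : AbsRing} {V : NormedModule K} (x y : V) :
  norm (minus x y) = norm (minus y x).
Proof. rewrite -opp_minus. apply norm_opp. Qed.

Lemma norm_minus_triangle {K : AbsRing} {V : NormedModule K} (y x z : V) :
  norm (minus x z) <= norm (minus x y) + norm (minus y z).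
Proof. rewrite (minus_trans y x z). apply norm_triangle. Qed.

Lemma norm_minus_self {K : AbsRing} {V : NormedModule K} (x : V) :
  norm (minus x x) = 0.
Proof. rewrite minus_eq_zero. apply norm_zero. Qed.

Lemma eq_of_norm_minus {K : AbsRing} {V : NormedModule K} (x y : V) :
  (forall eps, 0 < eps -> norm (minus x y) <= eps) -> x = y.
Proof.
  intro H.
  assert (E : norm (minus x y) = 0).
  { apply Rle_antisym; [|apply norm_ge_0].
    apply le_epsilon. intros e He. rewrite Rplus_0_l. apply H, He. }
  apply minus_zero_eq, norm_eq_zero, E.
Qed.

Lemma norm_le_minus {K : AbsRing} {V : NormedModule K} (x y : V) :
  norm x <= norm y + norm (minus x y).
Proof.
  rewrite -{1}(plus_minus_cancel x y). apply norm_triangle.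
Qed.

Lemma minus_plus_l {G : AbelianGroup} (x y : G) : minus (plus x y) x = y.
Proof.
  change (plus (plus x y) (opp x) = y).
  rewrite (plus_comm x y) -(plus_assoc y x (opp x)) (plus_opp_r x). apply plus_zero_r.
Qed.

Lemma norm_minus_le {K : AbsRing} {V : NormedModule K} (x y : V) :
  norm (minus x y) <= norm x + norm y.
Proof. rewrite -(norm_opp y). exact (norm_triangle x (opp y)). Qed.

Lemma plus_plus_swap {G : AbelianMonoid} (a b c d : G) :
  plus (plus a b) (plus c d) = plus (plus a c) (plus b d).
Proof.
  rewrite -(plus_assoc a b) -(plus_assoc a c). f_equal.
  rewrite (plus_assoc b c) (plus_assoc c b). f_equal. apply plus_comm.
Qed.

Lemma minus_plus_plus {G : AbelianGroup} (a b c d : G) :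
  minus (plus a b) (plus c d) = plus (minus a c) (minus b d).
Proof. unfold minus. rewrite (opp_plus c d). apply plus_plus_swap. Qed.

Lemma minus_minus_minus {G : AbelianGroup} (a b c d : G) :
  minus (minus a b) (minus c d) = minus (minus a c) (minus b d).
Proof.
  change (plus (plus a (opp b)) (opp (plus c (opp d)))
    = plus (plus a (opp c)) (opp (plus b (opp d)))).
  rewrite (opp_plus c (opp d)) (opp_plus b (opp d)). apply plus_plus_swap.
Qed.

(** * Relative derivatives of curves *)

(** The points [x] of [[a, b]] up to which the bound holds form a closed
    set, which the local hypothesis lets grow; so its supremum is [b]. *)
Lemma lipschitz_from_local {K : AbsRing} {V : NormedModule K} (F : R -> V) (a b eta : R) :
  0 < eta -> a <= b ->
  (forall x, a <= x <= b -> exists d, 0 < d /\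
     forall y, a <= y <= b -> Rabs (y - x) < d ->
       norm (minus (F y) (F x)) <= eta * Rabs (y - x)) ->
  norm (minus (F b) (F a)) <= eta * (b - a).
Proof.
  intros Heta Hab H.
  set (S := fun x => a <= x <= b /\ norm (minus (F x) (F a)) <= eta * (x - a)).
  assert (Sa : S a).
  { split; [lra|]. rewrite norm_minus_self. nra. }
  destruct (completeness S) as [m [Hub Hlub]].
  { exists b. intros x [Hx _]. lra. }
  { exists a. exact Sa. }
  assert (Hm : a <= m <= b).
  { split; [apply Hub, Sa|]. apply Hlub. intros x [Hx _]. lra. }
  destruct (H m Hm) as [d [Hd Hloc]].
  assert (Sm : norm (minus (F m) (F a)) <= eta * (m - a)).
  { destruct (classic (exists x, S x /\ m - d < x)) as [[x [[Hx Sx] Hx2]]|Hno].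
    - assert (x <= m) by (apply Hub; split; assumption).
      pose proof (Hloc x Hx) as L. rewrite (Rabs_left1 (x - m)) in L; [|lra].
      specialize (L ltac:(lra)).
      rewrite norm_minus_sym in L.
      pose proof (norm_minus_triangle (F x) (F m) (F a)). nra.
    - exfalso. assert (m <= m - d); [|lra].
      apply Hlub. intros x Sx. destruct (Rle_dec x (m - d)); [assumption|].
      exfalso. apply Hno. exists x. split; [exact Sx|lra]. }
  destruct (Req_dec m b) as [->|Hne]; [exact Sm|].
  exfalso.
  set (y := Rmin b (m + d / 2)).
  assert (Hy : m < y /\ y <= b /\ y <= m + d / 2).
  { unfold y. split; [apply Rmin_glb_lt; lra|]. split; [apply Rmin_l|apply Rmin_r]. }
  assert (y <= m); [|lra].
  apply Hub. split; [lra|].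
  pose proof (Hloc y ltac:(lra)) as L. rewrite (Rabs_right (y - m)) in L; [|lra].
  specialize (L ltac:(lra)).
  pose proof (norm_minus_triangle (F m) (F y) (F a)). nra.
Qed.

Lemma const_from_local {K : AbsRing} {V : NormedModule K} (F : R -> V) (a b : R) :
  a <= b ->
  (forall x eta, a <= x <= b -> 0 < eta -> exists d, 0 < d /\
     forall y, a <= y <= b -> Rabs (y - x) < d ->
       norm (minus (F y) (F x)) <= eta * Rabs (y - x)) ->
  F b = F a.
Proof.
  intros Hab H. apply eq_of_norm_minus. intros e He.
  eapply Rle_trans.
  - apply (lipschitz_from_local F a b (e / (b - a + 1))); [|exact Hab|].
    + apply Rdiv_lt_0_compat; lra.
    + intros x Hx. apply H; [exact Hx|]. apply Rdiv_lt_0_compat; lra.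
  - replace e with (e / (b - a + 1) * (b - a + 1)) at 2 by (field; lra).
    apply Rmult_le_compat_l; [|lra]. apply Rlt_le, Rdiv_lt_0_compat; lra.
Qed.

(** The derivative at [t] of [F] restricted to [D]: it covers one-sided
    derivatives at the ends of a time interval. *)
Definition rderiv {V : NormedModule C_AbsRing} (D : R -> Prop) (F : R -> V)
    (t : R) (l : V) : Prop :=
  forall eta, 0 < eta -> exists d, 0 < d /\
    forall s, D s -> Rabs (s - t) < d ->
      norm (minus (minus (F s) (F t)) ((s - t) *: l))
        <= eta * Rabs (s - t).

Definition ncont {V : NormedModule C_AbsRing} (f : R -> V) (t : R) : Prop :=
  forall eps, 0 < eps -> exists d, 0 < d /\
    forall s, Rabs (s - t) < d -> norm (minus (f s) (f t)) < eps.

Definition between (a b t : R) : Prop := a <= t <= b \/ b <= t <= a.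

Definition everywhere (t : R) : Prop := True.

Lemma rderiv_mono {V : NormedModule C_AbsRing} (D D' : R -> Prop) (F : R -> V) t l :
  (forall s, D' s -> D s) -> rderiv D F t l -> rderiv D' F t l.
Proof.
  intros HD H eta He. destruct (H eta He) as [d [Hd Hs]].
  exists d. split; [exact Hd|]. intros s Ds. apply Hs, HD, Ds.
Qed.

Lemma norm_scal_R {V : NormedModule C_AbsRing} (r : R) (l : V) :
  norm (r *: l) <= Rabs r * norm l.
Proof. rewrite -Cmod_R. apply (norm_scal (RtoC r : C_AbsRing) l). Qed.

Lemma minus_scal_zero {V : NormedModule C_AbsRing} (r : R) (u : V) :
  minus u (r *: zero) = u.
Proof.
  transitivity (minus u zero); [|exact (minus_zero_r u)].
  apply (f_equal (minus u)). exact (scal_zero_r (RtoC r : C_AbsRing)).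
Qed.

(** Stands in for the mean value theorem, which fails for vector-valued
    functions; identities between curves are proved by it. *)
Lemma rderiv_zero_const {V : NormedModule C_AbsRing} (F : R -> V) (a b : R) :
  a <= b ->
  (forall x, a <= x <= b -> rderiv (fun t => a <= t <= b) F x zero) ->
  F b = F a.
Proof.
  intros Hab H. apply const_from_local; [exact Hab|].
  intros x eta Hx He. destruct (H x Hx eta He) as [d [Hd Hs]].
  exists d. split; [exact Hd|]. intros y Hy1 Hy2. specialize (Hs y Hy1 Hy2).
  eapply Rle_trans; [|exact Hs].
  right. apply f_equal. symmetry. apply minus_scal_zero.
Qed.

Lemma rderiv_local {V : NormedModule C_AbsRing} (D : R -> Prop) (F G : R -> V) t l r :
  0 < r -> (forall s, D s -> Rabs (s - t) < r -> F s = G s) -> F t = G t ->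
  rderiv D F t l -> rderiv D G t l.
Proof.
  intros Hr HFG Ht H eta He. destruct (H eta He) as [d [Hd Hs]].
  exists (Rmin d r). split; [apply Rmin_glb_lt; assumption|].
  intros s Ds Hst.
  destruct (Rlt_Rmin _ _ _ Hst) as [? ?].
  rewrite -(HFG s) //. rewrite -Ht. apply Hs; assumption.
Qed.

Lemma rderiv_minus {V : NormedModule C_AbsRing} (D : R -> Prop) (F G : R -> V) t l m :
  rderiv D F t l -> rderiv D G t m ->
  rderiv D (fun s => minus (F s) (G s)) t (minus l m).
Proof.
  intros HF HG eta He.
  destruct (HF (eta / 2) ltac:(lra)) as [d1 [Hd1 H1]].
  destruct (HG (eta / 2) ltac:(lra)) as [d2 [Hd2 H2]].
  exists (Rmin d1 d2). split; [apply Rmin_glb_lt; assumption|].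
  intros s Ds Hst.
  destruct (Rlt_Rmin _ _ _ Hst) as [? ?].
  specialize (H1 s Ds ltac:(assumption)). specialize (H2 s Ds ltac:(assumption)).
  rewrite minus_minus_minus.
  replace ((s - t) *: (minus l m)) with
    (minus ((s - t) *: l) ((s - t) *: m)).
  2:{ symmetry. exact (scal_minus_distr_l (RtoC (s - t) : C_AbsRing) l m). }
  rewrite (minus_minus_minus (minus (F s) (F t))).
  eapply Rle_trans; [apply norm_minus_le|].
  eapply Rle_trans; [apply Rplus_le_compat; [exact H1|exact H2]|lra].
Qed.

Lemma rderiv_plus {V : NormedModule C_AbsRing} (D : R -> Prop) (F G : R -> V) t l m :
  rderiv D F t l -> rderiv D G t m ->
  rderiv D (fun s => plus (F s) (G s)) t (plus l m).
Proof.
  intros HF HG eta He.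
  destruct (HF (eta / 2) ltac:(lra)) as [d1 [Hd1 H1]].
  destruct (HG (eta / 2) ltac:(lra)) as [d2 [Hd2 H2]].
  exists (Rmin d1 d2). split; [apply Rmin_glb_lt; assumption|].
  intros s Ds Hst.
  destruct (Rlt_Rmin _ _ _ Hst) as [? ?].
  specialize (H1 s Ds ltac:(assumption)). specialize (H2 s Ds ltac:(assumption)).
  replace ((s - t) *: (plus l m)) with
    (plus ((s - t) *: l) ((s - t) *: m)).
  2:{ symmetry. exact (scal_distr_l (RtoC (s - t) : C_AbsRing) l m). }
  rewrite (minus_plus_plus (F s) (G s)) (minus_plus_plus (minus (F s) (F t))).
  eapply Rle_trans; [apply norm_triangle|].
  eapply Rle_trans; [apply Rplus_le_compat; [exact H1|exact H2]|lra].
Qed.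

Record real_linear {V W : NormedModule C_AbsRing} (L : V -> W) : Prop := {
  real_linear_plus : forall x y, L (plus x y) = plus (L x) (L y);
  real_linear_scal : forall (r : R) x,
    L (r *: x) = r *: (L x);
  real_linear_bound : exists M, 0 < M /\ forall x, norm (L x) <= M * norm x }.

Lemma real_linear_minus {V W : NormedModule C_AbsRing} (L : V -> W) x y :
  real_linear L -> L (minus x y) = minus (L x) (L y).
Proof.
  intros [HP HS _]. unfold minus. rewrite HP. f_equal.
  assert (E : forall (U : NormedModule C_AbsRing) (u : U), opp u = (-1) *: u).
  { intros U u. rewrite RtoC_opp. symmetry. exact (scal_opp_one u). }
  rewrite !E. apply HS.
Qed.

Lemma rderiv_linear {V W : NormedModule C_AbsRing} (L : V -> W) D F t l :
  real_linear L -> rderiv D F t l -> rderiv D (fun s => L (F s)) t (L l).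
Proof.
  intros HL HF eta He. destruct (real_linear_bound L HL) as [M [HM HB]].
  destruct (HF (eta / M)) as [d [Hd H]].
  { apply Rdiv_lt_0_compat; assumption. }
  exists d. split; [exact Hd|]. intros s Ds Hs. specialize (H s Ds Hs).
  rewrite -(real_linear_scal L HL) -!(fun x y => real_linear_minus L x y HL).
  eapply Rle_trans; [apply HB|].
  eapply Rle_trans; [apply Rmult_le_compat_l; [lra|exact H]|].
  right. field. lra.
Qed.

Lemma ncont_linear {V W : NormedModule C_AbsRing} (L : V -> W) f t :
  real_linear L -> ncont f t -> ncont (fun s => L (f s)) t.
Proof.
  intros HL Hf e He. destruct (real_linear_bound L HL) as [M [HM HB]].
  destruct (Hf (e / M)) as [d [Hd H]].
  { apply Rdiv_lt_0_compat; assumption. }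
  exists d. split; [exact Hd|]. intros s Hs. specialize (H s Hs).
  rewrite -(real_linear_minus L _ _ HL).
  eapply Rle_lt_trans; [apply HB|].
  eapply Rlt_le_trans; [apply Rmult_lt_compat_l; [lra|exact H]|].
  right. field. lra.
Qed.

Lemma rderiv_near {V : NormedModule C_AbsRing} D (F : R -> V) t l e :
  rderiv D F t l -> 0 < e ->
  exists d, 0 < d /\ forall s, D s -> Rabs (s - t) < d -> norm (minus (F s) (F t)) < e.
Proof.
  intros HF He. destruct (HF 1 ltac:(lra)) as [d [Hd H]].
  pose proof (norm_ge_0 l) as Hl.
  exists (Rmin d (e / (norm l + 2))). split.
  { apply Rmin_glb_lt; [assumption|]. apply Rdiv_lt_0_compat; lra. }
  intros s Ds Hs.
  destruct (Rlt_Rmin _ _ _ Hs) as [H1 H2].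
  specialize (H s Ds H1).
  pose proof (norm_le_minus (minus (F s) (F t)) ((s - t) *: l)) as H3.
  pose proof (norm_scal_R (s - t) l) as H4.
  apply Rlt_div_r in H2; [|lra].
  pose proof (Rabs_pos (s - t)). nra.
Qed.

Lemma rderiv_ncont {V : NormedModule C_AbsRing} (F : R -> V) t l :
  rderiv everywhere F t l -> ncont F t.
Proof.
  intros HF e He. destruct (rderiv_near everywhere F t l e HF He) as [d [Hd H]].
  exists d. split; [exact Hd|]. intros s Hs. apply H; [exact I|exact Hs].
Qed.

Lemma rderiv_mono_local {V : NormedModule C_AbsRing} (D D' : R -> Prop) (F : R -> V) t l d :
  0 < d -> (forall s, D' s -> Rabs (s - t) < d -> D s) -> rderiv D F t l -> rderiv D' F t l.
Proof.
  intros Hd HD H eta He. destruct (H eta He) as [d' [Hd' Hs]].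
  exists (Rmin d d'). split; [apply Rmin_glb_lt; assumption|].
  intros s Ds Hst. apply Hs; [apply (HD s Ds)|]; (eapply Rlt_le_trans; [exact Hst|]); [apply Rmin_l|apply Rmin_r].
Qed.

Lemma rderiv_flip {V : NormedModule C_AbsRing} (D : R -> Prop) (F : R -> V) c s k :
  rderiv D F (c - s) k -> rderiv (fun x => D (c - x)) (fun x => F (c - x)) s (opp k).
Proof.
  intros H eta He. destruct (H eta He) as [d [Hd Hs]]. exists d. split; [exact Hd|].
  intros x Dx Hx.
  assert (E : Rabs ((c - x) - (c - s)) = Rabs (x - s)).
  { rewrite -Rabs_Ropp. f_equal. ring. }
  specialize (Hs (c - x) Dx ltac:(rewrite E; exact Hx)). rewrite E in Hs.
  eapply Rle_trans; [|exact Hs]. right. apply f_equal, f_equal.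
  transitivity (opp ((x - s) *: k)); [exact (scal_opp_r (RtoC (x - s) : C_AbsRing) k)|].
  transitivity (scal (opp (RtoC (x - s) : C_AbsRing)) k); [symmetry; exact (scal_opp_l (RtoC (x - s) : C_AbsRing) k)|].
  apply (f_equal (fun a : C_AbsRing => scal a k)).
  change (opp (RtoC (x - s) : C_AbsRing)) with (- RtoC (x - s))%C. rewrite -RtoC_opp. f_equal. ring.
Qed.

Lemma real_linear_comp {U V W : NormedModule C_AbsRing} (L : U -> V) (K : V -> W) :
  real_linear L -> real_linear K -> real_linear (fun x => K (L x)).
Proof.
  intros [Lp Ls [M [HM LM]]] [Kp Ks [N [HN KN]]]. split.
  - intros x y. rewrite Lp. apply Kp.
  - intros r x. rewrite Ls. apply Ks.
  - exists (N * M). split; [apply Rmult_lt_0_compat; assumption|].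
    intro x. eapply Rle_trans; [apply KN|]. rewrite Rmult_assoc. apply Rmult_le_compat_l; [lra|apply LM].
Qed.

Lemma rderiv_shift {V : NormedModule C_AbsRing} (D : R -> Prop) (F : R -> V) a t l :
  rderiv D F (a + t) l -> rderiv (fun s => D (a + s)) (fun s => F (a + s)) t l.
Proof.
  intros H eta He. destruct (H eta He) as [d [Hd Hs]]. exists d. split; [exact Hd|].
  intros s Ds Hst. replace (s - t) with ((a + s) - (a + t)) in * by ring. apply Hs; assumption.
Qed.

Lemma ncont_minus {V : NormedModule C_AbsRing} (f g : R -> V) t :
  ncont f t -> ncont g t -> ncont (fun s => minus (f s) (g s)) t.
Proof.
  intros HF HG eta He.
  destruct (HF (eta / 2) ltac:(lra)) as [d1 [Hd1 H1]].
  destruct (HG (eta / 2) ltac:(lra)) as [d2 [Hd2 H2]].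
  exists (Rmin d1 d2). split; [apply Rmin_glb_lt; assumption|].
  intros s Hst.
  destruct (Rlt_Rmin _ _ _ Hst) as [? ?].
  specialize (H1 s ltac:(assumption)). specialize (H2 s ltac:(assumption)).
  rewrite (minus_minus_minus (f s) (g s)).
  eapply Rle_lt_trans; [apply norm_minus_le|].
  eapply Rlt_le_trans; [apply Rplus_lt_compat; [exact H1|exact H2]|lra].
Qed.

Lemma ncont_const {V : NormedModule C_AbsRing} (c : V) t : ncont (fun _ => c) t.
Proof. intros e He. exists 1. split; [lra|]. intros. rewrite norm_minus_self. exact He. Qed.

Lemma rderiv_const {V : NormedModule C_AbsRing} D (c : V) t : rderiv D (fun _ => c) t zero.
Proof.
  intros e He. exists 1. split; [lra|]. intros s _ _.
  replace (norm _) with 0.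
  2:{ symmetry. etransitivity; [apply f_equal, minus_scal_zero|]. apply norm_minus_self. }
  pose proof (Rabs_pos (s - t)). nra.
Qed.

(** * Riemann integrals of vector-valued curves *)

Lemma ncont_continuous {V : CompleteNormedModule C_AbsRing} (f : R -> V) t :
  ncont f t <-> continuous (f : R -> restrict_scalars V) t.
Proof.
  split.
  - intros H P [e He]. destruct (H e (cond_pos e)) as [d [Hd Hs]].
    exists (mkposreal d Hd). intros s Hst. apply He.
    apply (@norm_compat1 _ V). apply Hs. exact Hst.
  - intros H e He.
    assert (Hnf := @norm_factor_gt_0 _ V).
    assert (He' : 0 < e / @norm_factor _ V) by (apply Rdiv_lt_0_compat; assumption).
    destruct (H (ball (f t : restrict_scalars V) (mkposreal _ He'))) as [d Hd].
    { exists (mkposreal _ He'). intros y Hy. exact Hy. }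
    exists d. split; [apply cond_pos|]. intros s Hs.
    specialize (Hd s Hs). apply (@norm_compat2 _ V) in Hd. simpl in Hd.
    replace e with (@norm_factor _ V * (e / @norm_factor _ V)) by (field; lra). exact Hd.
Qed.

Definition vint {V : CompleteNormedModule C_AbsRing} (f : R -> V) (a b : R) : V :=
  RInt (f : R -> restrict_scalars V) a b.

Section Integral.
Context {V : CompleteNormedModule C_AbsRing}.
Implicit Types f g : R -> V.

Lemma between_minmax a b t : Rmin a b <= t <= Rmax a b -> between a b t.
Proof.
  unfold between. destruct (Rle_dec a b).
  - rewrite (Rmin_left a b r) (Rmax_right a b r). lra.
  - rewrite (Rmin_right a b); [|lra]. rewrite (Rmax_left a b); lra.
Qed.

Lemma ex_vint f a b :
  (forall t, between a b t -> ncont f t) -> ex_RInt (f : R -> restrict_scalars V) a b.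
Proof.
  intro H. apply ex_RInt_continuous. intros t Ht. apply ncont_continuous, H, between_minmax, Ht.
Qed.

Lemma vint_norm_le f a b B :
  a <= b -> (forall t, a <= t <= b -> ncont f t) ->
  (forall t, a <= t <= b -> norm (f t) <= B) ->
  norm (vint f a b) <= B * (b - a).
Proof.
  intros Hab Hc HB.
  replace (B * (b - a)) with (scal (b - a) B : R).
  2:{ unfold scal; simpl; unfold mult; simpl; ring. }
  apply (@norm_RInt_le (restrict_scalars V) f (fun _ => B) a b (vint f a b) (scal (b - a) B) Hab HB).
  - apply (@RInt_correct (restrict_scalars V)), ex_vint.
    intros t [Ht|Ht]; apply Hc; lra.
  - apply (@is_RInt_const R_NormedModule).
Qed.

Lemma vint_chasles f a b c :
  (forall t, between a b t -> ncont f t) -> (forall t, between b c t -> ncont f t) ->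
  plus (vint f a b) (vint f b c) = vint f a c.
Proof.
  intros H1 H2. apply (@RInt_Chasles (restrict_scalars V)); apply ex_vint; assumption.
Qed.

Lemma vint_ext f g a b :
  (forall t, between a b t -> f t = g t) -> vint f a b = vint g a b.
Proof.
  intro H. apply (@RInt_ext (restrict_scalars V)). intros x Hx. apply H, between_minmax; lra.
Qed.

Lemma vint_swap f a b :
  (forall t, between a b t -> ncont f t) -> vint f b a = opp (vint f a b).
Proof.
  intros H. symmetry. apply (@opp_RInt_swap (restrict_scalars V)), ex_vint, H.
Qed.

Lemma vint_point f a : vint f a a = zero.
Proof. apply (@RInt_point (restrict_scalars V)). Qed.

Lemma vint_minus f g a b :
  (forall t, between a b t -> ncont f t) -> (forall t, between a b t -> ncont g t) ->
  vint (fun t => minus (f t) (g t)) a b = minus (vint f a b) (vint g a b).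
Proof.
  intros H1 H2. apply (@RInt_minus (restrict_scalars V)); apply ex_vint; assumption.
Qed.

Lemma vint_const (c : V) a b : vint (fun _ => c) a b = (b - a) *: c.
Proof. apply (@RInt_const (restrict_scalars V)). Qed.

Lemma vint_norm_le_abs f a b B :
  (forall t, between a b t -> ncont f t) ->
  (forall t, between a b t -> norm (f t) <= B) ->
  norm (vint f a b) <= B * Rabs (b - a).
Proof.
  intros Hc HB. destruct (Rle_dec a b) as [Hab|Hab].
  - rewrite (Rabs_right (b - a)); [|lra]. apply vint_norm_le; [exact Hab| |]; intros t Ht; [apply Hc|apply HB]; left; lra.
  - rewrite (vint_swap f b a); [|intros t Ht; apply Hc; unfold between in *; lra].
    eapply Rle_trans; [right; exact (norm_opp (vint f b a))|].
    rewrite (Rabs_left (b - a)); [|lra]. replace (- (b - a)) with (a - b) by ring.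
    apply vint_norm_le; [lra| |]; intros t Ht; [apply Hc|apply HB]; right; lra.
Qed.

Lemma vint_rderiv D f a t :
  (forall s, D s -> forall r, between a s r \/ between t s r \/ between a t r -> ncont f r) ->
  D t ->
  rderiv D (fun x => vint f a x) t (f t).
Proof.
  intros Hc Dt eta He.
  assert (Hct : ncont f t). { apply (Hc t Dt). right; left. unfold between; lra. }
  destruct (Hct eta He) as [d [Hd H]].
  exists d. split; [exact Hd|]. intros s Ds Hs.
  pose proof (Hc s Ds) as Hcs.
  rewrite -(vint_chasles f a t s).
  2,3: intros r Hr; apply Hcs; auto.
  rewrite minus_plus_l -vint_const -(vint_minus f (fun _ => f t)).
  2: intros r Hr; apply Hcs; auto. 2: intros r Hr; apply ncont_const.
  apply vint_norm_le_abs.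
  - intros r Hr. apply (ncont_minus f (fun _ => f t)); [apply Hcs; auto|apply ncont_const].
  - intros r Hr. apply Rlt_le, H. eapply Rle_lt_trans; [|exact Hs].
    unfold between in Hr. unfold Rabs. repeat destruct Rcase_abs; lra.
Qed.

(** The difference with the indefinite integral has zero derivative. *)
Lemma vint_of_deriv f F a b :
  a <= b -> (forall t, a <= t <= b -> ncont f t) ->
  (forall t, a <= t <= b -> rderiv (fun t => a <= t <= b) F t (f t)) ->
  vint f a b = minus (F b) (F a).
Proof.
  intros Hab Hc HF.
  assert (E : minus (F b) (vint f a b) = minus (F a) (vint f a a)).
  { apply (rderiv_zero_const (fun t => minus (F t) (vint f a t))); [exact Hab|].
    intros x Hx. rewrite -(minus_eq_zero (f x)). apply (rderiv_minus _ F (fun t => vint f a t)); [apply HF, Hx|].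
    apply vint_rderiv; [|exact Hx]. intros s Hs r Hr. apply Hc. unfold between in Hr. lra. }
  rewrite vint_point minus_zero_r in E.
  rewrite -E minus_minus_cancel. reflexivity.
Qed.

End Integral.

(** Both sides have the same derivative in the upper bound. *)
Lemma vint_linear {V W : CompleteNormedModule C_AbsRing} (L : V -> W) f a b :
  real_linear L -> a <= b -> (forall t, a <= t <= b -> ncont f t) ->
  vint (fun t => L (f t)) a b = L (vint f a b).
Proof.
  intros HL Hab Hc.
  rewrite (vint_of_deriv (fun t => L (f t)) (fun t => L (vint f a t)) a b Hab).
  - rewrite -(real_linear_minus L _ _ HL). rewrite vint_point minus_zero_r. reflexivity.
  - intros t Ht. apply ncont_linear; [exact HL|apply Hc, Ht].
  - intros t Ht. apply rderiv_linear; [exact HL|].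
    apply vint_rderiv; [|exact Ht]. intros s Hs r Hr. apply Hc. unfold between in Hr. lra.
Qed.

Notation ccurve_cont := (@ncont C_NormedModule).
Notation crderiv := (@rderiv C_NormedModule).

(** * Complex derivatives and complex-valued curves *)

Definition cder (f : C -> C) (z l : C) : Prop :=
  forall eta, 0 < eta -> exists d, 0 < d /\
    forall w, Cmod (w - z) < d ->
      Cmod (f w - f z - l * (w - z)) <= eta * Cmod (w - z).

Lemma is_derive_cder (f : C -> C) (z l : C) :
  is_derive (K := C_AbsRing) (V := C_NormedModule) f z l <-> cder f z l.
Proof.
  split.
  - intros [_ H] eta He.
    specialize (H z (fun P HP => HP) (mkposreal eta He)).
    destruct H as [d Hd]. exists d. split; [apply cond_pos|].
    intros w Hw. specialize (Hd w Hw). simpl in Hd.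
    rewrite (Cmult_comm l). exact Hd.
  - intro H. split.
    + apply is_linear_scal_l.
    + intros x Hx.
      assert (E : z = x) by (apply (is_filter_lim_locally_unique (V := AbsRing_NormedModule C_AbsRing)); exact Hx).
      subst x. intros [eta He]. destruct (H eta He) as [d [Hd Hs]].
      exists (mkposreal d Hd). intros w Hw. specialize (Hs w Hw). simpl.
      rewrite (Cmult_comm l) in Hs. exact Hs.
Qed.

(** The field of complex numbers carries two normed module structures with
    the same norm but different uniform structures: the one of the ring, for
    which the product and chain rules are stated, and the product one of
    [is_derive_cder]. *)
Lemma is_derive_ring_cder (f : C -> C) (z l : C) :
  is_derive (K := C_AbsRing) (V := AbsRing_NormedModule C_AbsRing) f z l <-> cder f z l.
Proof.
  split.
  - intros [_ H] eta He.
    specialize (H z (fun P HP => HP) (mkposreal eta He)).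
    destruct H as [d Hd]. exists d. split; [apply cond_pos|].
    intros w Hw. specialize (Hd w Hw). simpl in Hd.
    rewrite (Cmult_comm l). exact Hd.
  - intro H. split.
    + apply (is_linear_scal_l (V := AbsRing_NormedModule C_AbsRing)).
    + intros x Hx.
      assert (E : z = x) by (apply (is_filter_lim_locally_unique (V := AbsRing_NormedModule C_AbsRing)); exact Hx).
      subst x. intros [eta He]. destruct (H eta He) as [d [Hd Hs]].
      exists (mkposreal d Hd). intros w Hw. specialize (Hs w Hw). simpl.
      rewrite (Cmult_comm l) in Hs. exact Hs.
Qed.

Lemma ex_derive_cder (f : C -> C) (z : C) :
  ex_derive (K := C_AbsRing) (V := C_NormedModule) f z <-> exists l, cder f z l.
Proof.
  split; intros [l H]; exists l; apply is_derive_cder; exact H.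
Qed.

Lemma cder_C_derive f z : (exists l, cder f z l) -> cder f z (C_derive f z).
Proof.
  intro H. apply is_derive_cder, C_derive_correct; [exact z|].
  apply ex_derive_cder, H.
Qed.

Lemma Cmod_minus_sym (a b : C) : Cmod (a - b) = Cmod (b - a).
Proof. rewrite -Cmod_opp. f_equal. ring. Qed.

Lemma Cmod_minus_self (a : C) : Cmod (a - a) = 0.
Proof. replace (a - a)%C with (RtoC 0) by ring. apply Cmod_0. Qed.

Lemma Cmod_minus_triangle (b a c : C) : Cmod (a - c) <= Cmod (a - b) + Cmod (b - c).
Proof. replace (a - c)%C with ((a - b) + (b - c))%C by ring. apply Cmod_triangle. Qed.

Lemma Cmod_minus_le (a b : C) : Cmod (a - b) <= Cmod a + Cmod b.
Proof. rewrite -(Cmod_opp b). apply Cmod_triangle. Qed.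

Lemma Cmod_le_minus (a b : C) : Cmod a <= Cmod b + Cmod (a - b).
Proof. replace a with (b + (a - b))%C at 1 by ring. apply Cmod_triangle. Qed.

Lemma Cminus_eq_zero (a b : C) : (a - b)%C = 0 -> a = b.
Proof. intro H. replace a with ((a - b) + b)%C by ring. rewrite H. ring. Qed.

Lemma Cmod_minus_pos (a b : C) : a <> b -> 0 < Cmod (a - b).
Proof. intro H. apply Cmod_gt_0. intro E. apply H, Cminus_eq_zero, E. Qed.

Definition ccont (f : C -> C) (z : C) : Prop :=
  forall eps, 0 < eps -> exists d, 0 < d /\
    forall w, Cmod (w - z) < d -> Cmod (f w - f z) < eps.

Lemma cder_ccont f z l : cder f z l -> ccont f z.
Proof.
  intros H e He. destruct (H 1 ltac:(lra)) as [d [Hd Hs]].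
  pose proof (Cmod_ge_0 l) as Hl.
  exists (Rmin d (e / (Cmod l + 2))). split.
  { apply Rmin_glb_lt; [assumption|]. apply Rdiv_lt_0_compat; lra. }
  intros w Hw.
  destruct (Rlt_Rmin _ _ _ Hw) as [H1 H2].
  specialize (Hs w H1).
  pose proof (Cmod_le_minus (f w - f z)%C (l * (w - z))%C) as H3.
  rewrite Cmod_mult in H3.
  apply Rlt_div_r in H2; [|lra].
  pose proof (Cmod_ge_0 (w - z)%C). nra.
Qed.

Lemma cder_ext_loc f g z l r :
  0 < r -> (forall w, Cmod (w - z) < r -> f w = g w) -> cder f z l -> cder g z l.
Proof.
  intros Hr E H eta He. destruct (H eta He) as [d [Hd Hs]].
  exists (Rmin d r). split; [apply Rmin_glb_lt; assumption|].
  intros w Hw.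
  destruct (Rlt_Rmin _ _ _ Hw) as [H1 H2].
  rewrite -(E w H2) -(E z); [apply Hs, H1|].
  rewrite Cmod_minus_self. exact Hr.
Qed.

Lemma cder_const (c z : C) : cder (fun _ => c) z 0.
Proof. apply is_derive_cder. exact (is_derive_const (V := C_NormedModule) c z). Qed.

Lemma cder_id (z : C) : cder (fun w => w) z 1.
Proof. apply is_derive_ring_cder. exact (is_derive_id (K := C_AbsRing) z). Qed.

Lemma cder_plus f g z l m : cder f z l -> cder g z m -> cder (fun w => f w + g w)%C z (l + m)%C.
Proof.
  intros Hf%is_derive_cder Hg%is_derive_cder. apply is_derive_cder.
  exact (is_derive_plus (V := C_NormedModule) f g z l m Hf Hg).
Qed.

Lemma cder_minus f g z l m : cder f z l -> cder g z m -> cder (fun w => f w - g w)%C z (l - m)%C.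
Proof.
  intros Hf%is_derive_cder Hg%is_derive_cder. apply is_derive_cder.
  exact (is_derive_minus (V := C_NormedModule) f g z l m Hf Hg).
Qed.

Lemma cder_mult f g z l m :
  cder f z l -> cder g z m -> cder (fun w => f w * g w)%C z (l * g z + f z * m)%C.
Proof.
  intros Hf%is_derive_ring_cder Hg%is_derive_ring_cder. apply is_derive_ring_cder.
  exact (is_derive_mult (K := C_AbsRing) f g z l m Hf Hg Cmult_comm).
Qed.

Lemma cder_comp f g z l m :
  cder f (g z) l -> cder g z m -> cder (fun w => f (g w)) z (m * l)%C.
Proof.
  intros Hf%is_derive_cder Hg%is_derive_ring_cder. apply is_derive_cder.
  exact (is_derive_comp (K := C_AbsRing) (V := C_NormedModule) f g z l m Hf Hg).
Qed.

Lemma cder_inv_id (z : C) : z <> 0 -> cder (fun w => / w)%C z (- / (z * z))%C.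
Proof.
  intros Hz eta He.
  pose proof (proj1 (Cmod_gt_0 z) Hz) as Hm.
  exists (Rmin (Cmod z / 2) (eta * (Cmod z * Cmod z * Cmod z) / 2)). split.
  { apply Rmin_glb_lt; [lra|]. apply Rdiv_lt_0_compat; [|lra].
    repeat apply Rmult_lt_0_compat; assumption. }
  intros w Hw.
  destruct (Rlt_Rmin _ _ _ Hw) as [H1 H2].
  assert (Hwm : Cmod z / 2 < Cmod w).
  { pose proof (Cmod_le_minus z w) as L. rewrite Cmod_minus_sym in L. lra. }
  assert (Hw0 : w <> 0). { apply Cmod_gt_0. lra. }
  replace (/ w - / z - - / (z * z) * (w - z))%C with
    ((w - z) * (w - z) / (w * (z * z)))%C by (field; auto).
  assert (w * (z * z) <> 0)%C by (repeat apply Cmult_neq_0; assumption).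
  rewrite Cmod_div // !Cmod_mult.
  assert (Hd : 0 < Cmod w * (Cmod z * Cmod z)) by (repeat apply Rmult_lt_0_compat; lra).
  apply (Rmult_le_reg_r (Cmod w * (Cmod z * Cmod z))); [exact Hd|].
  replace (Cmod (w - z) * Cmod (w - z) / (Cmod w * (Cmod z * Cmod z)) * (Cmod w * (Cmod z * Cmod z)))
    with (Cmod (w - z) * Cmod (w - z)) by (field; split; lra).
  pose proof (Cmod_ge_0 (w - z)%C).
  assert (Cmod (w - z) <= eta * (Cmod w * (Cmod z * Cmod z))).
  { eapply Rle_trans; [apply Rlt_le, H2|].
    replace (eta * (Cmod z * Cmod z * Cmod z) / 2) with (eta * ((Cmod z / 2) * (Cmod z * Cmod z))) by field.
    apply Rmult_le_compat_l; [lra|]. apply Rmult_le_compat_r; [nra|lra]. }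
  nra.
Qed.

Lemma cder_inv (f : C -> C) z l : f z <> 0 -> cder f z l -> cder (fun w => / f w)%C z (- (l / (f z * f z)))%C.
Proof.
  intros Hz Hf.
  replace (- (l / (f z * f z)))%C with (l * (- / (f z * f z)))%C by (field; auto).
  apply (cder_comp Cinv f); [apply cder_inv_id, Hz|exact Hf].
Qed.

Lemma ccont_minus f g z : ccont f z -> ccont g z -> ccont (fun w => f w - g w)%C z.
Proof.
  intros HF HG eta He.
  destruct (HF (eta / 2) ltac:(lra)) as [d1 [Hd1 H1]].
  destruct (HG (eta / 2) ltac:(lra)) as [d2 [Hd2 H2]].
  exists (Rmin d1 d2). split; [apply Rmin_glb_lt; assumption|].
  intros w Hw.
  destruct (Rlt_Rmin _ _ _ Hw) as [E1 E2].
  specialize (H1 w E1). specialize (H2 w E2).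
  replace (f w - g w - (f z - g z))%C with ((f w - f z) - (g w - g z))%C by ring.
  eapply Rle_lt_trans; [apply Cmod_minus_le|]. lra.
Qed.


Lemma ncont_comp (f : C -> C) (g : R -> C) t :
  ccont f (g t) -> ccurve_cont g t -> ccurve_cont (fun s => f (g s)) t.
Proof.
  intros Hf Hg e He. destruct (Hf e He) as [d [Hd H]].
  destruct (Hg d Hd) as [d' [Hd' H']]. exists d'. split; [exact Hd'|].
  intros s Hs. apply H. apply H', Hs.
Qed.

Lemma ncont_Cconst (c : C) t : ccurve_cont (fun _ => c) t.
Proof. apply (@ncont_const C_NormedModule). Qed.

Lemma ncont_Cminus (f g : R -> C) t :
  ccurve_cont f t -> ccurve_cont g t -> ccurve_cont (fun s => f s - g s)%C t.
Proof. exact (@ncont_minus C_NormedModule f g t). Qed.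

Lemma ncont_mult (f g : R -> C) t :
  ccurve_cont f t -> ccurve_cont g t -> ccurve_cont (fun s => f s * g s)%C t.
Proof.
  intros HF HG eta He.
  pose proof (Cmod_ge_0 (f t)) as Pf. pose proof (Cmod_ge_0 (g t)) as Pg.
  set (M := Cmod (f t) + Cmod (g t) + 1).
  destruct (HF (Rmin 1 (eta / (2 * M)))) as [d1 [Hd1 H1]].
  { apply Rmin_glb_lt; [lra|]. apply Rdiv_lt_0_compat; unfold M; lra. }
  destruct (HG (eta / (2 * M))) as [d2 [Hd2 H2]].
  { apply Rdiv_lt_0_compat; unfold M; lra. }
  exists (Rmin d1 d2). split; [apply Rmin_glb_lt; assumption|].
  intros w Hw.
  destruct (Rlt_Rmin _ _ _ Hw) as [E1 E2].
  specialize (H1 w E1). specialize (H2 w E2).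
  change (Cmod (f w - f t) < Rmin 1 (eta / (2 * M))) in H1.
  change (Cmod (g w - g t) < (eta / (2 * M))) in H2.
  destruct (Rlt_Rmin _ _ _ H1) as [H1a H1b].
  change (Cmod (f w * g w - f t * g t) < eta).
  replace (f w * g w - f t * g t)%C with ((f w - f t) * g t + f w * (g w - g t))%C by ring.
  eapply Rle_lt_trans; [apply Cmod_triangle|]. rewrite !Cmod_mult.
  pose proof (Cmod_le_minus (f w) (f t)) as L.
  pose proof (Cmod_ge_0 (f w - f t)%C). pose proof (Cmod_ge_0 (g w - g t)%C).
  assert (Hq : eta / (2 * M) * M = eta / 2) by (field; unfold M; lra).
  assert (0 < eta / (2 * M)) by (apply Rdiv_lt_0_compat; unfold M; lra).
  assert (Cmod (f w - f t) * Cmod (g t) <= eta / (2 * M) * Cmod (g t)) by nra.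
  assert (Cmod (f w) * Cmod (g w - g t) <= (Cmod (f t) + 1) * (eta / (2 * M))).
  { apply Rmult_le_compat; try lra. apply Cmod_ge_0. }
  unfold M in *. nra.
Qed.

Lemma rderiv_comp (f : C -> C) D (g : R -> C) t l m :
  cder f (g t) l -> crderiv D g t m -> crderiv D (fun s => f (g s)) t (l * m)%C.
Proof.
  intros Hf Hg eta He.
  pose proof (Cmod_ge_0 l) as Pl. pose proof (Cmod_ge_0 m) as Pm.
  set (e1 := eta / (2 * (Cmod m + 1))). set (e2 := Rmin 1 (eta / (2 * (Cmod l + 1)))).
  assert (He1 : 0 < e1) by (apply Rdiv_lt_0_compat; lra).
  assert (He2 : 0 < e2) by (apply Rmin_glb_lt; [lra|apply Rdiv_lt_0_compat; lra]).
  destruct (Hf e1 He1) as [d1 [Hd1 H1]]. destruct (Hg e2 He2) as [d2 [Hd2 H2]].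
  exists (Rmin d2 (d1 / (Cmod m + 2))). split.
  { apply Rmin_glb_lt; [assumption|]. apply Rdiv_lt_0_compat; lra. }
  intros s Ds Hs.
  destruct (Rlt_Rmin _ _ _ Hs) as [E1 E2].
  specialize (H2 s Ds E1).
  change (Cmod (g s - g t - RtoC (s - t) * m) <= e2 * Rabs (s - t)) in H2.
  change (Cmod (f (g s) - f (g t) - RtoC (s - t) * (l * m)) <= eta * Rabs (s - t)).
  pose proof (Cmod_le_minus (g s - g t)%C (RtoC (s - t) * m)%C) as L.
  rewrite Cmod_mult Cmod_R in L.
  pose proof (Rabs_pos (s - t)) as Pa.
  assert (He2' : e2 <= 1) by apply Rmin_l.
  assert (He2'' : e2 <= eta / (2 * (Cmod l + 1))) by apply Rmin_r.
  assert (L2 : Cmod (g s - g t) <= (Cmod m + 1) * Rabs (s - t)) by nra.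
  assert (L3 : Cmod (g s - g t) < d1).
  { apply Rlt_div_r in E2; [|lra]. nra. }
  specialize (H1 (g s) L3).
  replace (f (g s) - f (g t) - RtoC (s - t) * (l * m))%C with
    ((f (g s) - f (g t) - l * (g s - g t)) + l * (g s - g t - RtoC (s - t) * m))%C by ring.
  eapply Rle_trans; [apply Cmod_triangle|]. rewrite Cmod_mult.
  assert (A1 : e1 * Cmod (g s - g t) <= eta / 2 * Rabs (s - t)).
  { eapply Rle_trans; [apply Rmult_le_compat_l; [lra|exact L2]|].
    right. unfold e1. field. lra. }
  assert (A2 : Cmod l * Cmod (g s - g t - RtoC (s - t) * m) <= eta / 2 * Rabs (s - t)).
  { eapply Rle_trans; [apply Rmult_le_compat_l; [lra|exact H2]|].
    rewrite -Rmult_assoc. apply Rmult_le_compat_r; [lra|].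
    eapply Rle_trans; [apply Rmult_le_compat_l; [lra|exact He2'']|].
    replace (Cmod l * (eta / (2 * (Cmod l + 1)))) with (eta / 2 * (Cmod l / (Cmod l + 1))) by (field; lra).
    rewrite -{2}(Rmult_1_r (eta / 2)). apply Rmult_le_compat_l; [lra|].
    apply (Rmult_le_reg_r (Cmod l + 1)); [lra|]. unfold Rdiv. rewrite Rmult_assoc Rinv_l; lra. }
  lra.
Qed.

Definition Cint (f : R -> C) (a b : R) : C := @vint C_CompleteNormedModule f a b.

Lemma Cint_bound f a b B :
  (forall t, between a b t -> ccurve_cont f t) ->
  (forall t, between a b t -> Cmod (f t) <= B) ->
  Cmod (Cint f a b) <= B * Rabs (b - a).
Proof. exact (@vint_norm_le_abs C_CompleteNormedModule f a b B). Qed.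

Lemma Cint_chasles f a b c :
  (forall t, between a b t -> ccurve_cont f t) -> (forall t, between b c t -> ccurve_cont f t) ->
  (Cint f a b + Cint f b c)%C = Cint f a c.
Proof. exact (@vint_chasles C_CompleteNormedModule f a b c). Qed.

Lemma Cint_ext f g a b :
  (forall t, between a b t -> f t = g t) -> Cint f a b = Cint g a b.
Proof. exact (@vint_ext C_CompleteNormedModule f g a b). Qed.

Lemma Cint_swap f a b :
  (forall t, between a b t -> ccurve_cont f t) -> Cint f b a = (- Cint f a b)%C.
Proof. exact (@vint_swap C_CompleteNormedModule f a b). Qed.

Lemma Cint_point f a : Cint f a a = 0.
Proof. exact (@vint_point C_CompleteNormedModule f a). Qed.

Lemma Cint_minus f g a b :
  (forall t, between a b t -> ccurve_cont f t) -> (forall t, between a b t -> ccurve_cont g t) ->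
  Cint (fun t => f t - g t)%C a b = (Cint f a b - Cint g a b)%C.
Proof. exact (@vint_minus C_CompleteNormedModule f g a b). Qed.

Lemma Cint_const (c : C) a b : Cint (fun _ => c) a b = (RtoC (b - a) * c)%C.
Proof. exact (@vint_const C_CompleteNormedModule c a b). Qed.

Lemma Cint_of_deriv f F a b :
  a <= b -> (forall t, a <= t <= b -> ccurve_cont f t) ->
  (forall t, a <= t <= b -> crderiv (fun t => a <= t <= b) F t (f t)) ->
  Cint f a b = (F b - F a)%C.
Proof. exact (@vint_of_deriv C_CompleteNormedModule f F a b). Qed.

Lemma real_linear_Cmult (c : C) : @real_linear C_NormedModule C_NormedModule (fun z => c * z)%C.
Proof.
  split.
  - intros x y. exact (Cmult_plus_distr_l c x y).
  - intros r x. change (c * (RtoC r * x) = RtoC r * (c * x))%C. ring.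
  - exists (Cmod c + 1). pose proof (Cmod_ge_0 c). split; [lra|].
    intros x. change (Cmod (c * x) <= (Cmod c + 1) * Cmod x). rewrite Cmod_mult.
    pose proof (Cmod_ge_0 x). nra.
Qed.

Lemma Cint_scal (c : C) f a b :
  a <= b -> (forall t, a <= t <= b -> ccurve_cont f t) ->
  Cint (fun t => c * f t)%C a b = (c * Cint f a b)%C.
Proof.
  exact (@vint_linear C_CompleteNormedModule C_CompleteNormedModule _ f a b (real_linear_Cmult c)).
Qed.

Lemma C_eq_of_le (a b : C) : (forall e, 0 < e -> Cmod (a - b) <= e) -> a = b.
Proof. exact (@eq_of_norm_minus C_AbsRing C_NormedModule a b). Qed.

(** * Goursat's lemma and primitives *)

Lemma Cmod_le_sum (x y : R) : Cmod (x, y) <= Rabs x + Rabs y.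
Proof.
  replace ((x, y) : C) with (RtoC x + Ci * RtoC y)%C.
  2:{ unfold RtoC, Ci, Cplus, Cmult; simpl. f_equal; ring. }
  eapply Rle_trans; [apply Cmod_triangle|]. rewrite Cmod_mult Cmod_Ci !Cmod_R. lra.
Qed.

Lemma Rabs_fst_le (z : C) : Rabs (fst z) <= Cmod z.
Proof. eapply Rle_trans; [apply Rmax_l|apply Rmax_Cmod]. Qed.

Lemma Rabs_snd_le (z : C) : Rabs (snd z) <= Cmod z.
Proof. eapply Rle_trans; [apply Rmax_r|apply Rmax_Cmod]. Qed.

Lemma hline_rderiv D (y t : R) : crderiv D (fun s => (s, y) : C) t (RtoC 1).
Proof.
  intros eta He. exists 1. split; [lra|]. intros s _ _.
  change (Cmod ((s, y) - (t, y) - RtoC (s - t) * 1) <= eta * Rabs (s - t)).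
  replace ((s, y) - (t, y) - RtoC (s - t) * 1)%C with (RtoC 0).
  2:{ unfold RtoC, Cminus, Cplus, Copp, Cmult; simpl. f_equal; ring. }
  rewrite Cmod_0. pose proof (Rabs_pos (s - t)). nra.
Qed.

Lemma vline_rderiv D (x t : R) : crderiv D (fun s => (x, s) : C) t Ci.
Proof.
  intros eta He. exists 1. split; [lra|]. intros s _ _.
  change (Cmod ((x, s) - (x, t) - RtoC (s - t) * Ci) <= eta * Rabs (s - t)).
  replace ((x, s) - (x, t) - RtoC (s - t) * Ci)%C with (RtoC 0).
  2:{ unfold RtoC, Ci, Cminus, Cplus, Copp, Cmult; simpl. f_equal; ring. }
  rewrite Cmod_0. pose proof (Rabs_pos (s - t)). nra.
Qed.

Lemma hline_cont (f : C -> C) (y t : R) : ccont f (t, y) -> ccurve_cont (fun s => f (s, y)) t.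
Proof.
  intro H. apply (ncont_comp f (fun s => (s, y) : C)); [exact H|].
  apply (rderiv_ncont _ _ _ (hline_rderiv everywhere y t)).
Qed.

Lemma vline_cont (f : C -> C) (x t : R) : ccont f (x, t) -> ccurve_cont (fun s => f (x, s)) t.
Proof.
  intro H. apply (ncont_comp f (fun s => (x, s) : C)); [exact H|].
  apply (rderiv_ncont _ _ _ (vline_rderiv everywhere x t)).
Qed.

Definition rect (a b c d : R) (z : C) : Prop := a <= fst z <= b /\ c <= snd z <= d.

(** The integral of [f (z) dz] along the boundary of a rectangle,
    counterclockwise. *)
Definition rect_int (f : C -> C) (a b c d : R) : C :=
  (Cint (fun t => f (t, c)) a b + Ci * Cint (fun t => f (b, t)) c d
   - Cint (fun t => f (t, d)) a b - Ci * Cint (fun t => f (a, t)) c d)%C.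

Section Rect.
Context (f : C -> C) (a b c d : R) (Hab : a <= b) (Hcd : c <= d)
  (Hf : forall z, rect a b c d z -> ccont f z).

Lemma hside_cont y t : c <= y <= d -> a <= t <= b -> ccurve_cont (fun s => f (s, y)) t.
Proof. intros. apply hline_cont, Hf. unfold rect; simpl; lra. Qed.

Lemma vside_cont x t : a <= x <= b -> c <= t <= d -> ccurve_cont (fun s => f (x, s)) t.
Proof. intros. apply vline_cont, Hf. unfold rect; simpl; lra. Qed.

Lemma rect_int_bound B :
  (forall z, rect a b c d z -> Cmod (f z) <= B) ->
  Cmod (rect_int f a b c d) <= 2 * B * ((b - a) + (d - c)).
Proof.
  intro HB. unfold rect_int.
  assert (H : forall y, c <= y <= d -> Cmod (Cint (fun t => f (t, y)) a b) <= B * (b - a)).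
  { intros y Hy. rewrite -(Rabs_right (b - a)); [|lra]. apply Cint_bound; unfold between; intros t Ht.
    - apply hside_cont; lra.
    - apply HB; unfold rect; simpl; lra. }
  assert (V : forall x, a <= x <= b -> Cmod (Ci * Cint (fun t => f (x, t)) c d) <= B * (d - c)).
  { intros x Hx. rewrite Cmod_mult Cmod_Ci Rmult_1_l.
    rewrite -(Rabs_right (d - c)); [|lra]. apply Cint_bound; unfold between; intros t Ht.
    - apply vside_cont; lra.
    - apply HB; unfold rect; simpl; lra. }
  pose proof (H c ltac:(lra)). pose proof (H d ltac:(lra)).
  pose proof (V a ltac:(lra)). pose proof (V b ltac:(lra)).
  eapply Rle_trans; [apply Cmod_minus_le|].
  eapply Rle_trans; [apply Rplus_le_compat_r, Cmod_minus_le|].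
  eapply Rle_trans; [apply Rplus_le_compat_r, Rplus_le_compat_r, Cmod_triangle|].
  lra.
Qed.

Lemma rect_int_split_x m : a <= m <= b ->
  rect_int f a b c d = (rect_int f a m c d + rect_int f m b c d)%C.
Proof.
  intro Hm. unfold rect_int.
  rewrite -(Cint_chasles (fun t => f (t, c)) a m b);
    [|unfold between; intros; apply hside_cont; lra..].
  rewrite -(Cint_chasles (fun t => f (t, d)) a m b);
    [|unfold between; intros; apply hside_cont; lra..].
  ring.
Qed.

Lemma rect_int_split_y m : c <= m <= d ->
  rect_int f a b c d = (rect_int f a b c m + rect_int f a b m d)%C.
Proof.
  intro Hm. unfold rect_int.
  rewrite -(Cint_chasles (fun t => f (a, t)) c m d);
    [|unfold between; intros; apply vside_cont; lra..].
  rewrite -(Cint_chasles (fun t => f (b, t)) c m d);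
    [|unfold between; intros; apply vside_cont; lra..].
  ring.
Qed.

(** On each side the integrand is the derivative of [F] along the side, and
    the contributions of the corners cancel. *)
Lemma rect_int_exact F : (forall z, rect a b c d z -> cder F z (f z)) -> rect_int f a b c d = 0.
Proof.
  intro HF. unfold rect_int.
  assert (H : forall y, c <= y <= d -> Cint (fun t => f (t, y)) a b = (F (b, y) - F (a, y))%C).
  { intros y Hy. apply (Cint_of_deriv _ (fun t => F (t, y))); [exact Hab|intros; apply hside_cont; lra|].
    intros t Ht. rewrite -(Cmult_1_r (f (t, y))).
    apply (rderiv_comp F _ (fun t => (t, y) : C)); [|apply hline_rderiv].
    apply HF. unfold rect; simpl; lra. }
  assert (V : forall x, a <= x <= b -> (Ci * Cint (fun t => f (x, t)) c d)%C = (F (x, d) - F (x, c))%C).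
  { intros x Hx. rewrite -Cint_scal; [|exact Hcd|intros; apply vside_cont; lra].
    apply (Cint_of_deriv _ (fun t => F (x, t))); [exact Hcd| |].
    - intros t Ht. apply (ncont_mult (fun _ => Ci)); [apply ncont_Cconst|apply vside_cont; lra].
    - intros t Ht. rewrite (Cmult_comm Ci).
      apply (rderiv_comp F _ (fun t => (x, t) : C)); [|apply vline_rderiv].
      apply HF. unfold rect; simpl; lra. }
  rewrite !H; [|lra..]. rewrite !V; [|lra..]. ring.
Qed.
End Rect.

Lemma rect_int_minus f g a b c d : a <= b -> c <= d ->
  (forall z, rect a b c d z -> ccont f z) -> (forall z, rect a b c d z -> ccont g z) ->
  rect_int (fun z => f z - g z)%C a b c d = (rect_int f a b c d - rect_int g a b c d)%C.
Proof.
  intros Hab Hcd Hf Hg. unfold rect_int.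
  rewrite (Cint_minus (fun t => f (t, c)) (fun t => g (t, c)));
    [|unfold between; intros; apply (hside_cont _ a b c d); auto; lra..].
  rewrite (Cint_minus (fun t => f (t, d)) (fun t => g (t, d)));
    [|unfold between; intros; apply (hside_cont _ a b c d); auto; lra..].
  rewrite (Cint_minus (fun t => f (a, t)) (fun t => g (a, t)));
    [|unfold between; intros; apply (vside_cont _ a b c d); auto; lra..].
  rewrite (Cint_minus (fun t => f (b, t)) (fun t => g (b, t)));
    [|unfold between; intros; apply (vside_cont _ a b c d); auto; lra..].
  ring.
Qed.

Lemma nested_intervals (x w : nat -> R) :
  (forall n, x n <= x (S n)) -> (forall n, x (S n) + w (S n) <= x n + w n) ->
  (forall n, 0 <= w n) -> exists p, forall n, x n <= p <= x n + w n.
Proof.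
  intros Hx Hy Hw.
  assert (Hxm : forall n k, x n <= x (n + k)%nat).
  { intros n k. induction k; [rewrite Nat.add_0_r; lra|]. rewrite Nat.add_succ_r. specialize (Hx (n + k)%nat). lra. }
  assert (Hym : forall n k, x (n + k)%nat + w (n + k)%nat <= x n + w n).
  { intros n k. induction k; [rewrite Nat.add_0_r; lra|]. rewrite Nat.add_succ_r. specialize (Hy (n + k)%nat). lra. }
  assert (Hub : forall n m, x m <= x n + w n).
  { intros n m. destruct (Nat.le_ge_cases n m) as [H|H].
    - replace m with (n + (m - n))%nat by lia. specialize (Hym n (m - n)%nat). specialize (Hw (n + (m - n))%nat). lra.
    - replace n with (m + (n - m))%nat by lia. specialize (Hxm m (n - m)%nat). specialize (Hw (m + (n - m))%nat). lra. }
  destruct (completeness (fun r => exists n, r = x n)) as [p [Hp1 Hp2]].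
  - exists (x 0%nat + w 0%nat). intros r [n ->]. apply Hub.
  - exists (x 0%nat), 0%nat. reflexivity.
  - exists p. intro n. split; [apply Hp1; exists n; reflexivity|].
    apply Hp2. intros r [m ->]. apply Hub.
Qed.

(** The integrals over the four quarters add up to the whole one, so one of
    them carries at least a fourth of it. *)
Lemma rect_quadrisect f x y u v : 0 <= u -> 0 <= v ->
  (forall z, rect x (x + u) y (y + v) z -> ccont f z) ->
  exists x' y', x <= x' /\ x' + u / 2 <= x + u /\ y <= y' /\ y' + v / 2 <= y + v /\
    Cmod (rect_int f x (x + u) y (y + v)) / 4 <= Cmod (rect_int f x' (x' + u / 2) y' (y' + v / 2)).
Proof.
  intros Hu Hv Hf.
  (* The quarter with lower left corner [(x', y')]. *)
  set (q := fun x' y' => rect_int f x' (x' + u / 2) y' (y' + v / 2)).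
  assert (E : rect_int f x (x + u) y (y + v) =
    (q x y + q x (y + v / 2)%R + q (x + u / 2)%R y + q (x + u / 2)%R (y + v / 2)%R)%C).
  { unfold q.
    replace (y + v / 2 + v / 2) with (y + v) by field. replace (x + u / 2 + u / 2) with (x + u) by field.
    rewrite (rect_int_split_x f x (x + u) y (y + v) ltac:(lra) ltac:(lra) Hf (x + u / 2) ltac:(lra)).
    assert (Hf1 : forall z, rect x (x + u / 2) y (y + v) z -> ccont f z).
    { intros z Hz. apply Hf. unfold rect in *. lra. }
    assert (Hf2 : forall z, rect (x + u / 2) (x + u) y (y + v) z -> ccont f z).
    { intros z Hz. apply Hf. unfold rect in *. lra. }
    rewrite (rect_int_split_y f x (x + u / 2) y (y + v) ltac:(lra) ltac:(lra) Hf1 (y + v / 2) ltac:(lra)).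
    rewrite (rect_int_split_y f (x + u / 2) (x + u) y (y + v) ltac:(lra) ltac:(lra) Hf2 (y + v / 2) ltac:(lra)).
    ring. }
  assert (T : Cmod (rect_int f x (x + u) y (y + v)) <=
    Cmod (q x y) + Cmod (q x (y + v / 2)%R) + Cmod (q (x + u / 2)%R y) + Cmod (q (x + u / 2)%R (y + v / 2)%R)).
  { rewrite E. eapply Rle_trans; [apply Cmod_triangle|]. apply Rplus_le_compat_r.
    eapply Rle_trans; [apply Cmod_triangle|]. apply Rplus_le_compat_r. apply Cmod_triangle. }
  destruct (Rle_dec (Cmod (rect_int f x (x + u) y (y + v)) / 4) (Cmod (q x y))).
  { exists x, y. repeat split; (lra || assumption). }
  destruct (Rle_dec (Cmod (rect_int f x (x + u) y (y + v)) / 4) (Cmod (q x (y + v / 2)%R))).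
  { exists x, (y + v / 2). repeat split; (lra || assumption). }
  destruct (Rle_dec (Cmod (rect_int f x (x + u) y (y + v)) / 4) (Cmod (q (x + u / 2)%R y))).
  { exists (x + u / 2), y. repeat split; (lra || assumption). }
  exists (x + u / 2), (y + v / 2). unfold q in *. repeat split; lra.
Qed.

Lemma affine_primitive (p l z0 z : C) :
  cder (fun z => p * z + l * ((z - z0) * (z - z0) / 2))%C z (p + l * (z - z0))%C.
Proof.
  assert (H : cder (fun z => z - z0)%C z (1 - 0)%C) by (apply cder_minus; [apply cder_id|apply cder_const]).
  replace (p + l * (z - z0))%C with ((0 * z + p * 1) + (0 * ((z - z0) * (z - z0) / 2) +
     l * (((1 - 0) * (z - z0) + (z - z0) * (1 - 0)) * / 2 + ((z - z0) * (z - z0)) * 0)))%C.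
  2:{ field. }
  apply (cder_plus (fun z => p * z)%C (fun z => l * ((z - z0) * (z - z0) / 2))%C).
  - apply (cder_mult (fun _ => p) (fun z => z)); [apply cder_const|apply cder_id].
  - apply (cder_mult (fun _ => l) (fun z => (z - z0) * (z - z0) / 2)%C); [apply cder_const|].
    apply (cder_mult (fun z => (z - z0) * (z - z0))%C (fun _ => / 2)%C); [|apply cder_const].
    apply (cder_mult (fun z => z - z0)%C (fun z => z - z0)%C); exact H.
Qed.

(** Quarter the rectangle again and again, always keeping a quarter whose
    integral is at least a fourth. The rectangles shrink to a point [p] at
    which [f] is affine up to a small error; the affine part has a primitive
    and contributes nothing, and the error is at most (small) * (diameter) *
    (perimeter), which decreases by the same factor 4 at each step. *)
Lemma goursat f a b c d : a <= b -> c <= d ->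
  (forall z, rect a b c d z -> exists l, cder f z l) -> rect_int f a b c d = 0.
Proof.
  intros Hab Hcd Hf.
  assert (Hcont : forall z, rect a b c d z -> ccont f z).
  { intros z Hz. destruct (Hf z Hz) as [l Hl]. exact (cder_ccont _ _ _ Hl). }
  set (u := fun n : nat => (b - a) / 2 ^ n). set (v := fun n : nat => (d - c) / 2 ^ n).
  assert (H2n : forall n : nat, 0 < 2 ^ n) by (intro n; apply pow_lt; lra).
  assert (Hu : forall n, 0 <= u n) by (intro n; apply Rdiv_le_0_compat; [lra|apply H2n]).
  assert (Hv : forall n, 0 <= v n) by (intro n; apply Rdiv_le_0_compat; [lra|apply H2n]).
  assert (HuS : forall n, u (S n) = u n / 2).
  { intro n. unfold u. simpl. field. specialize (H2n n). lra. }
  assert (HvS : forall n, v (S n) = v n / 2).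
  { intro n. unfold v. simpl. field. specialize (H2n n). lra. }
  set (inside := fun (n : nat) (z : R * R) =>
    a <= fst z /\ fst z + u n <= b /\ c <= snd z /\ snd z + v n <= d).
  set (I := fun (n : nat) (z : R * R) => rect_int f (fst z) (fst z + u n) (snd z) (snd z + v n)).
  destruct (functional_choice (fun (nz : nat * (R * R)) (z' : R * R) =>
    inside (fst nz) (snd nz) ->
      fst (snd nz) <= fst z' /\ fst z' + u (S (fst nz)) <= fst (snd nz) + u (fst nz) /\
      snd (snd nz) <= snd z' /\ snd z' + v (S (fst nz)) <= snd (snd nz) + v (fst nz) /\
      Cmod (I (fst nz) (snd nz)) / 4 <= Cmod (I (S (fst nz)) z'))) as [next Hnext].
  { intros [n [x y]]. unfold inside; simpl.
    destruct (classic (a <= x /\ x + u n <= b /\ c <= y /\ y + v n <= d)) as [Hin|Hin].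
    - destruct (rect_quadrisect f x y (u n) (v n) (Hu n) (Hv n)) as [x' [y' H']].
      + intros z Hz. apply Hcont. unfold rect in *. lra.
      + exists (x', y'). intros _. unfold I; simpl. rewrite HuS HvS. exact H'.
    - exists (x, y). intro H. contradiction. }
  (* The lower left corners of the selected quarters. *)
  set (s := fix s (n : nat) := match n with O => (a, c) | S k => next (k, s k) end).
  assert (Hs : forall n, inside n (s n)).
  { induction n as [|n IH].
    - unfold inside; simpl. unfold u, v; simpl. lra.
    - pose proof (Hnext (n, s n) IH) as H. change (next (n, s n)) with (s (S n)) in H.
      unfold inside in IH |- *. simpl in H. simpl. simpl in IH. lra. }
  assert (HI : forall n, Cmod (rect_int f a b c d) / 4 ^ n <= Cmod (I n (s n))).
  { induction n as [|n IH].
    - unfold I; simpl. unfold u, v; simpl.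
      replace (a + (b - a) / 1) with b by field. replace (c + (d - c) / 1) with d by field. lra.
    - pose proof (Hnext (n, s n) (Hs n)) as H. change (next (n, s n)) with (s (S n)) in H. simpl fst in H. simpl snd in H.
      assert (0 < 4 ^ n) by (apply pow_lt; lra).
      replace (Cmod (rect_int f a b c d) / 4 ^ S n) with (Cmod (rect_int f a b c d) / 4 ^ n / 4).
      2:{ simpl. field. lra. }
      destruct H as (_ & _ & _ & _ & H).
      eapply Rle_trans; [|exact H]. apply Rmult_le_compat_r; [lra|exact IH]. }
  destruct (nested_intervals (fun n => fst (s n)) u) as [p Hp].
  { intro n. apply (Hnext (n, s n) (Hs n)). }
  { intro n. apply (Hnext (n, s n) (Hs n)). }
  { exact Hu. }
  destruct (nested_intervals (fun n => snd (s n)) v) as [q Hq].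
  { intro n. apply (Hnext (n, s n) (Hs n)). }
  { intro n. apply (Hnext (n, s n) (Hs n)). }
  { exact Hv. }
  assert (Hpq : rect a b c d (p, q)).
  { specialize (Hp 0%nat). specialize (Hq 0%nat). simpl in Hp, Hq. unfold u, v in Hp, Hq. simpl in Hp, Hq.
    unfold rect; simpl. lra. }
  destruct (Hf _ Hpq) as [l Hl].
  set (W := (b - a) + (d - c)).
  assert (HW : 0 <= W) by (unfold W; lra).
  apply C_eq_of_le. intros e He.
  replace (rect_int f a b c d - 0)%C with (rect_int f a b c d) by ring.
  destruct (Hl (e / (2 * (W * W + 1)))) as [r [Hr Hloc]].
  { apply Rdiv_lt_0_compat; nra. }
  assert (Hn : exists n : nat, W / 2 ^ n < r).
  { destruct (geometric_small W r HW Hr) as [N HN]. exists N.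
    replace (W / 2 ^ N) with (W * (1 / 2) ^ N); [exact HN|].
    unfold Rdiv. rewrite Rmult_1_l pow_inv. reflexivity. }
  destruct Hn as [n Hn].
  specialize (Hp n). specialize (Hq n). specialize (HI n). specialize (Hs n). unfold I in HI.
  destruct (s n) as [x y]. unfold inside in Hs. simpl in Hp, Hq, HI, Hs.
  assert (HW' : u n + v n = W / 2 ^ n).
  { unfold u, v, W. field. specialize (H2n n). lra. }
  specialize (Hu n). specialize (Hv n).
  set (g := fun z => (f (p, q) + l * (z - (p, q)))%C).
  assert (Hsub : forall z, rect x (x + u n) y (y + v n) z -> rect a b c d z).
  { intros z Hz. unfold rect in *. lra. }
  assert (Hg : forall z, ccont g z).
  { intro z. apply (cder_ccont g z (0 + l * (1 - 0))%C).
    replace (0 + l * (1 - 0))%C with (0 + (0 * (z - (p, q)) + l * (1 - 0)))%C by ring.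
    apply (cder_plus (fun _ => f (p, q)) (fun z => l * (z - (p, q)))%C); [apply cder_const|].
    apply (cder_mult (fun _ => l) (fun z => z - (p, q))%C); [apply cder_const|].
    apply cder_minus; [apply cder_id|apply cder_const]. }
  assert (Hg0 : rect_int g x (x + u n) y (y + v n) = 0).
  { apply (rect_int_exact g x (x + u n) y (y + v n) ltac:(lra) ltac:(lra) (fun z _ => Hg z)
      (fun z => f (p, q) * z + l * ((z - (p, q)) * (z - (p, q)) / 2))%C).
    intros z _. apply affine_primitive. }
  assert (Hb : Cmod (rect_int f x (x + u n) y (y + v n)) <=
     2 * (e / (2 * (W * W + 1)) * (u n + v n)) * ((x + u n - x) + (y + v n - y))).
  { replace (rect_int f x (x + u n) y (y + v n)) with
      (rect_int (fun z => f z - g z)%C x (x + u n) y (y + v n)).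
    2:{ rewrite rect_int_minus; [|lra|lra|intros z Hz; apply Hcont, Hsub, Hz|intros z _; apply Hg].
        rewrite Hg0. ring. }
    apply rect_int_bound; [lra|lra| |].
    - intros z Hz. apply ccont_minus; [apply Hcont, Hsub, Hz|apply Hg].
    - intros [zx zy] Hz. unfold rect in Hz; simpl in Hz.
      assert (Hd : Cmod ((zx, zy) - (p, q)) <= u n + v n).
      { change ((zx, zy) - (p, q))%C with ((zx + - p, zy + - q) : C).
        eapply Rle_trans; [apply Cmod_le_sum|].
        apply Rplus_le_compat; unfold Rabs; destruct Rcase_abs; lra. }
      unfold g. replace (f (zx, zy) - (f (p, q) + l * ((zx, zy) - (p, q))))%C with
        (f (zx, zy) - f (p, q) - l * ((zx, zy) - (p, q)))%C by ring.
      eapply Rle_trans; [apply Hloc; lra|].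
      apply Rmult_le_compat_l; [|exact Hd].
      apply Rlt_le, Rdiv_lt_0_compat; nra. }
  assert (H4 : 0 < 4 ^ n) by (apply pow_lt; lra).
  apply (Rmult_le_reg_r (/ 4 ^ n)); [apply Rinv_0_lt_compat, H4|].
  eapply Rle_trans; [exact HI|]. eapply Rle_trans; [exact Hb|].
  replace (x + u n - x + (y + v n - y)) with (u n + v n) by ring. rewrite HW'.
  replace (4 ^ n) with (2 ^ n * 2 ^ n) by (rewrite -Rpow_mult_distr; f_equal; lra).
  specialize (H2n n).
  replace (2 * (e / (2 * (W * W + 1)) * (W / 2 ^ n)) * (W / 2 ^ n)) with
    (e * / (2 ^ n * 2 ^ n) * (W * W / (W * W + 1))) by (field; split; nra).
  assert (0 < / (2 ^ n * 2 ^ n)) by (apply Rinv_0_lt_compat; nra).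
  rewrite -{2}(Rmult_1_r (e * / (2 ^ n * 2 ^ n))).
  apply Rmult_le_compat_l; [nra|].
  apply (Rmult_le_reg_r (W * W + 1)); [nra|].
  unfold Rdiv. rewrite Rmult_assoc Rinv_l; nra.
Qed.

Lemma rect_int_degenerate_x f a c d : rect_int f a a c d = 0.
Proof. unfold rect_int. rewrite !Cint_point. ring. Qed.

Lemma rect_int_degenerate_y f a b c : rect_int f a b c c = 0.
Proof. unfold rect_int. rewrite !Cint_point. ring. Qed.

(** Cut out a small rectangle around [z0]: the other pieces avoid [z0] or
    are degenerate, and the integral over the small one is small because [f]
    is bounded near [z0]. This is what allows the difference quotient at
    [z0] in the proof of Cauchy's formula. *)
Lemma goursat_punctured f a b c d (z0 : C) : a <= b -> c <= d ->
  (forall z, rect a b c d z -> ccont f z) ->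
  (forall z, rect a b c d z -> z <> z0 -> exists l, cder f z l) ->
  rect_int f a b c d = 0.
Proof.
  intros Hab Hcd Hcont Hf.
  destruct (classic (rect a b c d z0)) as [Hin|Hout].
  2:{ apply goursat; [assumption..|]. intros z Hz. apply Hf; [exact Hz|]. intros ->. contradiction. }
  destruct z0 as [x0 y0]. unfold rect in Hin; simpl in Hin.
  destruct (Hcont (x0, y0) ltac:(unfold rect; simpl; lra) 1 ltac:(lra)) as [r [Hr Hloc]].
  set (B := Cmod (f (x0, y0)) + 1).
  assert (HB : 0 < B) by (unfold B; pose proof (Cmod_ge_0 (f (x0, y0))); lra).
  apply C_eq_of_le. intros e He.
  replace (rect_int f a b c d - 0)%C with (rect_int f a b c d) by ring.
  (* The small rectangle has half-perimeter at most [4 * h] and lies where [|f| <= B]. *)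
  set (h := Rmin (r / 4) (e / (8 * B))).
  assert (Hh : 0 < h) by (apply Rmin_glb_lt; [lra|apply Rdiv_lt_0_compat; lra]).
  assert (Hh1 : h <= r / 4) by apply Rmin_l.
  assert (Hh2 : h <= e / (8 * B)) by apply Rmin_r.
  set (a' := Rmax a (x0 - h)). set (b' := Rmin b (x0 + h)).
  set (c' := Rmax c (y0 - h)). set (d' := Rmin d (y0 + h)).
  assert (Ha : a <= a' /\ x0 - h <= a' <= x0 /\ (a' = a \/ a' = x0 - h)).
  { unfold a', Rmax; destruct Rle_dec; repeat split; lra. }
  assert (Hb : b' <= b /\ x0 <= b' <= x0 + h /\ (b' = b \/ b' = x0 + h)).
  { unfold b', Rmin; destruct Rle_dec; repeat split; lra. }
  assert (Hc : c <= c' /\ y0 - h <= c' <= y0 /\ (c' = c \/ c' = y0 - h)).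
  { unfold c', Rmax; destruct Rle_dec; repeat split; lra. }
  assert (Hd : d' <= d /\ y0 <= d' <= y0 + h /\ (d' = d \/ d' = y0 + h)).
  { unfold d', Rmin; destruct Rle_dec; repeat split; lra. }
  clearbody a' b' c' d'.
  assert (G : forall a1 b1 c1 d1, a <= a1 -> a1 <= b1 -> b1 <= b -> c <= c1 -> c1 <= d1 -> d1 <= d ->
    (b1 < x0 \/ x0 < a1 \/ d1 < y0 \/ y0 < c1) -> rect_int f a1 b1 c1 d1 = 0).
  { intros a1 b1 c1 d1 ? ? ? ? ? ? Hn. apply goursat; [assumption..|].
    intros z Hz. unfold rect in Hz. apply Hf; [unfold rect; lra|]. intros ->. simpl in Hz. lra. }
  rewrite (rect_int_split_x f a b c d Hab Hcd Hcont a' ltac:(lra)).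
  replace (rect_int f a a' c d) with (RtoC 0).
  2:{ destruct Ha as [? [? [->|?]]]; [rewrite rect_int_degenerate_x; reflexivity|]. symmetry; apply G; lra. }
  rewrite (rect_int_split_x f a' b c d ltac:(lra) Hcd ltac:(intros; apply Hcont; unfold rect in *; lra) b' ltac:(lra)).
  replace (rect_int f b' b c d) with (RtoC 0).
  2:{ destruct Hb as [? [? [->|?]]]; [rewrite rect_int_degenerate_x; reflexivity|]. symmetry; apply G; lra. }
  rewrite (rect_int_split_y f a' b' c d ltac:(lra) Hcd ltac:(intros; apply Hcont; unfold rect in *; lra) c' ltac:(lra)).
  replace (rect_int f a' b' c c') with (RtoC 0).
  2:{ destruct Hc as [? [? [->|?]]]; [rewrite rect_int_degenerate_y; reflexivity|]. symmetry; apply G; lra. }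
  rewrite (rect_int_split_y f a' b' c' d ltac:(lra) ltac:(lra) ltac:(intros; apply Hcont; unfold rect in *; lra) d' ltac:(lra)).
  replace (rect_int f a' b' d' d) with (RtoC 0).
  2:{ destruct Hd as [? [? [->|?]]]; [rewrite rect_int_degenerate_y; reflexivity|]. symmetry; apply G; lra. }
  replace (0 + (0 + (rect_int f a' b' c' d' + 0) + 0))%C with (rect_int f a' b' c' d') by ring.
  eapply Rle_trans.
  - apply (rect_int_bound f a' b' c' d' ltac:(lra) ltac:(lra) ltac:(intros; apply Hcont; unfold rect in *; lra) B).
    intros [x y] Hz. unfold rect in Hz; simpl in Hz.
    assert (Hdist : Cmod ((x, y) - (x0, y0)) < r).
    { change ((x, y) - (x0, y0))%C with ((x + - x0, y + - y0) : C).
      eapply Rle_lt_trans; [apply Cmod_le_sum|].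
      unfold Rabs; repeat destruct Rcase_abs; lra. }
    specialize (Hloc _ Hdist). pose proof (Cmod_le_minus (f (x, y)) (f (x0, y0))). unfold B; lra.
  - apply (Rle_trans _ (2 * B * (4 * h))); [apply Rmult_le_compat_l; lra|].
    apply (Rmult_le_compat_r (8 * B)) in Hh2; [|lra].
    replace (e / (8 * B) * (8 * B)) with e in Hh2 by (field; lra). lra.
Qed.

Definition square (z0 : C) (r : R) (z : C) : Prop :=
  Rabs (fst z - fst z0) < r /\ Rabs (snd z - snd z0) < r.

(** Integrate from the centre horizontally and then vertically. Since
    rectangle integrals vanish, vertically and then horizontally gives the
    same value, so both partial derivatives are as they should be. *)
Lemma square_primitive f (z0 : C) r :
  (forall z, square z0 r z -> ccont f z) ->
  (forall z, square z0 r z -> z <> z0 -> exists l, cder f z l) ->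
  exists F, forall z, square z0 r z -> cder F z (f z).
Proof.
  destruct z0 as [x0 y0]. unfold square; simpl. intros Hcont Hf.
  assert (Hh : forall x x' y t, Rabs (x - x0) < r -> Rabs (x' - x0) < r -> Rabs (y - y0) < r ->
    between x x' t -> ccurve_cont (fun s => f (s, y)) t).
  { intros x x' y t Hx Hx' Hy Ht. apply hline_cont, Hcont. simpl. split; [|exact Hy].
    unfold between in Ht. apply Rabs_def2 in Hx, Hx'. apply Rabs_def1; lra. }
  assert (Hv : forall x y y' t, Rabs (x - x0) < r -> Rabs (y - y0) < r -> Rabs (y' - y0) < r ->
    between y y' t -> ccurve_cont (fun s => f (x, s)) t).
  { intros x y y' t Hx Hy Hy' Ht. apply vline_cont, Hcont. simpl. split; [exact Hx|].
    unfold between in Ht. apply Rabs_def2 in Hy, Hy'. apply Rabs_def1; lra. }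
  assert (Z : forall a b c d, Rabs (a - x0) < r -> Rabs (b - x0) < r -> Rabs (c - y0) < r -> Rabs (d - y0) < r ->
     a <= b -> c <= d -> rect_int f a b c d = 0).
  { intros a b c d Ha Hb Hc Hd Hab Hcd. apply Rabs_def2 in Ha, Hb, Hc, Hd.
    apply (goursat_punctured f a b c d (x0, y0) Hab Hcd).
    - intros z Hz. unfold rect in Hz. apply Hcont. split; apply Rabs_def1; lra.
    - intros z Hz. unfold rect in Hz. apply Hf. split; apply Rabs_def1; lra. }
  assert (Zc : forall a b c d, Rabs (a - x0) < r -> Rabs (b - x0) < r -> Rabs (c - y0) < r -> Rabs (d - y0) < r ->
     c <= d -> rect_int f a b c d = 0).
  { intros a b c d Ha Hb Hc Hd Hcd. destruct (Rle_dec a b); [apply Z; assumption|].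
    transitivity (- rect_int f b a c d)%C; [|rewrite Z; [ring|assumption..|lra|assumption]].
    unfold rect_int. rewrite (Cint_swap _ b a) ?(Cint_swap (fun t => f (t, d)) b a).
    2,3: intros; eapply (Hh b a); eassumption. ring. }
  assert (Zall : forall a b c d, Rabs (a - x0) < r -> Rabs (b - x0) < r -> Rabs (c - y0) < r -> Rabs (d - y0) < r ->
     rect_int f a b c d = 0).
  { intros a b c d Ha Hb Hc Hd. destruct (Rle_dec c d); [apply Zc; assumption|].
    transitivity (- rect_int f a b d c)%C; [|rewrite Zc; [ring|assumption..|lra]].
    unfold rect_int. rewrite (Cint_swap (fun t => f (b, t)) d c) ?(Cint_swap (fun t => f (a, t)) d c).
    2,3: intros; eapply (Hv _ d c); eassumption. ring. }
  set (F := fun z : C => (Cint (fun t => f (t, y0)) x0 (fst z) + Ci * Cint (fun t => f (fst z, t)) y0 (snd z))%C).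
  exists F. intros [x y] [Hx Hy] eta He. simpl in Hx, Hy.
  assert (Hx0 : Rabs (x0 - x0) < r) by (rewrite Rminus_diag Rabs_R0; eapply Rle_lt_trans; [apply Rabs_pos|exact Hx]).
  assert (Hy0 : Rabs (y0 - y0) < r) by (rewrite Rminus_diag Rabs_R0; eapply Rle_lt_trans; [apply Rabs_pos|exact Hx]).
  destruct (Hcont (x, y) (conj Hx Hy) (eta / 2) ltac:(lra)) as [d1 [Hd1 Hloc]].
  set (d := Rmin d1 (Rmin (r - Rabs (x - x0)) (r - Rabs (y - y0)))).
  exists (d / 2). assert (Hd : 0 < d) by (repeat apply Rmin_glb_lt; lra).
  split; [lra|].
  assert (Hdd : d <= d1) by apply Rmin_l.
  assert (Hdx : d <= r - Rabs (x - x0)) by (eapply Rle_trans; [apply Rmin_r|apply Rmin_l]).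
  assert (Hdy : d <= r - Rabs (y - y0)) by (eapply Rle_trans; [apply Rmin_r|apply Rmin_r]).
  intros [s t] Hw.
  pose proof (Rabs_fst_le ((s, t) - (x, y))%C) as H1. pose proof (Rabs_snd_le ((s, t) - (x, y))%C) as H2.
  simpl in H1, H2. change (s + - x) with (s - x) in H1. change (t + - y) with (t - y) in H2.
  assert (Hs : Rabs (s - x0) < r).
  { replace (s - x0) with ((s - x) + (x - x0)) by ring. eapply Rle_lt_trans; [apply Rabs_triang|]. lra. }
  assert (Ht : Rabs (t - y0) < r).
  { replace (t - y0) with ((t - y) + (y - y0)) by ring. eapply Rle_lt_trans; [apply Rabs_triang|]. lra. }
  assert (E1 : F (s, t) = (F (s, y) + Ci * Cint (fun k => f (s, k)) y t)%C).
  { unfold F; simpl. rewrite -(Cint_chasles (fun k => f (s, k)) y0 y t); [ring| |].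
    - intros k Hk. apply (Hv s y0 y k); assumption.
    - intros k Hk. apply (Hv s y t k); assumption. }
  assert (E2 : F (s, y) = (F (x, y) + Cint (fun k => f (k, y)) x s)%C).
  { pose proof (Zall x s y0 y Hx Hs Hy0 Hy) as E. unfold rect_int in E.
    unfold F; simpl. rewrite -(Cint_chasles (fun k => f (k, y0)) x0 x s).
    - apply Cminus_eq_zero. rewrite -E. ring.
    - intros k Hk. apply (Hh x0 x y0 k); assumption.
    - intros k Hk. apply (Hh x s y0 k); assumption. }
  assert (Ef : (f (x, y) * ((s, t) - (x, y)))%C =
    (Cint (fun _ => f (x, y)) x s + Ci * Cint (fun _ => f (x, y)) y t)%C).
  { rewrite !Cint_const. replace ((s, t) - (x, y))%C with (RtoC (s - x) + Ci * RtoC (t - y))%C; [ring|].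
    unfold RtoC, Ci, Cminus, Cplus, Copp, Cmult; simpl. f_equal; ring. }
  rewrite E1 E2 Ef.
  replace (F (x, y) + Cint (fun k => f (k, y)) x s + Ci * Cint (fun k => f (s, k)) y t - F (x, y) -
      (Cint (fun _ => f (x, y)) x s + Ci * Cint (fun _ => f (x, y)) y t))%C
   with ((Cint (fun k => f (k, y)) x s - Cint (fun _ => f (x, y)) x s) +
      Ci * (Cint (fun k => f (s, k)) y t - Cint (fun _ => f (x, y)) y t))%C by ring.
  rewrite -(Cint_minus (fun k => f (k, y)) (fun _ => f (x, y)));
    [|intros k Hk; apply (Hh x s y k); assumption|intros k Hk; apply ncont_Cconst].
  rewrite -(Cint_minus (fun k => f (s, k)) (fun _ => f (x, y)));
    [|intros k Hk; apply (Hv s y t k); assumption|intros k Hk; apply ncont_Cconst].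
  eapply Rle_trans; [apply Cmod_triangle|]. rewrite Cmod_mult Cmod_Ci Rmult_1_l.
  set (h := Cmod ((s, t) - (x, y))) in *.
  assert (B1 : Cmod (Cint (fun k => f (k, y) - f (x, y))%C x s) <= eta / 2 * Rabs (s - x)).
  { apply Cint_bound.
    - intros k Hk. apply ncont_Cminus; [apply (Hh x s y k); assumption|apply ncont_Cconst].
    - intros k Hk. apply Rlt_le, Hloc. change ((k, y) - (x, y))%C with ((k + - x, y + - y) : C).
      eapply Rle_lt_trans; [apply Cmod_le_sum|]. rewrite Rplus_opp_r Rabs_R0.
      unfold between in Hk. assert (Rabs (k + - x) <= Rabs (s - x)) by (unfold Rabs; repeat destruct Rcase_abs; lra). lra. }
  assert (B2 : Cmod (Cint (fun k => f (s, k) - f (x, y))%C y t) <= eta / 2 * Rabs (t - y)).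
  { apply Cint_bound.
    - intros k Hk. apply ncont_Cminus; [apply (Hv s y t k); assumption|apply ncont_Cconst].
    - intros k Hk. apply Rlt_le, Hloc. change ((s, k) - (x, y))%C with ((s + - x, k + - y) : C).
      eapply Rle_lt_trans; [apply Cmod_le_sum|].
      unfold between in Hk. assert (Rabs (k + - y) <= Rabs (t - y)) by (unfold Rabs; repeat destruct Rcase_abs; lra).
      change (s + - x) with (s - x). lra. }
  nra.
Qed.

(** * Cauchy's formula on a circle *)

Definition circ (c : C) (rho theta : R) : C := (c + RtoC rho * (cos theta, sin theta))%C.

Lemma derivable_estimate (f : R -> R) (t l eta : R) :
  derivable_pt_lim f t l -> 0 < eta ->
  exists d, 0 < d /\ forall s, Rabs (s - t) < d -> Rabs (f s - f t - (s - t) * l) <= eta * Rabs (s - t).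
Proof.
  intros H He. destruct (H eta He) as [[d Hd] Hs]. exists d. split; [exact Hd|].
  intros s Hst. destruct (Req_dec s t) as [->|Hne].
  - rewrite !Rminus_diag Rmult_0_l Rminus_diag Rabs_R0. lra.
  - specialize (Hs (s - t) ltac:(lra) Hst). replace (t + (s - t)) with s in Hs by ring.
    replace (f s - f t - (s - t) * l) with (((f s - f t) / (s - t) - l) * (s - t)) by (field; lra).
    rewrite Rabs_mult. apply Rmult_le_compat_r; [apply Rabs_pos|lra].
Qed.

Lemma unit_circle_rderiv D t : crderiv D (fun s => (cos s, sin s) : C) t (Ci * (cos t, sin t))%C.
Proof.
  intros eta He.
  destruct (derivable_estimate cos t (- sin t) (eta / 2) (derivable_pt_lim_cos t) ltac:(lra)) as [d1 [Hd1 H1]].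
  destruct (derivable_estimate sin t (cos t) (eta / 2) (derivable_pt_lim_sin t) ltac:(lra)) as [d2 [Hd2 H2]].
  exists (Rmin d1 d2). split; [apply Rmin_glb_lt; assumption|].
  intros s _ Hs.
  specialize (H1 s ltac:(eapply Rlt_le_trans; [exact Hs|apply Rmin_l])).
  specialize (H2 s ltac:(eapply Rlt_le_trans; [exact Hs|apply Rmin_r])).
  change (Cmod ((cos s, sin s) - (cos t, sin t) - RtoC (s - t) * (Ci * (cos t, sin t))) <= eta * Rabs (s - t)).
  replace ((cos s, sin s) - (cos t, sin t) - RtoC (s - t) * (Ci * (cos t, sin t)))%C with
    ((cos s - cos t - (s - t) * - sin t, sin s - sin t - (s - t) * cos t) : C).
  2:{ unfold RtoC, Ci, Cminus, Cplus, Copp, Cmult; simpl. f_equal; ring. }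
  eapply Rle_trans; [apply Cmod_le_sum|]. lra.
Qed.

Lemma circ_rderiv D c rho t : crderiv D (circ c rho) t (Ci * (circ c rho t - c))%C.
Proof.
  replace (Ci * (circ c rho t - c))%C with ((0 + (0 * (cos t, sin t) + RtoC rho * 1)) * (Ci * (cos t, sin t)))%C.
  2:{ unfold circ. ring. }
  apply (rderiv_comp (fun z => c + RtoC rho * z)%C D (fun s => (cos s, sin s) : C)); [|apply unit_circle_rderiv].
  apply (cder_plus (fun _ => c) (fun z => RtoC rho * z)%C); [apply cder_const|].
  apply (cder_mult (fun _ => RtoC rho) (fun z => z)); [apply cder_const|apply cder_id].
Qed.

Lemma circ_cont c rho t : ccurve_cont (circ c rho) t.
Proof. exact (rderiv_ncont _ _ _ (circ_rderiv everywhere c rho t)). Qed.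

Lemma circ_dist c rho t : 0 <= rho -> Cmod (circ c rho t - c) = rho.
Proof.
  intro H. unfold circ. replace (c + RtoC rho * (cos t, sin t) - c)%C with (RtoC rho * (cos t, sin t))%C by ring.
  rewrite Cmod_mult Cmod_R Rabs_right; [|lra].
  unfold Cmod; simpl. replace (cos t * (cos t * 1) + sin t * (sin t * 1)) with 1.
  - rewrite sqrt_1. ring.
  - pose proof (sin2_cos2 t) as E. unfold Rsqr in E. lra.
Qed.

Lemma circ_period c rho : circ c rho (2 * PI) = circ c rho 0.
Proof. unfold circ. rewrite cos_2PI sin_2PI cos_0 sin_0. reflexivity. Qed.

Lemma circ_far c rho t z : 0 <= rho -> rho - Cmod (z - c) <= Cmod (circ c rho t - z).
Proof.
  intro H. pose proof (Cmod_minus_triangle z (circ c rho t) c) as E. rewrite (circ_dist c rho t H) in E. lra.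
Qed.

Lemma two_pi_pos : 0 < 2 * PI.
Proof. pose proof PI_RGT_0. lra. Qed.

Lemma circ_off c rho t z : Cmod (z - c) < rho -> (circ c rho t - z)%C <> 0.
Proof.
  intros H E. pose proof (Cmod_ge_0 (z - c)%C). pose proof (circ_far c rho t z ltac:(lra)) as F.
  rewrite E Cmod_0 in F. lra.
Qed.

Lemma inv_kernel_cont c rho t z : Cmod (z - c) < rho ->
  ccurve_cont (fun s => / (circ c rho s - z))%C t.
Proof.
  intro H. apply (ncont_comp (fun w => / (w - z))%C (circ c rho)); [|apply circ_cont].
  eapply cder_ccont. apply (cder_inv (fun w => w - z)%C); [apply circ_off, H|].
  apply cder_minus; [apply cder_id|apply cder_const].
Qed.

(** Differentiation under the integral sign; the remainder is explicit: with
    [a = xi - z] and [b = xi - w], [1 / b - 1 / a - (w - z) / a^2 = (w -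
    z)^2 / (a^2 b)]. *)
Lemma cauchy_type_cder (k : R -> C) c rho B z :
  (forall t, 0 <= t <= 2 * PI -> ccurve_cont k t) ->
  (forall t, 0 <= t <= 2 * PI -> Cmod (k t) <= B) ->
  Cmod (z - c) < rho ->
  cder (fun w => Cint (fun t => k t * / (circ c rho t - w))%C 0 (2 * PI)) z
    (Cint (fun t => k t * (/ (circ c rho t - z) * / (circ c rho t - z)))%C 0 (2 * PI)).
Proof.
  intros Hk HB Hz eta He. pose proof two_pi_pos as Hpi.
  assert (HB0 : 0 <= B) by (eapply Rle_trans; [apply Cmod_ge_0|apply (HB 0); lra]).
  set (d := rho - Cmod (z - c)). assert (Hd : 0 < d) by (unfold d; lra).
  pose proof (Cmod_ge_0 (z - c)%C) as Hzc.
  set (Q := 2 * B / (d * d * d) * (2 * PI)).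
  assert (Hddd : 0 < d * d * d) by (repeat apply Rmult_lt_0_compat; assumption).
  assert (HQ : 0 <= Q).
  { unfold Q. apply Rmult_le_pos; [|lra]. apply Rdiv_le_0_compat; lra. }
  exists (Rmin (d / 2) (eta / (Q + 1))). split.
  { apply Rmin_glb_lt; [lra|]. apply Rdiv_lt_0_compat; lra. }
  intros w Hw.
  destruct (Rlt_Rmin _ _ _ Hw) as [Hw1 Hw2].
  assert (Hwc : Cmod (w - c) < rho - d / 2).
  { pose proof (Cmod_minus_triangle z w c). unfold d in *. lra. }
  assert (Kc : forall v, Cmod (v - c) < rho -> forall t, 0 <= t <= 2 * PI ->
     ccurve_cont (fun s => k s * / (circ c rho s - v))%C t).
  { intros v Hv t Ht. apply (ncont_mult k); [apply Hk, Ht|apply inv_kernel_cont, Hv]. }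
  assert (K2c : forall t, 0 <= t <= 2 * PI ->
     ccurve_cont (fun s => k s * (/ (circ c rho s - z) * / (circ c rho s - z)))%C t).
  { intros t Ht. apply (ncont_mult k); [apply Hk, Ht|].
    apply (ncont_mult (fun s => / (circ c rho s - z))%C (fun s => / (circ c rho s - z))%C); apply inv_kernel_cont, Hz. }
  rewrite (Cmult_comm _ (w - z)%C).
  rewrite -Cint_scal; [|lra|exact K2c].
  assert (K2w : forall t, 0 <= t <= 2 * PI -> ccurve_cont (fun s => (w - z) * (k s * (/ (circ c rho s - z) * / (circ c rho s - z))))%C t).
  { intros t Ht. apply (ncont_mult (fun _ => w - z)%C); [apply ncont_Cconst|apply K2c, Ht]. }
  rewrite -Cint_minus; [|unfold between; intros t Ht; apply Kc; lra|unfold between; intros t Ht; apply Kc; lra].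
  rewrite -(Cint_minus (fun t => k t * / (circ c rho t - w) - k t * / (circ c rho t - z))%C).
  2:{ unfold between; intros t Ht. apply ncont_Cminus; apply Kc; lra. }
  2:{ unfold between; intros t Ht. apply K2w; lra. }
  eapply Rle_trans.
  { apply (Cint_bound _ _ _ (2 * B / (d * d * d) * (Cmod (w - z) * Cmod (w - z)))).
    - unfold between; intros t Ht.
      apply ncont_Cminus.
      + apply ncont_Cminus; apply Kc; lra.
      + apply K2w; lra.
    - unfold between; intros t Ht. specialize (HB t ltac:(lra)).
      pose proof (circ_far c rho t z ltac:(lra)) as Fz. pose proof (circ_far c rho t w ltac:(lra)) as Fw.
      pose proof (circ_off c rho t z Hz) as Oz. pose proof (circ_off c rho t w ltac:(lra)) as Ow.
      set (a := (circ c rho t - z)%C) in *. set (b := (circ c rho t - w)%C) in *.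
      replace (k t * / b - k t * / a - (w - z) * (k t * (/ a * / a)))%C with
        (k t * ((w - z) * (w - z)) * / (a * a * b))%C.
      2:{ replace (w - z)%C with (a - b)%C by (unfold a, b; ring). field. split; assumption. }
      rewrite !Cmod_mult Cmod_inv; [|repeat apply Cmult_neq_0; assumption]. rewrite !Cmod_mult.
      fold d in Fz.
      assert (Fw' : d / 2 <= Cmod b) by lra.
      assert (Hden : d * d * d / 2 <= Cmod a * Cmod a * Cmod b).
      { replace (d * d * d / 2) with (d * d * (d / 2)) by field.
        apply Rmult_le_compat; [nra|lra| |exact Fw']. apply Rmult_le_compat; lra. }
      pose proof (Cmod_ge_0 (w - z)%C) as Pw. pose proof (Cmod_ge_0 (k t)) as Pk.
      apply (Rle_trans _ (B * (Cmod (w - z) * Cmod (w - z)) * / (d * d * d / 2))).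
      + apply Rmult_le_compat.
        * apply Rmult_le_pos; [exact Pk|nra].
        * apply Rlt_le, Rinv_0_lt_compat. lra.
        * apply Rmult_le_compat_r; [nra|exact HB].
        * apply Rinv_le_contravar; lra.
      + right. field. lra. }
  rewrite Rminus_0_r (Rabs_right (2 * PI)); [|lra].
  replace (2 * B / (d * d * d) * (Cmod (w - z) * Cmod (w - z)) * (2 * PI)) with
    (Q * Cmod (w - z) * Cmod (w - z)) by (unfold Q; field; lra).
  apply Rmult_le_compat_r; [apply Cmod_ge_0|].
  apply Rlt_div_r in Hw2; [|lra].
  pose proof (Cmod_ge_0 (w - z)%C). nra.
Qed.

(** As a function of [z] its derivative is the integral of [(xi - c) / (xi -
    z)^2], which has a primitive along the circle; so it is constant, and
    its value at the centre is clear. (Along the circle [d xi = Ci * (xi -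
    c) d theta].) *)
Lemma winding_number c rho z : Cmod (z - c) < rho ->
  Cint (fun t => (circ c rho t - c) * / (circ c rho t - z))%C 0 (2 * PI) = RtoC (2 * PI).
Proof.
  intro Hz. pose proof two_pi_pos as Hpi. pose proof (Cmod_ge_0 (z - c)%C) as Hzc.
  set (W := fun z => Cint (fun t => (circ c rho t - c) * / (circ c rho t - z))%C 0 (2 * PI)).
  assert (Hk : forall t, ccurve_cont (fun t => circ c rho t - c)%C t).
  { intro t. apply ncont_Cminus; [apply circ_cont|apply ncont_Cconst]. }
  assert (HW : forall z, Cmod (z - c) < rho -> cder W z 0).
  { intros v Hv.
    replace (RtoC 0) with (Cint (fun t => (circ c rho t - c) * (/ (circ c rho t - v) * / (circ c rho t - v)))%C 0 (2 * PI)).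
    - apply (cauchy_type_cder _ c rho rho); [intros; apply Hk| |exact Hv].
      intros t _. rewrite circ_dist; lra.
    - rewrite (Cint_of_deriv _ (fun t => Ci * / (circ c rho t - v))%C); [|lra| |].
      + rewrite circ_period. ring.
      + intros t Ht. apply (ncont_mult (fun t => circ c rho t - c)%C); [apply Hk|].
        apply (ncont_mult (fun s => / (circ c rho s - v))%C (fun s => / (circ c rho s - v))%C); apply inv_kernel_cont, Hv.
      + intros t Ht. pose proof (circ_off c rho t v Hv) as O.
        replace ((circ c rho t - c) * (/ (circ c rho t - v) * / (circ c rho t - v)))%C with
          ((0 * / (circ c rho t - v) + Ci * - ((1 - 0) / ((circ c rho t - v) * (circ c rho t - v)))) * (Ci * (circ c rho t - c)))%C.
        * apply (rderiv_comp (fun w => Ci * / (w - v))%C _ (circ c rho)); [|apply circ_rderiv].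
          apply (cder_mult (fun _ => Ci) (fun w => / (w - v))%C); [apply cder_const|].
          apply (cder_inv (fun w => w - v)%C); [exact O|].
          apply cder_minus; [apply cder_id|apply cder_const].
        * replace ((0 * / (circ c rho t - v) + Ci * - ((1 - 0) / ((circ c rho t - v) * (circ c rho t - v)))) * (Ci * (circ c rho t - c)))%C
            with (- (Ci * Ci) * ((circ c rho t - c) * (/ (circ c rho t - v) * / (circ c rho t - v))))%C by (field; exact O).
          replace (Ci * Ci)%C with (- RtoC 1)%C; [ring|].
          unfold RtoC, Ci, Copp, Cmult; simpl. f_equal; ring. }
  change (W z = RtoC (2 * PI)).
  transitivity (W c).
  - replace z with (c + RtoC 1 * (z - c))%C by ring. replace c with (c + RtoC 0 * (z - c))%C at 3 by ring.
    apply (@rderiv_zero_const C_NormedModule (fun s => W (c + RtoC s * (z - c))%C) 0 1 ltac:(lra)).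
    intros s Hs. change (@zero C_NormedModule) with (RtoC 0).
    replace (RtoC 0) with (0 * (z - c))%C by ring.
    apply (rderiv_comp W _ (fun s => c + RtoC s * (z - c))%C).
    + apply HW. replace (c + RtoC s * (z - c) - c)%C with (RtoC s * (z - c))%C by ring.
      rewrite Cmod_mult Cmod_R Rabs_right; [|lra]. nra.
    + intros eta He. exists 1. split; [lra|]. intros r _ _.
      change (Cmod (c + RtoC r * (z - c) - (c + RtoC s * (z - c)) - RtoC (r - s) * (z - c)) <= eta * Rabs (r - s)).
      replace (c + RtoC r * (z - c) - (c + RtoC s * (z - c)) - RtoC (r - s) * (z - c))%C with (RtoC 0) by (rewrite RtoC_minus; ring).
      rewrite Cmod_0. pose proof (Rabs_pos (r - s)). nra.
  - unfold W. rewrite (Cint_ext _ (fun _ => RtoC 1)).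
    + rewrite Cint_const Rminus_0_r. ring.
    + intros t _. field. apply circ_off. rewrite Cmod_minus_self. lra.
Qed.

Definition hol_disc (f : C -> C) (c : C) (r : R) : Prop :=
  forall z, Cmod (z - c) < r -> exists l, cder f z l.

Lemma hol_disc_cont f c r z : hol_disc f c r -> Cmod (z - c) < r -> ccont f z.
Proof. intros Hf Hz. destruct (Hf z Hz) as [l Hl]. exact (cder_ccont _ _ _ Hl). Qed.

Lemma hol_disc_circ_cont f c r rho t : hol_disc f c r -> 0 <= rho < r -> ccurve_cont (fun s => f (circ c rho s)) t.
Proof.
  intros Hf Hr. apply (ncont_comp f (circ c rho)); [|apply circ_cont].
  apply (hol_disc_cont f c r); [exact Hf|]. rewrite circ_dist; lra.
Qed.

(** Continuous at [z0] when [l] is the derivative of [f] there; elsewhere it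
    is holomorphic where [f] is. *)
Definition difference_quotient (f : C -> C) (z0 l z : C) : C :=
  if excluded_middle_informative (z = z0) is left _ then l else ((f z - f z0) * / (z - z0))%C.

Lemma difference_quotient_off f z0 l z : z <> z0 -> difference_quotient f z0 l z = ((f z - f z0) * / (z - z0))%C.
Proof. intro H. unfold difference_quotient. destruct excluded_middle_informative; [contradiction|reflexivity]. Qed.

Lemma difference_quotient_at f z0 l : difference_quotient f z0 l z0 = l.
Proof. unfold difference_quotient. destruct excluded_middle_informative; [reflexivity|contradiction]. Qed.

Lemma difference_quotient_cder f z0 l z m : z <> z0 -> cder f z m -> exists k, cder (difference_quotient f z0 l) z k.
Proof.
  intros Hne Hf. eexists.
  apply (cder_ext_loc (fun z => (f z - f z0) * / (z - z0))%C _ _ _ (Cmod (z - z0))).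
  - apply Cmod_minus_pos, Hne.
  - intros w Hw. rewrite difference_quotient_off; [reflexivity|]. intros ->. rewrite Cmod_minus_sym in Hw. lra.
  - apply (cder_mult (fun z => f z - f z0)%C (fun z => / (z - z0))%C).
    + apply cder_minus; [exact Hf|apply cder_const].
    + apply (cder_inv (fun z => z - z0)%C).
      * intro E. apply Hne, Cminus_eq_zero, E.
      * apply cder_minus; [apply cder_id|apply cder_const].
Qed.

Lemma difference_quotient_cont f z0 l : cder f z0 l -> ccont (difference_quotient f z0 l) z0.
Proof.
  intros Hf e He. destruct (Hf (e / 2) ltac:(lra)) as [d [Hd H]].
  exists d. split; [exact Hd|]. intros w Hw. rewrite difference_quotient_at.
  destruct (classic (w = z0)) as [->|Hne].
  - rewrite difference_quotient_at. rewrite Cmod_minus_self. exact He.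
  - rewrite difference_quotient_off; [|exact Hne]. specialize (H w Hw).
    assert (Hnz : (w - z0)%C <> 0) by (intro E; apply Hne, Cminus_eq_zero, E).
    replace ((f w - f z0) * / (w - z0) - l)%C with ((f w - f z0 - l * (w - z0)) / (w - z0))%C by (field; exact Hnz).
    rewrite Cmod_div; [|exact Hnz]. pose proof (Cmod_minus_pos w z0 Hne) as P.
    apply (Rmult_lt_reg_r (Cmod (w - z0))); [exact P|].
    unfold Rdiv. rewrite Rmult_assoc Rinv_l; nra.
Qed.

(** This is where the radius [4 * rho] of the next lemma comes from: a
    square centred at [zeta] must contain the circle of radius [rho] around
    [c]. *)
Lemma square_in_disc c rho zeta z : Cmod (zeta - c) < rho -> square zeta (2 * rho) z -> Cmod (z - c) < 4 * rho.
Proof.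
  intros Hz [H1 H2]. pose proof (Cmod_ge_0 (zeta - c)%C).
  pose proof (Cmod_minus_triangle zeta z c) as T.
  pose proof (Cmod_2Rmax (z - zeta)%C) as M.
  assert (Rmax (Rabs (fst (z - zeta)%C)) (Rabs (snd (z - zeta)%C)) <= 2 * rho).
  { apply Rmax_lub; apply Rlt_le; assumption. }
  assert (S2 : sqrt 2 <= 3 / 2).
  { rewrite -(sqrt_Rsqr (3 / 2)); [|lra]. apply sqrt_le_1_alt. unfold Rsqr. lra. }
  pose proof (sqrt_pos 2).
  assert (sqrt 2 * Rmax (Rabs (fst (z - zeta)%C)) (Rabs (snd (z - zeta)%C)) <= 3 / 2 * (2 * rho)).
  { apply Rmult_le_compat; try lra. eapply Rle_trans; [apply Rabs_pos|apply Rmax_l]. }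
  lra.
Qed.

(** The difference quotient of [f] at [z] has a primitive on a square around
    the circle, so its integral along the circle vanishes; what remains is
    [f z] times the winding number. *)
Lemma cauchy_formula f c rho z : hol_disc f c (4 * rho) -> Cmod (z - c) < rho ->
  Cint (fun t => ((circ c rho t - c) * f (circ c rho t)) * / (circ c rho t - z))%C 0 (2 * PI)
   = (RtoC (2 * PI) * f z)%C.
Proof.
  intros Hf Hz. pose proof two_pi_pos as Hpi. pose proof (Cmod_ge_0 (z - c)%C) as Hzc.
  destruct (Hf z ltac:(lra)) as [l Hl].
  destruct (square_primitive (difference_quotient f z l) z (2 * rho)) as [F HF].
  { intros w Hw. destruct (classic (w = z)) as [->|Hne]; [apply difference_quotient_cont, Hl|].
    destruct (Hf w (square_in_disc c rho z w Hz Hw)) as [m Hm].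
    destruct (difference_quotient_cder f z l w m Hne Hm) as [k Hk]. exact (cder_ccont _ _ _ Hk). }
  { intros w Hw Hne. destruct (Hf w (square_in_disc c rho z w Hz Hw)) as [m Hm].
    exact (difference_quotient_cder f z l w m Hne Hm). }
  assert (Hsq : forall t, square z (2 * rho) (circ c rho t)).
  { intro t. assert (D : Cmod (circ c rho t - z) < 2 * rho).
    { pose proof (Cmod_minus_triangle c (circ c rho t) z) as T. rewrite circ_dist in T; [|lra].
      rewrite (Cmod_minus_sym c z) in T. lra. }
    split; (eapply Rle_lt_trans; [|exact D]).
    - apply (Rabs_fst_le (circ c rho t - z)%C).
    - apply (Rabs_snd_le (circ c rho t - z)%C). }
  assert (Hfc : forall t, ccurve_cont (fun s => f (circ c rho s)) t).
  { intro t. apply (hol_disc_circ_cont f c (4 * rho)); [exact Hf|lra]. }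
  assert (Hcc : forall t, ccurve_cont (fun t => circ c rho t - c)%C t).
  { intro t. apply ncont_Cminus; [apply circ_cont|apply ncont_Cconst]. }
  assert (Hk : forall t, ccurve_cont (fun t => (circ c rho t - c) * / (circ c rho t - z))%C t).
  { intro t. apply (ncont_mult (fun t => circ c rho t - c)%C); [apply Hcc|apply inv_kernel_cont, Hz]. }
  assert (Hk2 : forall t, ccurve_cont (fun t => ((circ c rho t - c) * f (circ c rho t)) * / (circ c rho t - z))%C t).
  { intro t. apply (ncont_mult (fun t => (circ c rho t - c) * f (circ c rho t))%C); [|apply inv_kernel_cont, Hz].
    apply (ncont_mult (fun t => circ c rho t - c)%C); [apply Hcc|apply Hfc]. }
  assert (E : Cint (fun t => ((circ c rho t - c) * f (circ c rho t)) * / (circ c rho t - z) -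
      f z * ((circ c rho t - c) * / (circ c rho t - z)))%C 0 (2 * PI) = 0).
  { rewrite (Cint_of_deriv _ (fun t => - Ci * F (circ c rho t))%C); [|lra| |].
    - rewrite circ_period. ring.
    - intros t _. apply ncont_Cminus; [apply Hk2|].
      apply (ncont_mult (fun _ => f z)); [apply ncont_Cconst|apply Hk].
    - intros t _. pose proof (circ_off c rho t z Hz) as O.
      replace ((circ c rho t - c) * f (circ c rho t) * / (circ c rho t - z) -
        f z * ((circ c rho t - c) * / (circ c rho t - z)))%C with
        ((0 * F (circ c rho t) + - Ci * difference_quotient f z l (circ c rho t)) * (Ci * (circ c rho t - c)))%C.
      + apply (rderiv_comp (fun w => - Ci * F w)%C _ (circ c rho)); [|apply circ_rderiv].
        apply (cder_mult (fun _ => - Ci)%C F); [apply cder_const|apply HF, Hsq].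
      + rewrite difference_quotient_off.
        2:{ intro E. apply O. rewrite E. ring. }
        replace ((0 * F (circ c rho t) + - Ci * ((f (circ c rho t) - f z) * / (circ c rho t - z))) * (Ci * (circ c rho t - c)))%C
         with (- (Ci * Ci) * ((circ c rho t - c) * ((f (circ c rho t) - f z) * / (circ c rho t - z))))%C by ring.
        replace (Ci * Ci)%C with (- RtoC 1)%C; [ring|].
        unfold RtoC, Ci, Copp, Cmult; simpl. f_equal; ring. }
  rewrite Cint_minus in E.
  2: intros t _; apply Hk2.
  2: intros t _; apply (ncont_mult (fun _ => f z)); [apply ncont_Cconst|apply Hk].
  apply Cminus_eq_zero in E. rewrite E Cint_scal; [|lra|intros t _; apply Hk].
  rewrite winding_number; [ring|exact Hz].
Qed.

(** * Consequences of Cauchy's formula *)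

Lemma ncont_Cmod_continuity_pt (g : R -> C) t : ccurve_cont g t -> continuity_pt (fun s => Cmod (g s)) t.
Proof.
  intros H e He. destruct (H e He) as [d [Hd Hs]]. exists d. split; [exact Hd|].
  intros s [_ Hst]. specialize (Hs s Hst). change (Cmod (g s - g t) < e) in Hs.
  simpl. unfold R_dist.
  pose proof (Cmod_le_minus (g s) (g t)). pose proof (Cmod_le_minus (g t) (g s)) as H1.
  rewrite (Cmod_minus_sym (g t)) in H1. apply Rabs_def1; lra.
Qed.

Lemma curve_max (g : R -> C) a b : a <= b -> (forall t, a <= t <= b -> ccurve_cont g t) ->
  exists m, a <= m <= b /\ forall t, a <= t <= b -> Cmod (g t) <= Cmod (g m).
Proof.
  intros Hab Hg.
  destruct (continuity_ab_maj (fun t => Cmod (g t)) a b Hab) as [m [H1 H2]].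
  - intros t Ht. apply ncont_Cmod_continuity_pt, Hg, Ht.
  - exists m. split; assumption.
Qed.

Lemma curve_min (g : R -> C) a b : a <= b -> (forall t, a <= t <= b -> ccurve_cont g t) ->
  exists m, a <= m <= b /\ forall t, a <= t <= b -> Cmod (g m) <= Cmod (g t).
Proof.
  intros Hab Hg.
  destruct (continuity_ab_min (fun t => Cmod (g t)) a b Hab) as [m [H1 H2]].
  - intros t Ht. apply ncont_Cmod_continuity_pt, Hg, Ht.
  - exists m. split; assumption.
Qed.

Lemma hol_disc_minus f g c r : hol_disc f c r -> hol_disc g c r -> hol_disc (fun z => f z - g z)%C c r.
Proof.
  intros Hf Hg z Hz. destruct (Hf z Hz) as [l Hl]. destruct (Hg z Hz) as [m Hm].
  exists (l - m)%C. apply cder_minus; assumption.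
Qed.

Lemma circ_minus_cont c rho t : ccurve_cont (fun t => circ c rho t - c)%C t.
Proof.
  apply ncont_Cminus; [apply circ_cont|apply ncont_Cconst].
Qed.

Lemma Cmod_two_pi : Cmod (RtoC (2 * PI)) = 2 * PI.
Proof. pose proof two_pi_pos. rewrite Cmod_R Rabs_right; lra. Qed.

Lemma cauchy_kernel_bound (k : R -> C) c rho B z :
  (forall t, 0 <= t <= 2 * PI -> ccurve_cont k t) ->
  (forall t, 0 <= t <= 2 * PI -> Cmod (k t) <= B) -> Cmod (z - c) < rho ->
  Cmod (Cint (fun t => k t * / (circ c rho t - z))%C 0 (2 * PI)) <= B / (rho - Cmod (z - c)) * (2 * PI).
Proof.
  intros Hk HB Hz. pose proof two_pi_pos. pose proof (Cmod_ge_0 (z - c)).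
  replace (B / (rho - Cmod (z - c)) * (2 * PI)) with (B * / (rho - Cmod (z - c)) * Rabs (2 * PI - 0)).
  2:{ rewrite Rminus_0_r Rabs_right; [reflexivity|lra]. }
  apply Cint_bound; unfold between; intros t Ht.
  - apply (ncont_mult k); [apply Hk; lra|apply inv_kernel_cont, Hz].
  - rewrite Cmod_mult Cmod_inv; [|apply circ_off, Hz].
    apply Rmult_le_compat; [apply Cmod_ge_0| |apply HB; lra|].
    + apply Rlt_le, Rinv_0_lt_compat, Cmod_gt_0, circ_off, Hz.
    + apply Rinv_le_contravar; [lra|]. apply circ_far. lra.
Qed.

Section Estimates.
Context (f : C -> C) (c : C) (rho B : R) (Hrho : 0 < rho)
  (Hf : forall t, ccurve_cont (fun s => f (circ c rho s)) t)
  (HB : forall t, 0 <= t <= 2 * PI -> Cmod (f (circ c rho t)) <= B).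

Definition cauchy_density (t : R) : C := ((circ c rho t - c) * f (circ c rho t))%C.

Lemma cauchy_density_cont t : ccurve_cont cauchy_density t.
Proof. apply (ncont_mult (fun t => circ c rho t - c)%C); [apply circ_minus_cont|apply Hf]. Qed.

Lemma cauchy_density_bound t : 0 <= t <= 2 * PI -> Cmod (cauchy_density t) <= rho * B.
Proof.
  intro Ht. unfold cauchy_density. rewrite Cmod_mult circ_dist; [|lra].
  apply Rmult_le_compat_l; [lra|apply HB, Ht].
Qed.

Lemma cauchy_integrand_cont z t : Cmod (z - c) < rho ->
  ccurve_cont (fun t => cauchy_density t * / (circ c rho t - z))%C t.
Proof. intro Hz. apply (ncont_mult cauchy_density); [apply cauchy_density_cont|apply inv_kernel_cont, Hz]. Qed.

Lemma cauchy_estimate z : Cmod (z - c) < rho ->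
  Cint (fun t => cauchy_density t * / (circ c rho t - z))%C 0 (2 * PI) = (RtoC (2 * PI) * f z)%C ->
  Cmod (f z) * (rho - Cmod (z - c)) <= rho * B.
Proof.
  intros Hz E. pose proof two_pi_pos as Hpi.
  assert (L : Cmod (RtoC (2 * PI) * f z) <= rho * B / (rho - Cmod (z - c)) * (2 * PI)).
  { rewrite -E. apply cauchy_kernel_bound; [|apply cauchy_density_bound|exact Hz].
    intros t _. apply cauchy_density_cont. }
  rewrite Cmod_mult Cmod_two_pi in L.
  apply (Rmult_le_reg_l (2 * PI)); [exact Hpi|].
  apply (Rmult_le_compat_r (rho - Cmod (z - c))) in L; [|lra].
  replace (rho * B / (rho - Cmod (z - c)) * (2 * PI) * (rho - Cmod (z - c))) with (2 * PI * (rho * B)) in L by (field; lra).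
  lra.
Qed.

Lemma cauchy_lipschitz_aux z z' : Cmod (z - c) <= rho / 2 -> Cmod (z' - c) <= rho / 2 ->
  Cint (fun t => cauchy_density t * / (circ c rho t - z))%C 0 (2 * PI) = (RtoC (2 * PI) * f z)%C ->
  Cint (fun t => cauchy_density t * / (circ c rho t - z'))%C 0 (2 * PI) = (RtoC (2 * PI) * f z')%C ->
  Cmod (f z - f z') <= 4 * B / rho * Cmod (z - z').
Proof.
  intros Hz Hz' E E'. pose proof two_pi_pos as Hpi.
  assert (HB0 : 0 <= B) by (eapply Rle_trans; [apply Cmod_ge_0|apply (HB 0); lra]).
  set (k := fun t => (cauchy_density t * ((z - z') * / (circ c rho t - z')))%C).
  assert (L : Cmod (RtoC (2 * PI) * (f z - f z')) <=
    rho * B * (Cmod (z - z') * / (rho / 2)) / (rho - Cmod (z - c)) * (2 * PI)).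
  { replace (RtoC (2 * PI) * (f z - f z'))%C with (RtoC (2 * PI) * f z - RtoC (2 * PI) * f z')%C by ring.
    rewrite -E -E' -Cint_minus; [|intros t _; apply cauchy_integrand_cont; lra..].
    rewrite (Cint_ext _ (fun t => k t * / (circ c rho t - z))%C).
    2:{ intros t _. unfold k. field. split; apply circ_off; lra. }
    apply cauchy_kernel_bound; [| |lra].
    - intros t _. apply (ncont_mult cauchy_density); [apply cauchy_density_cont|].
      apply (ncont_mult (fun _ => z - z')%C); [apply ncont_Cconst|apply inv_kernel_cont; lra].
    - intros t Ht. unfold k. rewrite !(Cmod_mult _ (_ * _)%C) Cmod_mult Cmod_inv; [|apply circ_off; lra].
      pose proof (circ_far c rho t z' ltac:(lra)).
      apply Rmult_le_compat; [apply Cmod_ge_0| |apply cauchy_density_bound, Ht|].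
      + apply Rmult_le_pos; [apply Cmod_ge_0|]. apply Rlt_le, Rinv_0_lt_compat. lra.
      + apply Rmult_le_compat_l; [apply Cmod_ge_0|]. apply Rinv_le_contravar; lra. }
  rewrite Cmod_mult Cmod_two_pi Rmult_comm in L. apply Rmult_le_reg_r in L; [|exact Hpi].
  eapply Rle_trans; [exact L|].
  apply (Rle_trans _ (rho * B * (Cmod (z - z') * / (rho / 2)) / (rho / 2))); [|right; field; lra].
  pose proof (Cmod_ge_0 (z - z')). apply Rmult_le_compat_l; [|apply Rinv_le_contravar; lra].
  repeat apply Rmult_le_pos; try lra. apply Rlt_le, Rinv_0_lt_compat. lra.
Qed.

(** Cauchy's formula is preserved by uniform limits, and alone it implies
    differentiability; this gives Weierstrass' theorem. *)
Lemma cauchy_repr_cder :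
  (forall z, Cmod (z - c) < rho ->
    Cint (fun t => cauchy_density t * / (circ c rho t - z))%C 0 (2 * PI) = (RtoC (2 * PI) * f z)%C) ->
  hol_disc f c rho.
Proof.
  intros H z Hz. pose proof two_pi_pos as Hpi. eexists.
  apply (cder_ext_loc (fun z => / RtoC (2 * PI) * Cint (fun t => cauchy_density t * / (circ c rho t - z)) 0 (2 * PI))%C
    _ _ _ (rho - Cmod (z - c))); [lra| |].
  - intros w Hw. rewrite H.
    + field. intro E. apply (f_equal fst) in E. simpl in E. lra.
    + pose proof (Cmod_minus_triangle z w c). lra.
  - apply (cder_mult (fun _ => / RtoC (2 * PI))%C); [apply cder_const|].
    apply (cauchy_type_cder _ c rho (rho * B)); [intros; apply cauchy_density_cont|exact cauchy_density_bound|exact Hz].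
Qed.
End Estimates.

Lemma hol_disc_circ_bound f c R0 rho : hol_disc f c R0 -> 0 <= rho < R0 ->
  exists B, 0 <= B /\ forall t, 0 <= t <= 2 * PI -> Cmod (f (circ c rho t)) <= B.
Proof.
  intros Hf Hr. pose proof two_pi_pos.
  destruct (curve_max (fun s => f (circ c rho s)) 0 (2 * PI)) as [m [Hm Hmax]]; [lra| |].
  - intros t _. apply (hol_disc_circ_cont f c R0); assumption.
  - exists (Cmod (f (circ c rho m))). split; [apply Cmod_ge_0|exact Hmax].
Qed.

Lemma cauchy_bound f c rho B z : 0 < rho -> hol_disc f c (4 * rho) ->
  (forall t, 0 <= t <= 2 * PI -> Cmod (f (circ c rho t)) <= B) -> Cmod (z - c) < rho ->
  Cmod (f z) * (rho - Cmod (z - c)) <= rho * B.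
Proof.
  intros Hr Hf HB Hz. apply (cauchy_estimate f c rho B Hr); [|exact HB|exact Hz|].
  - intro t. apply (hol_disc_circ_cont f c (4 * rho)); [exact Hf|lra].
  - exact (cauchy_formula f c rho z Hf Hz).
Qed.

Lemma cauchy_lipschitz f c rho B z z' : 0 < rho -> hol_disc f c (4 * rho) ->
  (forall t, 0 <= t <= 2 * PI -> Cmod (f (circ c rho t)) <= B) ->
  Cmod (z - c) <= rho / 2 -> Cmod (z' - c) <= rho / 2 ->
  Cmod (f z - f z') <= 4 * B / rho * Cmod (z - z').
Proof.
  intros Hr Hf HB Hz Hz'. apply (cauchy_lipschitz_aux f c rho B Hr); [|exact HB|exact Hz|exact Hz'| |].
  - intro t. apply (hol_disc_circ_cont f c (4 * rho)); [exact Hf|lra].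
  - apply (cauchy_formula f c rho z Hf). lra.
  - apply (cauchy_formula f c rho z' Hf). lra.
Qed.

(** Cauchy's formula passes to the limit. *)
Lemma weierstrass (fn : nat -> C -> C) g c r :
  (forall n, hol_disc (fn n) c r) ->
  (forall e, 0 < e -> exists n, forall z, Cmod (z - c) < r -> Cmod (fn n z - g z) <= e) ->
  hol_disc g c r.
Proof.
  intros Hfn Hunif p Hp. pose proof two_pi_pos as Hpi.
  set (rho := (r - Cmod (p - c)) / 8). assert (Hrho : 0 < rho) by (unfold rho; lra).
  assert (Hin : forall z, Cmod (z - p) < 4 * rho -> Cmod (z - c) < r).
  { intros z Hz. pose proof (Cmod_minus_triangle p z c). unfold rho in *. lra. }
  assert (Hg : forall z, Cmod (z - p) < 4 * rho -> ccont g z).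
  { intros z Hz e He. destruct (Hunif (e / 4) ltac:(lra)) as [n Hn].
    destruct (hol_disc_cont (fn n) c r z (Hfn n) (Hin z Hz) (e / 4) ltac:(lra)) as [d [Hd Hc]].
    exists (Rmin d (4 * rho - Cmod (z - p))). split; [apply Rmin_glb_lt; lra|].
    intros w Hw.
    destruct (Rlt_Rmin _ _ _ Hw) as [Hw1 Hw2].
    pose proof (Cmod_minus_triangle z w p) as T.
    specialize (Hc w Hw1). pose proof (Hn w (Hin w ltac:(lra))) as N1. pose proof (Hn z (Hin z Hz)) as N2.
    rewrite Cmod_minus_sym in N1.
    pose proof (Cmod_minus_triangle (fn n w) (g w) (g z)) as T1.
    pose proof (Cmod_minus_triangle (fn n z) (fn n w) (g z)) as T2. lra. }
  assert (Hgc : forall t, ccurve_cont (fun s => g (circ p rho s)) t).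
  { intro t. apply (ncont_comp g (circ p rho)); [|apply circ_cont]. apply Hg. rewrite circ_dist; lra. }
  destruct (curve_max (fun s => g (circ p rho s)) 0 (2 * PI)) as [m [Hm Hmax]]; [lra|intros; apply Hgc|].
  apply (cauchy_repr_cder g p rho (Cmod (g (circ p rho m))) Hrho Hgc Hmax).
  2:{ rewrite Cmod_minus_self. exact Hrho. }
  intros z Hz. apply C_eq_of_le. intros e He.
  set (K := rho * / (rho - Cmod (z - p)) * (2 * PI)).
  assert (HK : 0 < K).
  { unfold K. apply Rmult_lt_0_compat; [|lra]. apply Rmult_lt_0_compat; [lra|]. apply Rinv_0_lt_compat. lra. }
  destruct (Hunif (e / (K + 2 * PI))) as [n Hn]. { apply Rdiv_lt_0_compat; lra. }
  set (e' := e / (K + 2 * PI)) in *.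
  assert (He' : 0 < e') by (apply Rdiv_lt_0_compat; lra).
  assert (Hfnp : hol_disc (fn n) p (4 * rho)). { intros w Hw. apply (Hfn n), Hin, Hw. }
  assert (Hfc : forall t, ccurve_cont (fun s => fn n (circ p rho s)) t).
  { intro t. apply (hol_disc_circ_cont _ p (4 * rho)); [exact Hfnp|lra]. }
  pose proof (cauchy_formula (fn n) p rho z Hfnp Hz) as E. fold (cauchy_density (fn n) p rho) in E.
  set (I1 := Cint (fun t => cauchy_density g p rho t * / (circ p rho t - z))%C 0 (2 * PI)).
  change (Cint (fun t => cauchy_density (fn n) p rho t * / (circ p rho t - z))%C 0 (2 * PI) = (RtoC (2 * PI) * fn n z)%C) in E.
  assert (D : Cmod (Cint (fun t => cauchy_density (fn n) p rho t * / (circ p rho t - z))%C 0 (2 * PI) - I1) <= e' * K).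
  { unfold I1. rewrite -Cint_minus; [|intros t _; apply cauchy_integrand_cont; assumption..].
    rewrite (Cint_ext _ (fun t => ((circ p rho t - p) * (fn n (circ p rho t) - g (circ p rho t))) * / (circ p rho t - z))%C).
    2:{ intros t _. unfold cauchy_density. ring. }
    replace (e' * K) with (rho * e' / (rho - Cmod (z - p)) * (2 * PI)) by (unfold K, Rdiv; ring).
    apply cauchy_kernel_bound; [| |exact Hz].
    - intros t _. apply (ncont_mult (fun t => circ p rho t - p)%C); [apply circ_minus_cont|].
      apply ncont_Cminus; [apply Hfc|apply Hgc].
    - intros t _. rewrite Cmod_mult circ_dist; [|lra].
      apply Rmult_le_compat_l; [lra|]. apply Hn, Hin. rewrite circ_dist; lra. }
  rewrite E in D. rewrite Cmod_minus_sym in D.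
  pose proof (Hn z (Hin z ltac:(lra))) as N.
  replace (I1 - RtoC (2 * PI) * g z)%C with ((I1 - RtoC (2 * PI) * fn n z) + RtoC (2 * PI) * (fn n z - g z))%C by ring.
  eapply Rle_trans; [apply Cmod_triangle|]. rewrite Cmod_mult Cmod_two_pi.
  assert (e' * (K + 2 * PI) = e) by (unfold e'; field; lra). nra.
Qed.

(** Subtract Cauchy's formula at [c] from the one at [z]: the factor [z - c]
    comes out, and the rest is an integral of Cauchy type. Away from [c] the
    quotient is explicit. *)
Lemma hol_disc_division f c r : 0 < r -> hol_disc f c r ->
  exists q, hol_disc q c r /\ forall z, Cmod (z - c) < r -> f z = (f c + (z - c) * q z)%C.
Proof.
  intros Hr Hf. pose proof two_pi_pos as Hpi. set (rho := r / 8). assert (Hrho : 0 < rho) by (unfold rho; lra).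
  destruct (hol_disc_circ_bound f c r rho Hf ltac:(unfold rho; lra)) as [B [HB0 HB]].
  assert (Hfc : forall t, ccurve_cont (fun s => f (circ c rho s)) t).
  { intro t. apply (hol_disc_circ_cont _ c r); [exact Hf|unfold rho; lra]. }
  assert (Hf4 : hol_disc f c (4 * rho)). { intros z Hz. apply Hf. unfold rho in *. lra. }
  set (qh := fun z => (/ RtoC (2 * PI) * Cint (fun t => f (circ c rho t) * / (circ c rho t - z)) 0 (2 * PI))%C).
  assert (H2pi : RtoC (2 * PI) <> 0). { intro E. apply (f_equal fst) in E. simpl in E. lra. }
  assert (Hcc : Cmod (c - c) < rho). { rewrite Cmod_minus_self. exact Hrho. }
  assert (Hqh : forall z, Cmod (z - c) < rho -> f z = (f c + (z - c) * qh z)%C).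
  { intros z Hz. unfold qh.
    assert (Kc : forall t, ccurve_cont (fun t => f (circ c rho t) * / (circ c rho t - z))%C t).
    { intro t. apply (ncont_mult (fun t => f (circ c rho t))); [apply Hfc|apply inv_kernel_cont, Hz]. }
    assert (E : (RtoC (2 * PI) * f z - RtoC (2 * PI) * f c)%C =
       ((z - c) * Cint (fun t => f (circ c rho t) * / (circ c rho t - z)) 0 (2 * PI))%C).
    { rewrite -(cauchy_formula f c rho z Hf4 Hz) -(cauchy_formula f c rho c Hf4 Hcc).
      rewrite -Cint_minus; [|intros t _; apply (cauchy_integrand_cont f c rho Hfc); assumption..].
      rewrite -Cint_scal; [|lra|intros t _; apply Kc].
      apply Cint_ext. intros t _. field. split; apply circ_off; assumption. }
    transitivity (/ RtoC (2 * PI) * (RtoC (2 * PI) * f c + (RtoC (2 * PI) * f z - RtoC (2 * PI) * f c)))%C.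
    - field. exact H2pi.
    - rewrite E. field. exact H2pi. }
  exists (difference_quotient f c (qh c)). split.
  - intros z Hz. destruct (classic (z = c)) as [->|Hne].
    + eexists. apply (cder_ext_loc qh _ _ _ rho Hrho).
      * intros w Hw. destruct (classic (w = c)) as [->|Hne]; [rewrite difference_quotient_at; reflexivity|].
        rewrite difference_quotient_off; [|exact Hne]. rewrite (Hqh w Hw). field.
        intro E. apply Hne, Cminus_eq_zero, E.
      * apply (cder_mult (fun _ => / RtoC (2 * PI))%C); [apply cder_const|].
        apply (cauchy_type_cder (fun t => f (circ c rho t)) c rho B); [intros; apply Hfc|exact HB|exact Hcc].
    + destruct (Hf z Hz) as [m Hm]. exact (difference_quotient_cder f c _ z m Hne Hm).
  - intros z Hz. destruct (classic (z = c)) as [->|Hne]; [ring|].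
    rewrite difference_quotient_off; [|exact Hne]. field. intro E. apply Hne, Cminus_eq_zero, E.
Qed.

Lemma eq_zero_of_geometric (x : C) (K : R) : (forall n : nat, Cmod x <= K * (1 / 2) ^ n) -> x = 0.
Proof.
  intro H. apply C_eq_of_le. intros e He. replace (x - 0)%C with x by ring.
  assert (HK : 0 <= K). { specialize (H 0%nat). pose proof (Cmod_ge_0 x). simpl in H. lra. }
  destruct (geometric_small K e HK He) as [n Hn]. specialize (H n). lra.
Qed.

(** Dividing repeatedly by [z - c] gives [f z = (z - c)^n * q z] for all
    [n], because [q c = 0] by accumulation of zeros. On the circle of radius
    [rho] one has [|q| <= B / rho^n], and Cauchy's estimate carries this
    bound inside up to a factor 2; hence [|f z| <= 2 * B / 2^n] for [|z - c|
    <= rho / 2]. *)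
Lemma hol_disc_accumulating_zeros f c r : 0 < r -> hol_disc f c r ->
  (forall d, 0 < d -> exists z, z <> c /\ Cmod (z - c) < d /\ f z = 0) ->
  forall z, Cmod (z - c) <= r / 16 -> f z = 0.
Proof.
  intros Hr Hf Hzero.
  assert (Hq : forall n : nat, exists q, hol_disc q c r /\
     forall z, Cmod (z - c) < r -> f z = ((z - c) ^ n * q z)%C).
  { induction n as [|n [q [Hq Eq]]].
    - exists f. split; [exact Hf|]. intros z _. simpl. ring.
    - assert (Hcc : Cmod (c - c) < r). { rewrite Cmod_minus_self. exact Hr. }
      assert (Q0 : q c = 0).
      { apply C_eq_of_le. intros e He.
        destruct (hol_disc_cont q c r c Hq Hcc e He) as [d [Hd Hc]].
        destruct (Hzero (Rmin d r)) as [z [Hne [Hz Fz]]]; [apply Rmin_glb_lt; assumption|].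
        destruct (Rlt_Rmin _ _ _ Hz) as [Hz1 Hz2].
        assert (Qz : q z = 0).
        { rewrite (Eq z Hz2) in Fz. destruct (classic (q z = 0)) as [?|Nq]; [assumption|].
          exfalso. revert Fz. apply Cmult_neq_0; [|exact Nq]. apply Cpow_nz.
          intro E. apply Hne, Cminus_eq_zero, E. }
        specialize (Hc z Hz1). rewrite Qz Cmod_minus_sym in Hc. lra. }
      destruct (hol_disc_division q c r Hr Hq) as [q' [Hq' Eq']].
      exists q'. split; [exact Hq'|]. intros z Hz. rewrite (Eq z Hz) (Eq' z Hz) Q0. simpl. ring. }
  intros z Hz. set (rho := r / 8). assert (Hrho : 0 < rho) by (unfold rho; lra).
  destruct (hol_disc_circ_bound f c r rho Hf ltac:(unfold rho; lra)) as [B [HB0 HB]].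
  apply (eq_zero_of_geometric (f z) (2 * B)). intro n.
  destruct (Hq n) as [q [Hqn Eq]].
  assert (Hzr : Cmod (z - c) <= rho / 2) by (unfold rho; lra).
  assert (Hpn : 0 < rho ^ n) by (apply pow_lt; exact Hrho).
  assert (Bq : Cmod (q z) * (rho - Cmod (z - c)) <= rho * (B / rho ^ n)).
  { apply (cauchy_bound q c rho); [exact Hrho| | |lra].
    - intros w Hw. apply Hqn. unfold rho in *. lra.
    - intros t Ht. specialize (HB t Ht). rewrite (Eq (circ c rho t)) in HB.
      2:{ rewrite circ_dist; unfold rho in *; lra. }
      rewrite Cmod_mult Cmod_pow circ_dist in HB; [|lra].
      apply (Rmult_le_reg_l (rho ^ n)); [exact Hpn|].
      replace (rho ^ n * (B / rho ^ n)) with B by (field; lra). exact HB. }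
  assert (Bq' : Cmod (q z) <= 2 * B / rho ^ n).
  { apply (Rmult_le_reg_r (rho / 2)); [lra|].
    apply (Rle_trans _ (rho * (B / rho ^ n))); [|right; field; lra].
    eapply Rle_trans; [|exact Bq]. apply Rmult_le_compat_l; [apply Cmod_ge_0|lra]. }
  rewrite (Eq z). 2:{ unfold rho in *; lra. }
  rewrite Cmod_mult Cmod_pow.
  apply (Rle_trans _ ((rho / 2) ^ n * (2 * B / rho ^ n))).
  - apply Rmult_le_compat; [apply pow_le, Cmod_ge_0|apply Cmod_ge_0| |exact Bq'].
    apply pow_incr. split; [apply Cmod_ge_0|exact Hzr].
  - right. replace (rho / 2) with (rho * (1 / 2)) by field. rewrite Rpow_mult_distr. field. lra.
Qed.

(** The radius on which [f] is found to vanish does not depend on [d]; this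
    uniformity is used in [exit_composition]. *)
Lemma hol_disc_vanishing f c r d : 0 < r -> hol_disc f c r -> 0 < d ->
  (forall z, Cmod (z - c) < d -> f z = 0) ->
  forall z, Cmod (z - c) <= r / 16 -> f z = 0.
Proof.
  intros Hr Hf Hd H. apply hol_disc_accumulating_zeros; [exact Hr|exact Hf|].
  intros e He. set (s := Rmin d e / 2).
  assert (Hs : 0 < s /\ s < d /\ s < e).
  { unfold s. assert (0 < Rmin d e) by (apply Rmin_glb_lt; assumption).
    pose proof (Rmin_l d e). pose proof (Rmin_r d e). lra. }
  assert (E : Cmod (c + RtoC s - c) = s).
  { replace (c + RtoC s - c)%C with (RtoC s) by ring. rewrite Cmod_R Rabs_right; lra. }
  exists (c + RtoC s)%C. split; [|split; [lra|apply H; lra]].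
  intro E2. rewrite E2 in E. rewrite Cmod_minus_self in E. lra.
Qed.

(** Choose a circle around [z] on which [|h - h z| >= m > 0]. If [w] is
    closer than [m / 2] to [h z] and is not a value of [h], then [1 / (h -
    w)] is larger at the centre than on the circle, against Cauchy's
    estimate. *)
Lemma open_mapping h z r : 0 < r -> hol_disc h z r ->
  ~ (exists d, 0 < d /\ forall v, Cmod (v - z) < d -> h v = h z) ->
  exists e, 0 < e /\ forall w, Cmod (w - h z) < e -> exists v, Cmod (v - z) < r /\ h v = w.
Proof.
  intros Hr Hh Hnc. pose proof two_pi_pos as Hpi.
  assert (Hiso : exists d, 0 < d /\ forall v, v <> z -> Cmod (v - z) < d -> h v <> h z).
  { apply NNPP. intro Hno. apply Hnc. exists (r / 16). split; [lra|].
    intros v Hv. apply Cminus_eq_zero.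
    apply (hol_disc_accumulating_zeros (fun v => h v - h z)%C z r Hr); [| |lra].
    - apply hol_disc_minus; [exact Hh|]. intros w _. exists (RtoC 0). apply cder_const.
    - intros d Hd. apply NNPP. intro Hno2. apply Hno. exists d. split; [exact Hd|].
      intros w Hne Hw E. apply Hno2. exists w. split; [exact Hne|]. split; [exact Hw|]. rewrite E. ring. }
  destruct Hiso as [d [Hd Hiso]].
  set (rho := Rmin d r / 8).
  assert (Hrho : 0 < rho /\ rho < d /\ 4 * rho < r).
  { unfold rho. assert (0 < Rmin d r) by (apply Rmin_glb_lt; assumption).
    pose proof (Rmin_l d r). pose proof (Rmin_r d r). lra. }
  assert (Hc : forall w t, ccurve_cont (fun s => h (circ z rho s) - w)%C t).
  { intros w t. apply ncont_Cminus;
      [apply (hol_disc_circ_cont h z r); [exact Hh|lra]|apply ncont_Cconst]. }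
  destruct (curve_min (fun s => h (circ z rho s) - h z)%C 0 (2 * PI)) as [t0 [Ht0 Hmin]]; [lra|intros; apply Hc|].
  set (m := Cmod (h (circ z rho t0) - h z)) in *.
  assert (Hm : 0 < m).
  { apply Cmod_minus_pos, Hiso; [|rewrite circ_dist; lra].
    intro E. pose proof (circ_dist z rho t0 ltac:(lra)) as D. rewrite E in D.
    rewrite Cmod_minus_self in D. lra. }
  exists (m / 2). split; [lra|]. intros w Hw. apply NNPP. intro Hno.
  assert (Hnw : forall v, Cmod (v - z) < r -> (h v - w)%C <> 0).
  { intros v Hv E. apply Hno. exists v. split; [exact Hv|apply Cminus_eq_zero, E]. }
  assert (Hzz : Cmod (z - z) = 0). { replace (z - z)%C with (RtoC 0) by ring. apply Cmod_0. }
  assert (L : Cmod (/ (h z - w)) * (rho - Cmod (z - z)) <= rho * (2 / m)).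
  { apply (cauchy_bound (fun v => / (h v - w))%C z rho); [lra| | |lra].
    - intros v Hv. destruct (Hh v ltac:(lra)) as [l Hl]. eexists.
      apply (cder_inv (fun v => h v - w)%C); [apply Hnw; lra|]. apply cder_minus; [exact Hl|apply cder_const].
    - intros t Ht. specialize (Hmin t Ht).
      rewrite Cmod_inv; [|apply Hnw; rewrite circ_dist; lra].
      replace (2 / m) with (/ (m / 2)) by (field; lra).
      apply Rinv_le_contravar; [lra|].
      pose proof (Cmod_minus_triangle w (h (circ z rho t)) (h z)). lra. }
  rewrite Hzz Rminus_0_r Cmod_inv in L; [|apply Hnw; lra].
  assert (P : 0 < Cmod (h z - w)). { apply Cmod_gt_0, Hnw. lra. }
  rewrite Rmult_comm in L. apply Rmult_le_reg_l in L; [|lra].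
  rewrite Cmod_minus_sym in Hw.
  assert (m / 2 <= Cmod (h z - w)); [|lra].
  apply Rinv_le_contravar in L; [|apply Rinv_0_lt_compat, P].
  rewrite Rinv_inv in L. replace (/ (2 / m)) with (m / 2) in L by (field; lra). exact L.
Qed.

Lemma open_disc_of_open (U : C -> Prop) z : open U -> U z ->
  exists r, 0 < r /\ forall w, Cmod (w - z) < r -> U w.
Proof.
  intros HU Hz. destruct (HU z Hz) as [r Hr]. exists r. split; [apply cond_pos|].
  intros w Hw. apply Hr. apply (@norm_compat1 C_AbsRing C_NormedModule). exact Hw.
Qed.

Lemma open_of_open_disc (U : C -> Prop) :
  (forall z, U z -> exists r, 0 < r /\ forall w, Cmod (w - z) < r -> U w) -> open U.
Proof.
  intros H z Hz. destruct (H z Hz) as [r [Hr Hw]].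
  apply (@locally_le_locally_norm C_AbsRing C_NormedModule). exists (mkposreal r Hr). exact Hw.
Qed.

Lemma hol_disc_of_holomorphic Omega f z r :
  holomorphic Omega f -> (forall w, Cmod (w - z) < r -> Omega w) -> hol_disc f z r.
Proof. intros Hf Hr w Hw. apply ex_derive_cder, Hf, Hr, Hw. Qed.

(** The points near which [h] is identically [w] form an open set, and so do
    the other points of [Omega], by [hol_disc_vanishing]. *)
Lemma identity_principle Omega h w z0 r : open Omega -> connected Omega -> holomorphic Omega h ->
  Omega z0 -> 0 < r -> (forall v, Cmod (v - z0) < r -> h v = w) ->
  forall z, Omega z -> h z = w.
Proof.
  intros Ho Hconn Hh Hz0 Hr Hw z Hz. apply NNPP. intro Hne.
  set (U := fun p => exists r, 0 < r /\ forall v, Cmod (v - p) < r -> h v = w).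
  destruct (Hconn U (fun p => Omega p /\ ~ U p)) as [p [_ [Up [_ NUp]]]].
  - apply open_of_open_disc. intros p [rp [Hrp Hp]]. exists (rp / 2). split; [lra|].
    intros q Hq. exists (rp / 2). split; [lra|]. intros v Hv. apply Hp.
    pose proof (Cmod_minus_triangle q v p). lra.
  - apply open_of_open_disc. intros p [Op NUp].
    destruct (open_disc_of_open Omega p Ho Op) as [R0 [HR0 HR]].
    exists (R0 / 64). split; [lra|]. intros q Hq. split; [apply HR; lra|].
    intros [d [Hd Hqd]]. apply NUp. exists (R0 / 64). split; [lra|].
    intros v Hv. apply Cminus_eq_zero.
    apply (hol_disc_vanishing (fun v => h v - w)%C q (R0 / 2) d); [lra| |exact Hd| |].
    + apply hol_disc_minus; [|intros u _; exists (RtoC 0); apply cder_const].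
      apply (hol_disc_of_holomorphic Omega); [exact Hh|]. intros u Hu. apply HR.
      pose proof (Cmod_minus_triangle q u p). lra.
    + intros u Hu. rewrite (Hqd u Hu). ring.
    + pose proof (Cmod_minus_triangle p v q) as T. rewrite (Cmod_minus_sym p q) in T. lra.
  - intros p Op. destruct (classic (U p)); [left|right]; auto.
  - exists z0. split; [exact Hz0|]. exists r. split; assumption.
  - exists z. split; [exact Hz|]. split; [exact Hz|]. intros [d [Hd H]]. apply Hne, H.
    rewrite Cmod_minus_self. exact Hd.
  - contradiction.
Qed.
(** * The uniform boundedness principle *)

(** This lemma and the next ones only repeat facts on norms for complete
    modules, so that the norms in their statements are syntactically those
    of later goals. *)
Lemma cnorm_triangle {X : CompleteNormedModule C_AbsRing} (y x z : X) :
  norm (minus x z) <= norm (minus x y) + norm (minus y z).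
Proof. exact (norm_minus_triangle y x z). Qed.

Lemma cnorm_le_minus {X : CompleteNormedModule C_AbsRing} (x y : X) :
  norm x <= norm y + norm (minus x y).
Proof. exact (norm_le_minus x y). Qed.

Lemma cnorm_minus_sym {X : CompleteNormedModule C_AbsRing} (x y : X) :
  norm (minus x y) = norm (minus y x).
Proof. exact (norm_minus_sym x y). Qed.

Lemma cnorm_scal_R {X : CompleteNormedModule C_AbsRing} (r : R) (x : X) :
  norm (r *: x) <= Rabs r * norm x.
Proof. exact (norm_scal_R r x). Qed.

Lemma cauchy_seq_limit {X : CompleteNormedModule C_AbsRing} (x : nat -> X) :
  (forall e, 0 < e -> exists N, forall m, (N <= m)%nat -> norm (minus (x m) (x N)) < e) ->
  exists l, forall e, 0 < e -> exists N, forall m, (N <= m)%nat -> norm (minus (x m) l) < e.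
Proof.
  intro H.
  destruct (proj1 (@filterlim_locally_cauchy nat X eventually _ x)) as [l Hl].
  - intros [e He]. destruct (H (e / 2) ltac:(lra)) as [N HN].
    exists (fun m => (N <= m)%nat). split; [exists N; auto|].
    intros u v Hu Hv. apply (@norm_compat1 _ X).
    eapply Rle_lt_trans; [apply (norm_minus_triangle (x N))|].
    rewrite (norm_minus_sym (x N)).
    eapply Rlt_le_trans; [apply Rplus_lt_compat; [exact (HN v Hv)|exact (HN u Hu)]|simpl; lra].
  - exists l. intros e He.
    assert (Hnf := @norm_factor_gt_0 _ X).
    assert (He' : 0 < e / @norm_factor _ X) by (apply Rdiv_lt_0_compat; assumption).
    destruct (Hl (ball l (mkposreal _ He'))) as [N HN].
    { exists (mkposreal _ He'). intros y Hy. exact Hy. }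
    exists N. intros m Hm. specialize (HN m Hm). apply (@norm_compat2 _ X) in HN. simpl in HN.
    replace e with (@norm_factor _ X * (e / @norm_factor _ X)) by (field; lra). exact HN.
Qed.

Section UniformBoundedness.
Context {X : CompleteNormedModule C_AbsRing} (N : nat -> X -> R).
Context (N_plus : forall n x y, N n (plus x y) <= N n x + N n y)
  (N_scal : forall n (r : R) x, N n (r *: x) = Rabs r * N n x)
  (N_bound : forall n, exists M, forall x, N n x <= M * norm x)
  (N_pointwise : forall x, exists B n0, forall n, (n0 <= n)%nat -> N n x <= B).

Lemma seminorm_minus n x y : N n (minus x y) <= N n x + N n y.
Proof.
  eapply Rle_trans; [apply N_plus|]. apply Rplus_le_compat_l.
  replace (opp y) with ((-1) *: y).
  - rewrite N_scal Rabs_left; lra.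
  - rewrite RtoC_opp. exact (scal_opp_one y).
Qed.

(** Baire's argument. Otherwise every ball contains, for every [k], a
    smaller ball on which some seminorm with index at least [k] exceeds [k];
    the common point of a nested sequence of such balls contradicts
    pointwise boundedness. *)
Lemma uniform_ball : exists x0 r B n0, 0 < r /\
  forall n x, (n0 <= n)%nat -> norm (minus x x0) <= r -> N n x <= B.
Proof.
  apply NNPP. intro Hno.
  assert (Hbad : forall x0 r B n0, 0 < r -> exists n x, (n0 <= n)%nat /\ norm (minus x x0) <= r /\ B < N n x).
  { intros x0 r B n0 Hr. apply NNPP. intro H. apply Hno. exists x0, r, B, n0. split; [exact Hr|].
    intros n x Hn Hx. destruct (Rle_dec (N n x) B); [assumption|]. exfalso. apply H.
    exists n, x. repeat split; try assumption. lra. }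
  destruct (functional_choice (fun (s : nat * (X * R)) (s' : X * R) => 0 < snd (snd s) ->
     0 < snd s' /\ snd s' <= snd (snd s) / 2 /\ norm (minus (fst s') (fst (snd s))) <= snd (snd s) / 2 /\
     exists n, (fst s <= n)%nat /\ forall y, norm (minus y (fst s')) <= snd s' -> INR (fst s) <= N n y)) as [next Hnext].
  { intros [k [x r]]. simpl. destruct (Rlt_dec 0 r) as [Hr|Hr].
    2:{ exists (x, r). intro; contradiction. }
    destruct (Hbad x (r / 2) (INR k + 1) k ltac:(lra)) as [n [x' [Hn [Hx' HN]]]].
    destruct (N_bound n) as [M HM].
    set (M' := Rabs M + 1). assert (HM' : 0 < M') by (unfold M'; pose proof (Rabs_pos M); lra).
    (* On this radius [N n] varies by at most [1], and [INR k + 1 < N n x']. *)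
    exists (x', Rmin (r / 2) (/ M')). simpl. intros _.
    assert (Hi : 0 < / M') by (apply Rinv_0_lt_compat; exact HM').
    split; [apply Rmin_glb_lt; lra|]. split; [apply Rmin_l|]. split; [exact Hx'|].
    exists n. split; [exact Hn|]. intros y Hy.
    assert (Hy2 : norm (minus y x') <= / M') by (eapply Rle_trans; [exact Hy|apply Rmin_r]).
    assert (D : N n x' <= N n y + N n (minus x' y)).
    { rewrite -{1}(plus_minus_cancel x' y). apply N_plus. }
    assert (D2 : N n (minus x' y) <= 1).
    { eapply Rle_trans; [apply HM|]. rewrite cnorm_minus_sym.
      pose proof (norm_ge_0 (minus y x')) as P. pose proof (Rle_abs M) as A.
      apply (Rle_trans _ (M' * / M')); [|right; field; lra].
      apply (Rle_trans _ (M' * norm (minus y x'))).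
      - apply Rmult_le_compat_r; [exact P|]. unfold M'. lra.
      - apply Rmult_le_compat_l; lra. }
    lra. }
  set (s := fix s (n : nat) := match n with O => (zero : X, 1) | S k => next (k, s k) end).
  assert (Hr : forall n, 0 < snd (s n)).
  { induction n as [|n IH]; [simpl; lra|]. apply (Hnext (n, s n) IH). }
  assert (Hstep : forall n, snd (s (S n)) <= snd (s n) / 2 /\
     norm (minus (fst (s (S n))) (fst (s n))) <= snd (s n) / 2 /\
     exists m, (n <= m)%nat /\ forall y, norm (minus y (fst (s (S n)))) <= snd (s (S n)) -> INR n <= N m y).
  { intro n. destruct (Hnext (n, s n) (Hr n)) as [_ H]. exact H. }
  clearbody s.
  assert (Hdist : forall n k, norm (minus (fst (s (n + k)%nat)) (fst (s n))) <= snd (s n) - snd (s (n + k)%nat)).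
  { intros n. induction k as [|k IH].
    - rewrite Nat.add_0_r norm_minus_self. lra.
    - rewrite Nat.add_succ_r. destruct (Hstep (n + k)%nat) as [H1 [H2 _]].
      pose proof (cnorm_triangle (fst (s (n + k)%nat)) (fst (s (S (n + k)))) (fst (s n))). lra. }
  assert (Hgeo : forall n, snd (s n) <= snd (s 0%nat) * (1 / 2) ^ n).
  { induction n as [|n IH]; [simpl; lra|]. destruct (Hstep n) as [H1 _]. simpl. lra. }
  destruct (cauchy_seq_limit (fun n => fst (s n))) as [l Hl].
  { intros e He. pose proof (Hr 0%nat) as P0.
    destruct (geometric_small (snd (s 0%nat)) e ltac:(lra) He) as [K HK].
    exists K. intros m Hm. replace m with (K + (m - K))%nat by lia.
    pose proof (Hdist K (m - K)%nat). pose proof (Hr (K + (m - K))%nat). pose proof (Hgeo K). lra. }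
  assert (Hlim : forall n, norm (minus l (fst (s n))) <= snd (s n)).
  { intro n. apply le_epsilon. intros e He. destruct (Hl e He) as [K HK].
    specialize (HK (n + K)%nat ltac:(lia)). rewrite cnorm_minus_sym in HK.
    pose proof (cnorm_triangle (fst (s (n + K)%nat)) l (fst (s n))).
    pose proof (Hdist n K). pose proof (Hr (n + K)%nat). lra. }
  destruct (N_pointwise l) as [B [n0 HB]].
  destruct (INR_unbounded B) as [k1 Hk1]. set (k := Nat.max k1 n0).
  destruct (Hstep k) as [_ [_ [m [Hm HN]]]].
  specialize (HN l (Hlim (S k))). specialize (HB m ltac:(lia)).
  assert (INR k1 <= INR k) by (apply le_INR; lia). lra.
Qed.

(** Pointwise bounds are only required eventually, and so is the uniform
    one: this suits sequences [ev f (z k)] and [T (t k) f] that are known to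
    converge. *)
Lemma uniform_boundedness : exists M n0, 0 < M /\ forall n x, (n0 <= n)%nat -> N n x <= M * norm x.
Proof.
  destruct uniform_ball as [x0 [r [B [n0 [Hr H]]]]].
  exists (2 * Rabs B / r + 1), n0.
  assert (0 <= 2 * Rabs B / r). { apply Rdiv_le_0_compat; [|exact Hr]. pose proof (Rabs_pos B). lra. }
  split; [lra|]. intros n x Hn.
  destruct (Req_dec (norm x) 0) as [E|E].
  - apply norm_eq_zero in E. subst x. rewrite norm_zero.
    pose proof (N_scal n 0 zero) as Z. rewrite Rabs_R0 Rmult_0_l in Z.
    assert (E : 0 *: (zero : X) = zero) by exact (scal_zero_l (zero : X)).
    rewrite E in Z. rewrite Z. lra.
  - assert (P : 0 < norm x) by (pose proof (norm_ge_0 x); lra).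
    set (h := (r / norm x) *: x).
    assert (Pr : 0 < r / norm x) by (apply Rdiv_lt_0_compat; assumption).
    assert (Hh : norm h <= r).
    { unfold h. eapply Rle_trans; [apply cnorm_scal_R|]. rewrite Rabs_right; [|lra]. right. field. lra. }
    assert (Bh : N n h <= 2 * Rabs B).
    { replace h with (minus (plus x0 h) x0) by apply minus_plus_l.
      eapply Rle_trans; [apply seminorm_minus|].
      assert (N n (plus x0 h) <= B). { apply H; [exact Hn|]. rewrite minus_plus_l. exact Hh. }
      assert (N n x0 <= B). { apply H; [exact Hn|]. rewrite norm_minus_self. lra. }
      pose proof (Rle_abs B). lra. }
    unfold h in Bh. rewrite N_scal Rabs_right in Bh; [|lra].
    apply (Rmult_le_compat_r (norm x / r)) in Bh; [|apply Rlt_le, Rdiv_lt_0_compat; assumption].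
    replace (r / norm x * N n x * (norm x / r)) with (N n x) in Bh by (field; lra).
    replace (2 * Rabs B * (norm x / r)) with (2 * Rabs B / r * norm x) in Bh by (field; lra). lra.
Qed.
End UniformBoundedness.

(** * Local solutions of the differential equation *)

Section Picard.
Context (Omega : C -> Prop) (Omega_open : open Omega) (G : C -> C) (HG : holomorphic Omega G).

Section Iteration.
Context (p z : C) (rho L M delta : R) (HM : 0 <= M) (HL : 0 <= L) (Hdelta : 0 < delta)
  (Hz : Cmod (z - p) + M * delta < rho) (HLd : L * delta <= 1 / 2)
  (Gcont : forall w, Cmod (w - p) < rho -> ccont G w)
  (GM : forall w, Cmod (w - p) < rho -> Cmod (G w) <= M)
  (GL : forall w w', Cmod (w - p) < rho -> Cmod (w' - p) < rho ->
    Cmod (G w - G w') <= L * Cmod (w - w')).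

Fixpoint picard_iter (n : nat) (t : R) : C :=
  match n with
  | O => z
  | S k => (z + Cint (fun s => G (picard_iter k s)) 0 t)%C
  end.

(** Such a curve stays in the disc where the bounds on [G] hold. *)
Definition admissible (u : R -> C) : Prop := forall t, Rabs t < delta ->
  Cmod (u t - z) <= M * Rabs t /\ ccurve_cont u t.

Lemma admissible_in_disc u t : admissible u -> Rabs t < delta -> Cmod (u t - p) < rho.
Proof.
  intros Hu Ht. destruct (Hu t Ht) as [B _].
  pose proof (Cmod_minus_triangle z (u t) p).
  assert (M * Rabs t <= M * delta) by (apply Rmult_le_compat_l; lra). lra.
Qed.

Lemma admissible_field_cont u t : admissible u -> Rabs t < delta -> ccurve_cont (fun s => G (u s)) t.
Proof.
  intros Hu Ht. apply (ncont_comp G u); [apply Gcont, (admissible_in_disc u t Hu Ht)|apply Hu, Ht].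
Qed.

Lemma between_0_small t s : Rabs t < delta -> between 0 t s -> Rabs s <= Rabs t.
Proof. intros Ht Hs. unfold between in Hs. unfold Rabs; repeat destruct Rcase_abs; lra. Qed.

Lemma admissible_int_rderiv u t : admissible u -> Rabs t < delta ->
  crderiv everywhere (fun t => z + Cint (fun s => G (u s)) 0 t)%C t (G (u t)).
Proof.
  intros Hu Ht.
  apply (rderiv_mono_local (fun s => Rabs s < delta) _ _ t _ (delta - Rabs t)); [lra| |].
  { intros s _ Hs. pose proof (Rabs_triang_inv s t). lra. }
  replace (G (u t)) with (0 + G (u t))%C by ring.
  apply (@rderiv_plus C_NormedModule _ (fun _ => z) (fun t => Cint (fun s => G (u s)) 0 t)).
  - apply (@rderiv_const C_NormedModule).
  - apply (@vint_rderiv C_CompleteNormedModule _ (fun s => G (u s)) 0 t); [|exact Ht].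
    intros s Hs r Hr. apply admissible_field_cont; [exact Hu|].
    apply Rabs_def2 in Hs, Ht. unfold between in Hr. apply Rabs_def1; lra.
Qed.

Lemma admissible_step u : admissible u -> admissible (fun t => z + Cint (fun s => G (u s)) 0 t)%C.
Proof.
  intros Hu t Ht. split.
  - replace (z + Cint (fun s => G (u s)) 0 t - z)%C with (Cint (fun s => G (u s)) 0 t) by ring.
    rewrite -{2}(Rminus_0_r t). apply Cint_bound; intros s Hs; pose proof (between_0_small t s Ht Hs).
    + apply admissible_field_cont; [exact Hu|lra].
    + apply GM, admissible_in_disc; [exact Hu|lra].
  - exact (rderiv_ncont _ _ _ (admissible_int_rderiv u t Hu Ht)).
Qed.

Lemma picard_admissible n : admissible (picard_iter n).
Proof.
  induction n as [|n IH].
  - intros t Ht. simpl. split; [|apply ncont_Cconst].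
    rewrite Cmod_minus_self. apply Rmult_le_pos; [exact HM|apply Rabs_pos].
  - exact (admissible_step _ IH).
Qed.

Lemma picard_contraction u v K t : admissible u -> admissible v -> 0 <= K -> Rabs t < delta ->
  (forall s, Rabs s < delta -> Cmod (u s - v s) <= K) ->
  Cmod (Cint (fun s => G (u s)) 0 t - Cint (fun s => G (v s)) 0 t) <= K / 2.
Proof.
  intros Hu Hv HK Ht H.
  assert (HC : forall w, admissible w -> forall s, between 0 t s -> ccurve_cont (fun s => G (w s)) s).
  { intros w Hw s Hs. pose proof (between_0_small t s Ht Hs). apply admissible_field_cont; [exact Hw|lra]. }
  rewrite -Cint_minus; [|apply HC, Hu|apply HC, Hv].
  apply (Rle_trans _ (L * K * Rabs (t - 0))).
  - apply Cint_bound; intros s Hs; pose proof (between_0_small t s Ht Hs).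
    + apply ncont_Cminus; apply HC; assumption.
    + eapply Rle_trans; [apply GL; apply admissible_in_disc; assumption || lra|].
      apply Rmult_le_compat_l; [exact HL|]. apply H. lra.
  - rewrite Rminus_0_r. pose proof (Rabs_pos t).
    apply (Rle_trans _ (L * delta * K)); [|nra].
    replace (L * K * Rabs t) with (L * K * Rabs t) by ring.
    assert (0 <= L * K) by (apply Rmult_le_pos; assumption). nra.
Qed.

Lemma picard_step_bound n t : Rabs t < delta ->
  Cmod (picard_iter (S n) t - picard_iter n t) <= M * delta * (1 / 2) ^ n.
Proof.
  revert t. induction n as [|n IH]; intros t Ht.
  - destruct (picard_admissible 1 t Ht) as [B _]. change (picard_iter 0 t) with z. simpl pow.
    assert (M * Rabs t <= M * delta) by (apply Rmult_le_compat_l; lra). lra.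
  - change (Cmod (z + Cint (fun s => G (picard_iter (S n) s)) 0 t - (z + Cint (fun s => G (picard_iter n s)) 0 t))
      <= M * delta * (1 / 2) ^ S n).
    replace (z + Cint (fun s => G (picard_iter (S n) s)) 0 t - (z + Cint (fun s => G (picard_iter n s)) 0 t))%C with
     (Cint (fun s => G (picard_iter (S n) s)) 0 t - Cint (fun s => G (picard_iter n s)) 0 t)%C by ring.
    eapply Rle_trans; [apply (picard_contraction _ _ (M * delta * (1 / 2) ^ n));
      [apply picard_admissible|apply picard_admissible| |exact Ht|exact IH]|].
    + apply Rmult_le_pos; [nra|]. apply pow_le. lra.
    + simpl. lra.
Qed.

Lemma picard_tail n k t : Rabs t < delta ->
  Cmod (picard_iter (n + k) t - picard_iter n t) <= 2 * (M * delta) * (1 / 2) ^ n - 2 * (M * delta) * (1 / 2) ^ (n + k).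
Proof.
  intro Ht. induction k as [|k IH].
  - rewrite Nat.add_0_r. rewrite Cmod_minus_self. lra.
  - rewrite Nat.add_succ_r. pose proof (picard_step_bound (n + k) t Ht).
    pose proof (Cmod_minus_triangle (picard_iter (n + k) t) (picard_iter (S (n + k)) t) (picard_iter n t)).
    change ((1 / 2) ^ S (n + k)) with (1 / 2 * (1 / 2) ^ (n + k)). lra.
Qed.

(** Successive iterates differ by at most [M * delta / 2^n]. *)
Lemma picard_limit : exists u, forall n t, Rabs t < delta ->
  Cmod (u t - picard_iter n t) <= 2 * (M * delta) * (1 / 2) ^ n.
Proof.
  assert (HMd : 0 <= M * delta) by nra.
  assert (Hpow : forall n : nat, 0 < (1 / 2) ^ n) by (intro; apply pow_lt; lra).
  destruct (functional_choice (fun (t : R) (l : C) => Rabs t < delta -> forall n,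
     Cmod (l - picard_iter n t) <= 2 * (M * delta) * (1 / 2) ^ n)) as [u Hu].
  - intro t. destruct (Rlt_dec (Rabs t) delta) as [Ht|Ht].
    2:{ exists (RtoC 0). intro; contradiction. }
    destruct (@cauchy_seq_limit C_CompleteNormedModule (fun n => picard_iter n t)) as [l Hl].
    + intros e He.
      destruct (geometric_small (2 * (M * delta)) e ltac:(lra) He) as [K HK].
      exists K. intros m Hm. replace m with (K + (m - K))%nat by lia.
      pose proof (picard_tail K (m - K) t Ht) as T. pose proof (Hpow (K + (m - K))%nat).
      change (Cmod (picard_iter (K + (m - K)) t - picard_iter K t) < e). nra.
    + exists l. intros _ n. apply le_epsilon. intros e He. destruct (Hl e He) as [K HK].
      specialize (HK (n + K)%nat ltac:(lia)).
      change (Cmod (picard_iter (n + K) t - l) < e) in HK. rewrite Cmod_minus_sym in HK.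
      pose proof (picard_tail n K t Ht). pose proof (Hpow (n + K)%nat).
      pose proof (Cmod_minus_triangle (picard_iter (n + K) t) l (picard_iter n t)). nra.
  - exists u. intros n t Ht. apply Hu, Ht.
Qed.

(** Solutions are two-sided in time, so that no one-sided derivative has to
    be dealt with at the initial time. *)
Lemma picard_local_solution : exists u : R -> C, u 0 = z /\ forall t, Rabs t < delta ->
  Cmod (u t - p) < rho /\ crderiv everywhere u t (G (u t)).
Proof.
  destruct picard_limit as [u Hu].
  assert (HMd : 0 <= M * delta) by nra.
  assert (Hsmall : forall e, 0 < e -> exists n : nat, 2 * (M * delta) * (1 / 2) ^ n < e).
  { intros e He. apply geometric_small; lra. }
  assert (Hgood : admissible u).
  { intros t Ht. split.
    - apply le_epsilon. intros e He. destruct (Hsmall e He) as [n Hn].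
      specialize (Hu n t Ht). destruct (picard_admissible n t Ht) as [B _].
      pose proof (Cmod_minus_triangle (picard_iter n t) (u t) z). lra.
    - intros e He. destruct (Hsmall (e / 3) ltac:(lra)) as [n Hn].
      destruct (picard_admissible n t Ht) as [_ Hc]. destruct (Hc (e / 3) ltac:(lra)) as [d [Hd Hs]].
      exists (Rmin d (delta - Rabs t)). split; [apply Rmin_glb_lt; lra|]. intros s Hst.
      destruct (Rlt_Rmin _ _ _ Hst) as [H1 H2].
      assert (Hsd : Rabs s < delta) by (pose proof (Rabs_triang_inv s t); lra).
      specialize (Hs s H1). change (Cmod (picard_iter n s - picard_iter n t) < e / 3) in Hs.
      change (Cmod (u s - u t) < e).
      pose proof (Hu n s Hsd) as U1. pose proof (Hu n t Ht) as U2. rewrite Cmod_minus_sym in U2.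
      pose proof (Cmod_minus_triangle (picard_iter n s) (u s) (u t)).
      pose proof (Cmod_minus_triangle (picard_iter n t) (picard_iter n s) (u t)). lra. }
  assert (Heq : forall t, Rabs t < delta -> u t = (z + Cint (fun s => G (u s)) 0 t)%C).
  { intros t Ht. apply Cminus_eq_zero, (eq_zero_of_geometric _ (4 * (M * delta))). intro n.
    pose proof (Hu (S n) t Ht) as U1.
    assert (U2 : Cmod (Cint (fun s => G (picard_iter n s)) 0 t - Cint (fun s => G (u s)) 0 t) <= 2 * (M * delta) * (1 / 2) ^ n / 2).
    { apply picard_contraction; [apply picard_admissible|exact Hgood| |exact Ht|].
      - apply Rmult_le_pos; [lra|]. apply pow_le. lra.
      - intros s Hs. rewrite Cmod_minus_sym. apply Hu, Hs. }
    change (picard_iter (S n) t) with (z + Cint (fun s => G (picard_iter n s)) 0 t)%C in U1.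
    pose proof (Cmod_minus_triangle (z + Cint (fun s => G (picard_iter n s)) 0 t)%C (u t) (z + Cint (fun s => G (u s)) 0 t)%C) as T.
    replace (z + Cint (fun s => G (picard_iter n s)) 0 t - (z + Cint (fun s => G (u s)) 0 t))%C with
      (Cint (fun s => G (picard_iter n s)) 0 t - Cint (fun s => G (u s)) 0 t)%C in T by ring.
    change ((1 / 2) ^ S n) with (1 / 2 * (1 / 2) ^ n) in U1.
    assert (0 < (1 / 2) ^ n) by (apply pow_lt; lra). nra. }
  exists u. split.
  - rewrite Heq; [|rewrite Rabs_R0; exact Hdelta]. rewrite Cint_point. ring.
  - intros t Ht. split; [apply admissible_in_disc; assumption|].
    refine (rderiv_local _ _ _ t _ (delta - Rabs t) ltac:(lra) _ _ (admissible_int_rderiv u t Hgood Ht)).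
    + intros s _ Hs. symmetry. apply Heq. pose proof (Rabs_triang_inv s t). lra.
    + symmetry. apply Heq, Ht.
Qed.
End Iteration.

(** Holomorphic functions are locally Lipschitz by Cauchy's formula. The
    existence time is uniform for initial values near [p], which is what
    allows orbits to be continued. *)
Lemma local_existence p : Omega p -> exists r delta, 0 < r /\ 0 < delta /\
  forall z, Cmod (z - p) < r -> exists u : R -> C, u 0 = z /\
    forall t, Rabs t < delta -> Omega (u t) /\ crderiv everywhere u t (G (u t)).
Proof.
  intro Hp. destruct (open_disc_of_open Omega p Omega_open Hp) as [R0 [HR0 Hin]].
  set (rho := R0 / 8). assert (Hrho : 0 < rho) by (unfold rho; lra).
  assert (HGd : hol_disc G p R0) by (apply (hol_disc_of_holomorphic Omega); assumption).
  destruct (hol_disc_circ_bound G p R0 rho HGd ltac:(unfold rho; lra)) as [B [HB0 HB]].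
  assert (HG4 : hol_disc G p (4 * rho)). { intros w Hw. apply HGd. unfold rho in *. lra. }
  set (L := 4 * B / rho). assert (HL : 0 <= L) by (apply Rdiv_le_0_compat; lra).
  assert (GL : forall w w', Cmod (w - p) < rho / 2 -> Cmod (w' - p) < rho / 2 ->
     Cmod (G w - G w') <= L * Cmod (w - w')).
  { intros w w' Hw Hw'. apply (cauchy_lipschitz G p rho B); [assumption..|lra|lra]. }
  assert (GM : forall w, Cmod (w - p) < rho / 2 -> Cmod (G w) <= 2 * B).
  { intros w Hw. pose proof (cauchy_bound G p rho B w Hrho HG4 HB ltac:(lra)) as E.
    apply (Rmult_le_reg_r (rho / 2)); [lra|].
    apply (Rle_trans _ (rho * B)); [|right; field].
    eapply Rle_trans; [|exact E]. apply Rmult_le_compat_l; [apply Cmod_ge_0|lra]. }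
  set (delta := Rmin (rho / (4 * (2 * B + 1))) (/ (2 * (L + 1)))).
  assert (Hdelta : 0 < delta).
  { apply Rmin_glb_lt; [apply Rdiv_lt_0_compat; lra|apply Rinv_0_lt_compat; lra]. }
  assert (H1 : 2 * B * delta <= rho / 4).
  { apply (Rle_trans _ ((2 * B + 1) * (rho / (4 * (2 * B + 1))))); [|right; field; lra].
    apply Rmult_le_compat; [lra|lra|lra|apply Rmin_l]. }
  assert (H2 : L * delta <= 1 / 2).
  { apply (Rle_trans _ ((L + 1) * / (2 * (L + 1)))); [|right; field; lra].
    apply Rmult_le_compat; [lra|lra|lra|apply Rmin_r]. }
  exists (rho / 4), delta. split; [lra|]. split; [exact Hdelta|]. intros z Hz.
  destruct (picard_local_solution p z (rho / 2) L (2 * B) delta) as [u [Hu0 Hu]].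
  - lra.
  - exact HL.
  - exact Hdelta.
  - lra.
  - exact H2.
  - intros w Hw. apply (hol_disc_cont G p R0); [exact HGd|unfold rho in *; lra].
  - exact GM.
  - exact GL.
  - exists u. split; [exact Hu0|]. intros t Ht. destruct (Hu t Ht) as [A D].
    split; [apply Hin; unfold rho in *; lra|exact D].
Qed.
End Picard.

(** * Evaluations and orbits of the semigroup *)

Section Flow.
Context (Omega : C -> Prop) (Omega_open : open Omega)
  (X : CompleteNormedModule C_AbsRing) (ev : X -> C -> C) (HX : embeds_in_Hol Omega X ev).

Lemma ev_real_linear z : Omega z -> @real_linear X C_NormedModule (fun f => ev f z).
Proof.
  intro Hz. split.
  - intros f g. exact (ev_plus _ _ _ HX f g z Hz).
  - intros r f. exact (ev_scal _ _ _ HX (RtoC r) f z Hz).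
  - destruct (ev_bounded _ _ _ HX z Hz) as [M HM]. exists (Rabs M + 1).
    pose proof (Rabs_pos M). pose proof (Rle_abs M). split; [lra|].
    intro f. eapply Rle_trans; [apply HM|]. apply Rmult_le_compat_r; [apply norm_ge_0|lra].
Qed.

Lemma ev_minus f g z : Omega z -> ev (minus f g) z = (ev f z - ev g z)%C.
Proof. intro Hz. exact (real_linear_minus _ f g (ev_real_linear z Hz)). Qed.

Lemma ev_cder f z : Omega z -> cder (ev f) z (C_derive (ev f) z).
Proof. intro Hz. apply cder_C_derive, ex_derive_cder, (ev_holomorphic _ _ _ HX f z Hz). Qed.

Lemma ev_ccont f z : Omega z -> ccont (ev f) z.
Proof. intro Hz. exact (cder_ccont _ _ _ (ev_cder f z Hz)). Qed.

Lemma ev_hol_disc f c r : (forall z, Cmod (z - c) < r -> Omega z) -> hol_disc (ev f) c r.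
Proof. intros H z Hz. eexists. apply ev_cder, H, Hz. Qed.

(** Otherwise there are points [z k] tending to [p] at which the norms of
    the evaluations tend to infinity, although [ev f (z k)] converges to [ev
    f p] for each [f]. *)
Lemma ev_local_bound p : Omega p -> exists r M, 0 < r /\ 0 < M /\
  (forall z, Cmod (z - p) < r -> Omega z) /\
  forall f z, Cmod (z - p) < r -> Cmod (ev f z) <= M * norm f.
Proof.
  intro Hp. destruct (open_disc_of_open Omega p Omega_open Hp) as [r0 [Hr0 Hin]].
  assert (H : exists k : nat, forall f z, Cmod (z - p) < r0 / (INR k + 1) -> Cmod (ev f z) <= (INR k + 1) * norm f).
  { apply NNPP. intro Hno.
    assert (Hbad : forall k : nat, exists z, Cmod (z - p) < r0 / (INR k + 1) /\ exists f, (INR k + 1) * norm f < Cmod (ev f z)).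
    { intro k. apply NNPP. intro H. apply Hno. exists k. intros f z Hz.
      destruct (Rle_dec (Cmod (ev f z)) ((INR k + 1) * norm f)); [assumption|].
      exfalso. apply H. exists z. split; [exact Hz|]. exists f. lra. }
    destruct (functional_choice _ Hbad) as [z Hz].
    assert (Hk : forall k, r0 / (INR k + 1) <= r0).
    { intro k. pose proof (pos_INR k). apply (Rmult_le_reg_r (INR k + 1)); [lra|].
      unfold Rdiv. rewrite Rmult_assoc Rinv_l; nra. }
    assert (Hzin : forall k, Omega (z k)).
    { intro k. apply Hin. eapply Rlt_le_trans; [apply Hz|apply Hk]. }
    destruct (@uniform_boundedness X (fun k f => Cmod (ev f (z k)))) as [M [n0 [HM HB]]].
    - intros n f g. rewrite (ev_plus _ _ _ HX f g _ (Hzin n)). apply Cmod_triangle.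
    - intros n r f. rewrite (ev_scal _ _ _ HX _ f _ (Hzin n)) Cmod_mult Cmod_R. reflexivity.
    - intro n. exact (ev_bounded _ _ _ HX _ (Hzin n)).
    - intro f. destruct (ev_ccont f p Hp 1 ltac:(lra)) as [d [Hd Hc]].
      exists (Cmod (ev f p) + 1). destruct (INR_unbounded (r0 / d)) as [n0 Hn0]. exists n0.
      intros n Hn. assert (D : Cmod (z n - p) < d).
      { eapply Rlt_le_trans; [apply Hz|].
        apply le_INR in Hn. pose proof (pos_INR n).
        apply (Rmult_le_reg_r (INR n + 1)); [lra|].
        replace (r0 / (INR n + 1) * (INR n + 1)) with r0 by (field; lra).
        apply (Rmult_lt_compat_r d) in Hn0; [|exact Hd].
        replace (r0 / d * d) with r0 in Hn0 by (field; lra). nra. }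
      specialize (Hc _ D). pose proof (Cmod_le_minus (ev f (z n)) (ev f p)). lra.
    - destruct (INR_unbounded M) as [k Hk2]. set (m := Nat.max k n0).
      destruct (Hz m) as [_ [f Hf]]. specialize (HB m f ltac:(lia)).
      assert (INR k <= INR m) by (apply le_INR; lia). pose proof (norm_ge_0 f). nra. }
  destruct H as [k Hk]. pose proof (pos_INR k).
  exists (r0 / (INR k + 1)), (INR k + 1). split; [apply Rdiv_lt_0_compat; lra|]. split; [lra|]. split.
  - intros z Hz. apply Hin. eapply Rlt_le_trans; [exact Hz|].
    apply (Rmult_le_reg_r (INR k + 1)); [lra|]. unfold Rdiv. rewrite Rmult_assoc Rinv_l; nra.
  - intros f z Hz. apply Hk, Hz.
Qed.

Lemma ev_local_lipschitz p : Omega p -> exists r M, 0 < r /\ 0 < M /\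
  (forall z, Cmod (z - p) < r -> Omega z) /\
  (forall f z, Cmod (z - p) < r -> Cmod (ev f z) <= M * norm f) /\
  forall f z z', Cmod (z - p) < r -> Cmod (z' - p) < r ->
    Cmod (ev f z - ev f z') <= M * norm f * Cmod (z - z').
Proof.
  intro Hp. destruct (ev_local_bound p Hp) as [r [M [Hr [HM [Hin HB]]]]].
  exists (r / 8), (M + 4 * M / (r / 4)).
  assert (H4 : 0 < 4 * M / (r / 4)) by (apply Rdiv_lt_0_compat; lra).
  split; [lra|]. split; [lra|]. split; [intros z Hz; apply Hin; lra|]. split.
  - intros f z Hz. pose proof (norm_ge_0 f). specialize (HB f z ltac:(lra)). nra.
  - intros f z z' Hz Hz'.
    assert (L : Cmod (ev f z - ev f z') <= 4 * (M * norm f) / (r / 4) * Cmod (z - z')).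
    { apply (cauchy_lipschitz (ev f) p (r / 4)); [lra| | |lra|lra].
      - intros w Hw. eexists. apply ev_cder, Hin. lra.
      - intros t _. apply HB. rewrite circ_dist; lra. }
    pose proof (norm_ge_0 f). pose proof (Cmod_ge_0 (z - z')%C).
    replace (4 * (M * norm f) / (r / 4)) with (4 * M / (r / 4) * norm f) in L by (field; lra).
    assert (0 <= M * norm f * Cmod (z - z')) by (repeat apply Rmult_le_pos; lra). nra.
Qed.

Context (T : R -> X -> X) (HT : C0_semigroup X T).

Lemma T_minus t f g : 0 <= t -> T t (minus f g) = minus (T t f) (T t g).
Proof.
  intro Ht. destruct (C0_linear _ _ HT t Ht) as [Hp Hs _].
  unfold minus. rewrite Hp. f_equal.
  assert (E : forall u : X, opp u = (-1) *: u).
  { intros u. rewrite RtoC_opp. symmetry. exact (scal_opp_one u). }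
  rewrite !E. apply Hs.
Qed.

Lemma T_real_linear t : 0 <= t -> real_linear (T t).
Proof.
  intro Ht. destruct (C0_linear _ _ HT t Ht) as [Hp Hs Hn]. split; [exact Hp| |exact Hn].
  intros r x. apply Hs.
Qed.

Lemma T_cont_at_0 f e : 0 < e -> exists d, 0 < d /\ forall t, 0 <= t < d -> norm (minus (T t f) f) < e.
Proof.
  intro He.
  assert (Hnf := @norm_factor_gt_0 _ X).
  assert (He' : 0 < e / @norm_factor _ X) by (apply Rdiv_lt_0_compat; assumption).
  destruct (C0_continuous _ _ HT f (ball f (mkposreal _ He'))) as [d Hd].
  { exists (mkposreal _ He'). intros y Hy. exact Hy. }
  exists d. split; [apply cond_pos|]. intros t [Ht0 Ht].
  destruct (Req_dec t 0) as [->|Hne].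
  - rewrite (C0_zero _ _ HT) norm_minus_self. exact He.
  - assert (B : ball 0 d t). { change (Rabs (t - 0) < d). rewrite Rminus_0_r Rabs_right; lra. }
    specialize (Hd t B ltac:(lra)). apply (@norm_compat2 _ X) in Hd. simpl in Hd.
    replace e with (@norm_factor _ X * (e / @norm_factor _ X)) by (field; lra). exact Hd.
Qed.

(** Uniform boundedness along a sequence of times tending to [0] at which
    the norms would be unbounded. *)
Lemma T_bounded_near_0 : exists d M, 0 < d /\ 0 < M /\ forall t f, 0 <= t <= d -> norm (T t f) <= M * norm f.
Proof.
  apply NNPP. intro Hno.
  assert (Hbad : forall k : nat, exists t, (0 <= t <= / (INR k + 1)) /\ exists f, (INR k + 1) * norm f < norm (T t f)).
  { intro k. apply NNPP. intro H. apply Hno. pose proof (pos_INR k).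
    exists (/ (INR k + 1)), (INR k + 1). split; [apply Rinv_0_lt_compat; lra|]. split; [lra|].
    intros t f Ht. destruct (Rle_dec (norm (T t f)) ((INR k + 1) * norm f)); [assumption|].
    exfalso. apply H. exists t. split; [exact Ht|]. exists f. lra. }
  destruct (functional_choice _ Hbad) as [t Ht].
  assert (Ht0 : forall k, 0 <= t k) by (intro k; apply (Ht k)).
  destruct (@uniform_boundedness X (fun k f => norm (T (t k) f))) as [M [n0 [HM HB]]].
  - intros n f g. rewrite (real_linear_plus _ (T_real_linear _ (Ht0 n))). apply norm_triangle.
  - intros n r f. rewrite (real_linear_scal _ (T_real_linear _ (Ht0 n))).
    apply Rle_antisym; [apply cnorm_scal_R|].
    destruct (Req_dec r 0) as [->|Hr].
    + rewrite Rabs_R0 Rmult_0_l. apply norm_ge_0.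
    + pose proof (cnorm_scal_R (/ r) (r *: (T (t n) f))) as E.
      replace ((/ r) *: (r *: (T (t n) f))) with (T (t n) f) in E.
      * rewrite Rabs_inv in E. pose proof (Rabs_pos_lt r Hr) as P.
        apply (Rmult_le_compat_l (Rabs r)) in E; [|lra].
        rewrite -Rmult_assoc Rinv_r in E; [|lra]. rewrite Rmult_1_l in E. exact E.
      * symmetry. transitivity ((/ r * r) *: (T (t n) f)).
        -- rewrite RtoC_mult. exact (scal_assoc (RtoC (/ r) : C_AbsRing) (RtoC r) _).
        -- rewrite Rinv_l; [|exact Hr]. exact (scal_one (T (t n) f)).
  - intro n. destruct (real_linear_bound _ (T_real_linear _ (Ht0 n))) as [M [_ HM]]. exists M. exact HM.
  - intro f. destruct (T_cont_at_0 f 1 ltac:(lra)) as [d [Hd Hc]].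
    exists (norm f + 1). destruct (INR_unbounded (/ d)) as [n0 Hn0]. exists n0.
    intros n Hn. assert (D : t n < d).
    { eapply Rle_lt_trans; [apply Ht|]. apply le_INR in Hn.
      rewrite -(Rinv_inv d). apply Rinv_lt_contravar; [|lra].
      apply Rmult_lt_0_compat; [apply Rinv_0_lt_compat, Hd|]. pose proof (pos_INR n). lra. }
    specialize (Hc (t n) (conj (Ht0 n) D)).
    pose proof (cnorm_le_minus (T (t n) f) f). lra.
  - destruct (INR_unbounded M) as [k Hk]. set (m := Nat.max k n0).
    destruct (Ht m) as [_ [f Hf]]. specialize (HB m f ltac:(lia)).
    assert (INR k <= INR m) by (apply le_INR; lia). pose proof (norm_ge_0 f). nra.
Qed.

Lemma T_locally_bounded b : exists M, 0 < M /\ forall t f, 0 <= t <= b -> norm (T t f) <= M * norm f.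
Proof.
  destruct T_bounded_near_0 as [d [M [Hd [HM HB]]]].
  assert (H : forall n : nat, exists K, 0 < K /\ forall t f, 0 <= t <= INR n * d -> norm (T t f) <= K * norm f).
  { induction n as [|n [K [HK IH]]].
    - exists 1. split; [lra|]. intros t f Ht. simpl in Ht. replace t with 0 by lra. rewrite (C0_zero _ _ HT). lra.
    - exists (K + K * M). split; [nra|]. intros t f Ht. rewrite S_INR in Ht. pose proof (norm_ge_0 f) as P.
      assert (0 <= K * M * norm f) by (repeat apply Rmult_le_pos; lra).
      destruct (Rle_dec t (INR n * d)) as [Hle|Hgt].
      + specialize (IH t f ltac:(lra)). nra.
      + pose proof (pos_INR n). assert (0 <= INR n * d) by nra.
        replace t with (INR n * d + (t - INR n * d)) by ring.
        rewrite (C0_plus _ _ HT); [|lra|lra].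
        eapply Rle_trans; [apply IH; lra|].
        specialize (HB (t - INR n * d) f ltac:(lra)). nra. }
  destruct (INR_unbounded (b / d)) as [n Hn]. destruct (H n) as [K [HK HKB]].
  exists K. split; [exact HK|]. intros t f Ht. apply HKB. split; [lra|].
  apply (Rmult_lt_compat_r d) in Hn; [|exact Hd]. replace (b / d * d) with b in Hn by (field; lra). lra.
Qed.

Lemma T_orbit_unif_cont b f e : 0 < e -> exists d, 0 < d /\
  forall s t, 0 <= s <= b -> 0 <= t <= b -> Rabs (t - s) < d -> norm (minus (T t f) (T s f)) < e.
Proof.
  intro He. destruct (T_locally_bounded b) as [M [HM HB]].
  destruct (T_cont_at_0 f (e / M)) as [d [Hd Hc]]; [apply Rdiv_lt_0_compat; assumption|].
  exists d. split; [exact Hd|].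
  assert (K : forall s t, 0 <= s -> s <= t -> t <= b -> t - s < d -> norm (minus (T t f) (T s f)) < e).
  { intros s t H0 Hst Htb Hd'. replace t with (s + (t - s)) by ring.
    rewrite (C0_plus _ _ HT); [|lra|lra]. rewrite -T_minus; [|exact H0].
    eapply Rle_lt_trans; [apply HB; lra|].
    specialize (Hc (t - s) ltac:(lra)).
    apply Rlt_div_l in Hc; [|exact HM]. exact Hc. }
  intros s t Hs Ht Hst. apply Rabs_def2 in Hst.
  destruct (Rle_dec s t).
  - apply K; lra.
  - rewrite cnorm_minus_sym. apply K; lra.
Qed.

Lemma orbit_ncont f t : ncont (fun s => T (Rabs s) f) t.
Proof.
  intros e He. destruct (T_orbit_unif_cont (Rabs t + 1) f e He) as [d [Hd Hc]].
  exists (Rmin 1 d). split; [apply Rmin_glb_lt; lra|]. intros s Hs.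
  destruct (Rlt_Rmin _ _ _ Hs) as [H1 H2].
  pose proof (Rabs_triang_inv s t). pose proof (Rabs_triang_inv2 s t).
  pose proof (Rabs_pos s). pose proof (Rabs_pos t).
  apply Hc; lra.
Qed.

(** The absolute value extends the orbit continuously to negative times, so
    that the integrand is continuous on the whole line. *)
Definition orbit_int (g : X) (t : R) : X := vint (fun s => T (Rabs s) g) 0 t.

Lemma orbit_int_0 g : orbit_int g 0 = zero.
Proof. apply vint_point. Qed.

Lemma orbit_int_rderiv g t : 0 <= t -> rderiv (fun s => 0 <= s) (orbit_int g) t (T t g).
Proof.
  intro Ht. rewrite -{2}(Rabs_right t); [|lra].
  apply (vint_rderiv _ (fun s => T (Rabs s) g) 0 t); [|exact Ht].
  intros s _ r _. apply orbit_ncont.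
Qed.

(** Both sides vanish for [r = 0] and have the same derivative in [r]. *)
Lemma T_orbit_int g t r : 0 <= t -> 0 <= r ->
  T t (orbit_int g r) = minus (orbit_int g (t + r)) (orbit_int g t).
Proof.
  intros Ht Hr. apply minus_zero_eq.
  set (D := fun x => minus (T t (orbit_int g x)) (minus (orbit_int g (t + x)) (orbit_int g t))).
  change (D r = zero). transitivity (D 0).
  - apply (rderiv_zero_const D 0 r Hr). intros x Hx.
    assert (E : (zero : X) = minus (T t (T x g)) (minus (T (t + x) g) zero)).
    { rewrite (minus_zero_r (T (t + x) g)) (C0_plus _ _ HT); [|lra|lra]. symmetry. exact (minus_eq_zero (T t (T x g))). }
    rewrite E. unfold D.
    apply (rderiv_minus _ (fun s => T t (orbit_int g s)) (fun s => minus (orbit_int g (t + s)) (orbit_int g t))).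
    + apply (rderiv_linear (T t)); [apply T_real_linear, Ht|].
      apply (rderiv_mono (fun s => 0 <= s)); [intros; lra|]. apply orbit_int_rderiv; lra.
    + apply (rderiv_minus _ (fun s => orbit_int g (t + s)) (fun s => orbit_int g t)); [|exact (rderiv_const _ (orbit_int g t) x)].
      apply (rderiv_mono (fun s => 0 <= t + s)); [intros; lra|].
      apply rderiv_shift, orbit_int_rderiv. lra.
  - unfold D. rewrite Rplus_0_r orbit_int_0.
    assert (T0 : T t zero = zero).
    { transitivity (T t (minus zero zero)); [apply f_equal; symmetry; exact (minus_eq_zero (zero : X))|].
      rewrite T_minus; [|exact Ht]. exact (minus_eq_zero (T t zero)). }
    rewrite T0. rewrite (minus_eq_zero (orbit_int g t)). exact (minus_eq_zero (zero : X)).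
Qed.

Lemma T_orbit_int_rderiv g eps t : 0 <= eps -> 0 <= t ->
  rderiv (fun s => 0 <= s) (fun s => T s (orbit_int g eps)) t (minus (T (t + eps) g) (T t g)).
Proof.
  intros He Ht.
  assert (H : rderiv (fun s => 0 <= s) (fun s => minus (orbit_int g (eps + s)) (orbit_int g s)) t
     (minus (T (t + eps) g) (T t g))).
  { apply (rderiv_minus _ (fun s => orbit_int g (eps + s)) (orbit_int g)); [|apply orbit_int_rderiv, Ht].
    apply (rderiv_mono (fun s => 0 <= eps + s)); [intros; lra|].
    apply rderiv_shift. rewrite (Rplus_comm t). apply orbit_int_rderiv. lra. }
  assert (E : forall s, 0 <= s -> minus (orbit_int g (eps + s)) (orbit_int g s) = T s (orbit_int g eps)).
  { intros s Hs. rewrite T_orbit_int; [|exact Hs|exact He]. rewrite (Rplus_comm s). reflexivity. }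
  refine (rderiv_local _ _ _ t _ 1 ltac:(lra) _ _ H).
  - intros s Hs _. apply E, Hs.
  - apply E, Ht.
Qed.

Lemma generator_of_rderiv f k :
  rderiv (fun s => 0 <= s) (fun s => T s f) 0 k -> generator T f k.
Proof.
  intros H P [e He]. destruct (H (e / 2)) as [d [Hd Hs]]. { pose proof (cond_pos e). lra. }
  exists (mkposreal d Hd). intros s Hsd Hs0. apply He, (@norm_compat1 _ X).
  assert (Hsd' : Rabs (s - 0) < d) by exact Hsd.
  specialize (Hs s ltac:(lra) Hsd'). rewrite Rminus_0_r (C0_zero _ _ HT) (Rabs_right s) in Hs; [|lra].
  assert (Eq : minus ((/ s) *: (minus (T s f) f)) k =
    (/ s) *: (minus (minus (T s f) f) (s *: k))).
  { symmetry. etransitivity; [exact (scal_minus_distr_l (RtoC (/ s) : C_AbsRing) _ _)|].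
    apply f_equal. etransitivity; [exact (scal_assoc (RtoC (/ s) : C_AbsRing) (RtoC s) k)|].
    etransitivity; [|exact (scal_one k)]. apply (f_equal (fun c : C_AbsRing => scal c k)).
    change (RtoC (/ s) * RtoC s = RtoC 1)%C. rewrite -RtoC_mult Rinv_l; [reflexivity|lra]. }
  eapply Rle_lt_trans; [right; exact (f_equal norm Eq)|].
  eapply Rle_lt_trans; [apply cnorm_scal_R|].
  assert (Pi : 0 < / s) by (apply Rinv_0_lt_compat; exact Hs0).
  rewrite (Rabs_right (/ s)); [|lra].
  apply (Rmult_le_compat_l (/ s)) in Hs; [|lra].
  replace (/ s * (e / 2 * s)) with (e / 2) in Hs by (field; lra).
  eapply Rle_lt_trans; [exact Hs|]. pose proof (cond_pos e). lra.
Qed.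

(** The vectors [orbit_int g eps] and their orbits lie in the domain of the
    generator, and the generator maps them to explicit vectors. *)
Lemma generator_orbit_int g eps t : 0 <= eps -> 0 <= t ->
  generator T (T t (orbit_int g eps)) (minus (T (t + eps) g) (T t g)).
Proof.
  intros He Ht. apply generator_of_rderiv.
  assert (H : rderiv (fun s => 0 <= s) (fun s => T s (orbit_int g eps)) (t + 0) (minus (T (t + eps) g) (T t g))).
  { rewrite Rplus_0_r. apply T_orbit_int_rderiv; assumption. }
  apply rderiv_shift in H.
  assert (E : forall s, 0 <= s -> T (t + s) (orbit_int g eps) = T s (T t (orbit_int g eps))).
  { intros s Hs. rewrite Rplus_comm. apply (C0_plus _ _ HT); assumption. }
  apply (rderiv_mono (fun s => 0 <= t + s) (fun s => 0 <= s)) in H; [|intros; lra].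
  refine (rderiv_local _ _ _ 0 _ 1 ltac:(lra) _ _ H).
  - intros s Hs _. apply E, Hs.
  - apply E. lra.
Qed.
Context (G : C -> C) (HG : holomorphic Omega G)
  (Hgen : forall f g : X, generator T f g ->
     forall z, Omega z -> ev g z = (G z * C_derive (ev f) z)%C).

(** * Transport along solutions *)

(** The chain rule for [(F x) (v x)]; uniform boundedness of the evaluations
    near [v s] makes the first-order expansion of [F] in [X] valid at the
    moving point [v x]. *)
Lemma ev_path_rderiv D (F : R -> X) (v : R -> C) s k m :
  Omega (v s) -> rderiv D F s k -> crderiv D v s m ->
  crderiv D (fun x => ev (F x) (v x)) s (ev k (v s) + C_derive (ev (F s)) (v s) * m)%C.
Proof.
  intros Hs HF Hv eta He.
  destruct (ev_local_bound (v s) Hs) as [r [M [Hr [HM [Hin HB]]]]].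
  destruct (rderiv_near D v s m r Hv Hr) as [d1 [Hd1 H1]].
  destruct (HF (eta / (3 * M))) as [d2 [Hd2 H2]]. { apply Rdiv_lt_0_compat; lra. }
  destruct (ev_ccont k (v s) Hs (eta / 3) ltac:(lra)) as [d3 [Hd3 H3]].
  destruct (rderiv_near D v s m d3 Hv Hd3) as [d4 [Hd4 H4]].
  destruct (rderiv_comp (ev (F s)) D v s _ m (ev_cder (F s) (v s) Hs) Hv (eta / 3) ltac:(lra)) as [d5 [Hd5 H5]].
  exists (Rmin (Rmin d1 d2) (Rmin d4 d5)). split; [repeat apply Rmin_glb_lt; assumption|].
  intros x Dx Hx.
  pose proof (Rmin_l (Rmin d1 d2) (Rmin d4 d5)). pose proof (Rmin_r (Rmin d1 d2) (Rmin d4 d5)).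
  pose proof (Rmin_l d1 d2). pose proof (Rmin_r d1 d2). pose proof (Rmin_l d4 d5). pose proof (Rmin_r d4 d5).
  specialize (H1 x Dx ltac:(lra)). specialize (H2 x Dx ltac:(lra)).
  specialize (H4 x Dx ltac:(lra)). specialize (H5 x Dx ltac:(lra)).
  change (Cmod (v x - v s) < r) in H1. change (Cmod (v x - v s) < d3) in H4.
  specialize (H3 (v x) H4).
  pose proof (Hin _ H1) as Ox.
  change (Cmod (ev (F s) (v x) - ev (F s) (v s) - RtoC (x - s) * (C_derive (ev (F s)) (v s) * m)) <= eta / 3 * Rabs (x - s)) in H5.
  change (Cmod (ev (F x) (v x) - ev (F s) (v s) - RtoC (x - s) * (ev k (v s) + C_derive (ev (F s)) (v s) * m)) <= eta * Rabs (x - s)).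
  pose proof (HB (minus (minus (F x) (F s)) ((x - s) *: k)) (v x) H1) as B1.
  rewrite !(ev_minus _ _ _ Ox) (ev_scal _ _ _ HX _ _ _ Ox) in B1.
  assert (B2 : M * norm (minus (minus (F x) (F s)) ((x - s) *: k)) <= eta / 3 * Rabs (x - s)).
  { apply (Rle_trans _ (M * (eta / (3 * M) * Rabs (x - s)))).
    - apply Rmult_le_compat_l; [lra|exact H2].
    - right. field. lra. }
  replace (ev (F x) (v x) - ev (F s) (v s) - RtoC (x - s) * (ev k (v s) + C_derive (ev (F s)) (v s) * m))%C with
    ((ev (F x) (v x) - ev (F s) (v x) - RtoC (x - s) * ev k (v x)) + RtoC (x - s) * (ev k (v x) - ev k (v s)) +
     (ev (F s) (v x) - ev (F s) (v s) - RtoC (x - s) * (C_derive (ev (F s)) (v s) * m)))%C by ring.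
  eapply Rle_trans; [apply Cmod_triangle|].
  eapply Rle_trans; [apply Rplus_le_compat_r, Cmod_triangle|].
  rewrite Cmod_mult Cmod_R.
  assert (Rabs (x - s) * Cmod (ev k (v x) - ev k (v s)) <= Rabs (x - s) * (eta / 3)).
  { apply Rmult_le_compat_l; [apply Rabs_pos|lra]. }
  lra.
Qed.

Definition solves_on (v : R -> C) (t : R) : Prop :=
  forall s, 0 <= s <= t -> Omega (v s) /\ crderiv (fun x => 0 <= x <= t) v s (G (v s)).

(** The generator acts as [h |-> G * h'], so the derivative of [s |-> (T (t
    + r - s) f) (v s)] vanishes. *)
Lemma transport_smooth v t g eps r : 0 <= t -> 0 <= r -> 0 <= eps -> solves_on v t ->
  ev (T (t + r) (orbit_int g eps)) (v 0) = ev (T r (orbit_int g eps)) (v t).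
Proof.
  intros Ht Hr He Hv.
  set (f := orbit_int g eps).
  set (psi := fun s => ev (T (t + r - s) f) (v s)).
  assert (E : psi t = psi 0).
  { apply (@rderiv_zero_const C_NormedModule psi 0 t Ht). intros s Hs.
    destruct (Hv s Hs) as [Os Ds].
    set (a := t + r - s). assert (Ha : 0 <= a) by (unfold a; lra).
    change (@zero C_NormedModule) with (RtoC 0).
    assert (K : ev (minus (T (a + eps) g) (T a g)) (v s) = (G (v s) * C_derive (ev (T a f)) (v s))%C).
    { apply (Hgen (T a f)); [|exact Os]. apply (generator_orbit_int); assumption. }
    replace (RtoC 0) with (ev (opp (minus (T (a + eps) g) (T a g))) (v s) + C_derive (ev (T a f)) (v s) * G (v s))%C.
    - apply (ev_path_rderiv _ (fun x => T (t + r - x) f) v s); [exact Os| |exact Ds].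
      apply (rderiv_mono (fun x => 0 <= t + r - x)); [intros; lra|].
      apply (rderiv_flip (fun x => 0 <= x) (fun x => T x f) (t + r) s).
      apply (T_orbit_int_rderiv); assumption.
    - rewrite opp_minus (ev_minus _ _ _ Os).
      rewrite (ev_minus _ _ _ Os) in K.
      replace (C_derive (ev (T a f)) (v s) * G (v s))%C with (ev (T (a + eps) g) (v s) - ev (T a g) (v s))%C; [ring|].
      rewrite K. ring. }
  unfold psi in E. rewrite Rminus_0_r in E. replace (t + r - t) with r in E by ring. symmetry. exact E.
Qed.

(** The difference of the two sides is a bounded linear function of [g] that
    vanishes at all vectors [orbit_int g eps], and [orbit_int g eps / eps]
    tends to [g]. *)
Lemma transport v t g r : 0 <= t -> 0 <= r -> solves_on v t ->
  ev (T (t + r) g) (v 0) = ev (T r g) (v t).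
Proof.
  intros Ht Hr Hv.
  assert (O0 : Omega (v 0)) by (apply (Hv 0); lra). assert (Ot : Omega (v t)) by (apply (Hv t); lra).
  assert (L1 : @real_linear X C_NormedModule (fun f => ev (T (t + r) f) (v 0))).
  { apply (real_linear_comp (T (t + r)) (fun f => ev f (v 0)));
      [apply (T_real_linear); lra|apply (ev_real_linear _ O0)]. }
  assert (L2 : @real_linear X C_NormedModule (fun f => ev (T r f) (v t))).
  { apply (real_linear_comp (T r) (fun f => ev f (v t)));
      [apply (T_real_linear); lra|apply (ev_real_linear _ Ot)]. }
  destruct (real_linear_bound _ L1) as [M1 [HM1 B1]]. destruct (real_linear_bound _ L2) as [M2 [HM2 B2]].
  apply C_eq_of_le. intros e He.
  destruct (orbit_int_rderiv g 0 ltac:(lra) (e / (M1 + M2))) as [d [Hd Hs]].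
  { apply Rdiv_lt_0_compat; lra. }
  set (eps := d / 2). assert (Heps : 0 < eps) by (unfold eps; lra).
  assert (Heps' : Rabs (eps - 0) < d). { rewrite Rminus_0_r Rabs_right; unfold eps; lra. }
  specialize (Hs eps ltac:(lra) Heps').
  rewrite Rminus_0_r orbit_int_0 (C0_zero _ _ HT) (Rabs_right eps) in Hs; [|lra].
  set (I := orbit_int g eps) in *.
  assert (HI : norm (minus I (eps *: g)) <= e / (M1 + M2) * eps).
  { rewrite -{1}(minus_zero_r I). exact Hs. }
  set (h := minus I (eps *: g)) in *.
  pose proof (transport_smooth v t g eps r Ht Hr ltac:(lra) Hv) as E. fold I in E.
  pose proof (real_linear_minus _ I (eps *: g) L1) as E1.
  pose proof (real_linear_minus _ I (eps *: g) L2) as E2.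
  rewrite (real_linear_scal _ L1) in E1. rewrite (real_linear_scal _ L2) in E2. fold h in E1, E2.
  change (ev (T (t + r) h) (v 0) = ev (T (t + r) I) (v 0) - RtoC eps * ev (T (t + r) g) (v 0))%C in E1.
  change (ev (T r h) (v t) = ev (T r I) (v t) - RtoC eps * ev (T r g) (v t))%C in E2.
  assert (E3 : (RtoC eps * (ev (T (t + r) g) (v 0) - ev (T r g) (v t)))%C = (ev (T r h) (v t) - ev (T (t + r) h) (v 0))%C).
  { rewrite E1 E2 E. ring. }
  apply (f_equal Cmod) in E3. rewrite Cmod_mult Cmod_R Rabs_right in E3; [|lra].
  apply (Rmult_le_reg_l eps); [exact Heps|]. rewrite E3.
  eapply Rle_trans; [apply Cmod_minus_le|].
  pose proof (B1 h) as C1. pose proof (B2 h) as C2.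
  change (Cmod (ev (T (t + r) h) (v 0)) <= M1 * norm h) in C1.
  change (Cmod (ev (T r h) (v t)) <= M2 * norm h) in C2.
  apply (Rle_trans _ ((M1 + M2) * norm h)); [lra|].
  apply (Rle_trans _ ((M1 + M2) * (e / (M1 + M2) * eps))).
  - apply Rmult_le_compat_l; [lra|exact HI].
  - right. field. lra.
Qed.

Context (e1 : X) (He1 : forall z, Omega z -> ev e1 z = z).

(** By [solution_follows] every solution starting at [z] must be this curve,
    which is defined for all times before anything is known about solutions. *)
Definition flow (t : R) (z : C) : C := ev (T t e1) z.

Lemma flow_0 z : Omega z -> flow 0 z = z.
Proof. intro Hz. unfold flow. rewrite (C0_zero _ _ HT). apply He1, Hz. Qed.

(** Up to time [s] the curve [flow t z] stays in [Omega] and the semigroup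
    is transported along it. Stated without derivatives, this concatenates
    well. *)
Definition follows (z : C) (s : R) : Prop := forall t, 0 <= t <= s ->
  Omega (flow t z) /\ forall g r, 0 <= r -> ev (T (t + r) g) z = ev (T r g) (flow t z).

Lemma follows_le z s s' : s' <= s -> follows z s -> follows z s'.
Proof. intros H F t Ht. apply F. lra. Qed.

Lemma follows_0 z : Omega z -> follows z 0.
Proof.
  intros Hz t Ht. replace t with 0 by lra. rewrite (flow_0 z Hz). split; [exact Hz|].
  intros g r Hr. rewrite Rplus_0_l. reflexivity.
Qed.

Lemma flow_add z s t r : follows z s -> 0 <= t <= s -> 0 <= r -> flow (t + r) z = flow r (flow t z).
Proof. intros F Ht Hr. exact (proj2 (F t Ht) e1 r Hr). Qed.

Lemma follows_concat z s s' : 0 <= s -> follows z s -> follows (flow s z) s' -> follows z (s + s').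
Proof.
  intros Hs F F' t Ht. destruct (Rle_dec t s) as [Hle|Hgt]; [apply F; lra|].
  destruct (F' (t - s) ltac:(lra)) as [O' H'].
  replace t with (s + (t - s)) by ring.
  rewrite (flow_add z s s (t - s) F); [|lra|lra]. split; [exact O'|].
  intros g r Hr. rewrite Rplus_assoc. rewrite (proj2 (F s ltac:(lra)) g); [|lra]. apply H', Hr.
Qed.

Lemma solution_follows v t : 0 <= t -> solves_on v t ->
  v t = flow t (v 0) /\ forall g r, 0 <= r -> ev (T (t + r) g) (v 0) = ev (T r g) (v t).
Proof.
  intros Ht Hv. split; [|intros g r Hr; apply transport; assumption].
  pose proof (transport v t e1 0 Ht ltac:(lra) Hv) as E.
  rewrite Rplus_0_r (C0_zero _ _ HT) He1 in E; [symmetry; exact E|apply (Hv t); lra].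
Qed.

Lemma follows_local p : Omega p -> exists r delta, 0 < r /\ 0 < delta /\
  forall z, Cmod (z - p) < r -> follows z delta /\
    forall t, 0 <= t < delta -> crderiv (fun s => 0 <= s) (fun s => flow s z) t (G (flow t z)).
Proof.
  intro Hp. destruct (local_existence Omega Omega_open G HG p Hp) as [r [delta [Hr [Hd H]]]].
  exists r, (delta / 2). split; [exact Hr|]. split; [lra|]. intros z Hz.
  destruct (H z Hz) as [u [Hu0 Hu]].
  assert (S : forall t, 0 <= t <= delta / 2 -> solves_on u t).
  { intros t Ht s Hs. destruct (Hu s) as [O D]; [rewrite Rabs_right; lra|]. split; [exact O|].
    apply (rderiv_mono everywhere); [intros; exact I|exact D]. }
  assert (E : forall t, 0 <= t <= delta / 2 -> u t = flow t z).
  { intros t Ht. rewrite -Hu0. apply (solution_follows u t); [lra|apply S, Ht]. }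
  split.
  - intros t Ht. rewrite -(E t Ht). split; [apply Hu; rewrite Rabs_right; lra|].
    rewrite -Hu0. apply (solution_follows u t); [lra|apply S, Ht].
  - intros t Ht. rewrite -(E t); [|lra].
    refine (rderiv_local _ u _ t _ (delta / 2 - t) ltac:(lra) _ _ _).
    + intros s Hs Hst. apply E. apply Rabs_def2 in Hst. lra.
    + apply E. lra.
    + apply (rderiv_mono everywhere); [intros; exact I|]. apply Hu. rewrite Rabs_right; lra.
Qed.

Lemma orbit_value_unif_cont f z b e : Omega z -> 0 < e -> exists d, 0 < d /\
  forall s t, 0 <= s <= b -> 0 <= t <= b -> Rabs (t - s) < d -> Cmod (ev (T t f) z - ev (T s f) z) < e.
Proof.
  intros Hz He. destruct (real_linear_bound _ (ev_real_linear z Hz)) as [M [HM HB]].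
  destruct (T_orbit_unif_cont b f (e / M)) as [d [Hd H]]; [apply Rdiv_lt_0_compat; assumption|].
  exists d. split; [exact Hd|]. intros s t Hs Ht Hst. specialize (H s t Hs Ht Hst).
  rewrite -(ev_minus _ _ _ Hz). eapply Rle_lt_trans; [apply HB|].
  apply Rlt_div_l in H; [|exact HM]. exact H.
Qed.

(** Near a positive time [t], the curve coincides with a local solution
    started slightly before [t]. *)
Lemma follows_rderiv z : Omega z -> (forall s, 0 <= s -> follows z s) ->
  forall t, 0 <= t -> crderiv (fun s => 0 <= s) (fun s => flow s z) t (G (flow t z)).
Proof.
  intros Oz F t Ht. pose proof (proj1 (F t Ht t ltac:(lra))) as Ot.
  destruct (follows_local (flow t z) Ot) as [r [delta [Hr [Hd H]]]].
  destruct (orbit_value_unif_cont e1 z t r Oz Hr) as [d [Hd' Hc]].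
  set (t0 := Rmax 0 (t - Rmin delta d / 2)).
  assert (Hmin : 0 < Rmin delta d) by (apply Rmin_glb_lt; assumption).
  pose proof (Rmin_l delta d). pose proof (Rmin_r delta d).
  assert (Ht0 : 0 <= t0 /\ t0 <= t /\ t - t0 < delta /\ t - t0 < d /\ (t0 = 0 \/ t0 < t)).
  { unfold t0, Rmax. destruct Rle_dec; repeat split; lra. }
  clearbody t0. destruct Ht0 as (A1 & A2 & A3 & A4 & A5).
  destruct (H (flow t0 z)) as [_ D].
  { rewrite Cmod_minus_sym. apply Hc; [lra|lra|]. rewrite Rabs_right; lra. }
  specialize (D (t - t0) ltac:(lra)).
  assert (E : forall s, t0 <= s -> flow s z = flow (s - t0) (flow t0 z)).
  { intros s Hs. rewrite -(flow_add z t0 t0 (s - t0)); [f_equal; ring|apply F; lra|lra|lra]. }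
  rewrite -E in D; [|exact A2].
  assert (D' : crderiv (fun s => 0 <= s) (fun s => flow s (flow t0 z)) (- t0 + t) (G (flow t z))).
  { replace (- t0 + t) with (t - t0) by ring. exact D. }
  apply rderiv_shift in D'.
  assert (Hq : exists q, 0 < q /\ forall s, 0 <= s -> Rabs (s - t) < q -> t0 <= s).
  { destruct A5 as [E0|Hlt].
    - exists 1. split; [lra|]. intros; lra.
    - exists (t - t0). split; [lra|]. intros s Hs Hst. apply Rabs_def2 in Hst. lra. }
  destruct Hq as [q [Hq1 Hq2]].
  apply (rderiv_mono_local (fun s => 0 <= s /\ t0 <= s) _ _ t _ q Hq1).
  { intros s Hs Hst. split; [exact Hs|]. apply Hq2; assumption. }
  refine (rderiv_local _ (fun s => flow (- t0 + s) (flow t0 z)) _ t _ 1 ltac:(lra) _ _ _).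
  - intros s [_ Hs] _. rewrite (E s Hs). f_equal. ring.
  - rewrite (E t A2). f_equal. ring.
  - apply (rderiv_mono (fun s => 0 <= - t0 + s)); [intros; lra|exact D'].
Qed.

(** * Orbits that reach the boundary *)

Lemma flow_cont_in_point z b e : Omega z -> 0 < e -> exists d, 0 < d /\
  forall z', Cmod (z' - z) < d -> Omega z' /\
    forall t, 0 <= t <= b -> Cmod (flow t z' - flow t z) < e.
Proof.
  intros Hz He.
  destruct (ev_local_lipschitz z Hz) as [r [M [Hr [HM [Hin [_ HL]]]]]].
  destruct (T_locally_bounded b) as [K [HK HB]].
  pose proof (norm_ge_0 e1) as P1.
  set (Q := M * (K * norm e1)). assert (HQ : 0 <= Q) by (unfold Q; repeat apply Rmult_le_pos; lra).
  exists (Rmin r (e / (Q + 1))). split; [apply Rmin_glb_lt; [exact Hr|apply Rdiv_lt_0_compat; lra]|].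
  intros z' Hz'.
  destruct (Rlt_Rmin _ _ _ Hz') as [H1 H2].
  split; [apply Hin, H1|]. intros t Ht.
  assert (H0 : Cmod (z - z) < r). { rewrite Cmod_minus_self. exact Hr. }
  pose proof (HL (T t e1) z' z H1 H0) as L. pose proof (HB t e1 Ht) as B.
  unfold flow. eapply Rle_lt_trans; [exact L|].
  pose proof (Cmod_ge_0 (z' - z)%C) as P2.
  apply (Rle_lt_trans _ (Q * Cmod (z' - z))).
  - apply Rmult_le_compat_r; [exact P2|]. apply Rmult_le_compat_l; [lra|exact B].
  - apply Rlt_div_r in H2; [|lra]. lra.
Qed.

(** Continue in time: at the supremum [m] of the times that are reached by
    all points near [z], the point [flow m z] has a neighbourhood with a
    uniform existence time, and the flow is continuous in the initial point. *)
Lemma follows_nearby z s : 0 <= s -> Omega z -> follows z s ->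
  exists d, 0 < d /\ forall z', Cmod (z' - z) < d -> follows z' s.
Proof.
  intros Hs Hz F.
  set (S := fun t => 0 <= t <= s /\ exists d, 0 < d /\ forall z', Cmod (z' - z) < d -> follows z' t).
  destruct (completeness S) as [m Hm].
  { exists s. intros t [Ht _]. lra. }
  { exists 0. split; [lra|]. destruct (flow_cont_in_point z 0 1 Hz ltac:(lra)) as [d [Hd H]].
    exists d. split; [exact Hd|]. intros z' Hz'. apply follows_0, H, Hz'. }
  assert (Hms : 0 <= m <= s).
  { destruct (lub_approx S m 1 Hm ltac:(lra)) as [x [[Hx _] Hx2]]. split; [lra|].
    apply Hm. intros t [Ht _]. lra. }
  pose proof (proj1 (F m Hms)) as Om.
  destruct (follows_local (flow m z) Om) as [r [delta [Hr [Hd H]]]].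
  destruct (orbit_value_unif_cont e1 z s (r / 2) Hz ltac:(lra)) as [c [Hc Hcont]].
  destruct (lub_approx S m (Rmin delta c) Hm) as [t [[Ht [d1 [Hd1 Fd1]]] Htm]].
  { apply Rmin_glb_lt; assumption. }
  pose proof (Rmin_l delta c). pose proof (Rmin_r delta c).
  assert (Hclose : Cmod (flow t z - flow m z) < r / 2).
  { rewrite Cmod_minus_sym. apply Hcont; [lra|lra|]. rewrite Rabs_right; lra. }
  destruct (flow_cont_in_point z s (r / 2) Hz ltac:(lra)) as [d2 [Hd2 Fd2]].
  assert (Fext : forall z', Cmod (z' - z) < Rmin d1 d2 -> follows z' (t + delta)).
  { intros z' Hz'.
    destruct (Rlt_Rmin _ _ _ Hz') as [Q1 Q2].
    apply follows_concat; [lra|apply Fd1, Q1|].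
    apply H. pose proof (proj2 (Fd2 z' Q2) t ltac:(lra)).
    pose proof (Cmod_minus_triangle (flow t z) (flow t z') (flow m z)). lra. }
  assert (Hd12 : 0 < Rmin d1 d2) by (apply Rmin_glb_lt; assumption).
  destruct (Rle_dec s (t + delta)) as [Hle|Hgt].
  - exists (Rmin d1 d2). split; [exact Hd12|]. intros z' Hz'.
    apply (follows_le z' (t + delta)); [exact Hle|apply Fext, Hz'].
  - exfalso. assert (t + delta <= m); [|lra]. apply Hm. split; [lra|].
    exists (Rmin d1 d2). split; [exact Hd12|exact Fext].
Qed.

Lemma follows_shift z s x : 0 <= s -> 0 <= x -> follows z (s + x) -> follows (flow s z) x.
Proof.
  intros Hs Hx F t Ht. rewrite -(flow_add z (s + x) s t F); [|lra|lra].
  split; [apply F; lra|]. intros g r Hr.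
  rewrite -(proj2 (F s ltac:(lra)) g); [|lra]. rewrite -Rplus_assoc. apply F; lra.
Qed.

Section Exit.
Context (z1 w : C) (t1 eps : R) (Hz1 : Omega z1) (Ht1 : 0 < t1) (Heps : 0 < eps)
  (Hfol : forall t, 0 <= t < t1 -> follows z1 t)
  (Hw : flow t1 z1 = w)
  (Hnear : forall t, 0 <= t <= t1 -> Cmod (flow t z1 - w) < eps / 2).

(** For [t < t1] the formula [T t f = g o flow t] holds close to [z1], hence
    on a disc that does not depend on [t], by [hol_disc_vanishing]; then [t]
    tends to [t1]. One disc serves all [f], as the uniform estimate of
    [exit_bound] requires. *)
Lemma exit_composition : exists rho, 0 < rho /\
  (forall z, Cmod (z - z1) < rho -> Omega z) /\
  forall f g, holomorphic (fun z => Omega z \/ open_disc w eps z) g ->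
    (forall z, Omega z -> g z = ev f z) ->
    forall z, Cmod (z - z1) < rho -> ev (T t1 f) z = g (flow t1 z).
Proof.
  destruct (flow_cont_in_point z1 t1 (eps / 2) Hz1 ltac:(lra)) as [R0 [HR0 HR]].
  assert (Hin : forall t z, 0 <= t <= t1 -> Cmod (z - z1) < R0 -> Cmod (flow t z - w) < eps).
  { intros t z Ht Hz. pose proof (proj2 (HR z Hz) t Ht). pose proof (Hnear t Ht).
    pose proof (Cmod_minus_triangle (flow t z1) (flow t z) w). lra. }
  exists (R0 / 16). split; [lra|]. split; [intros z Hz; apply HR; lra|].
  intros f g Hg Egf z Hz.
  assert (Hgd : forall v, Cmod (v - w) < eps -> exists l, cder g v l).
  { intros v Hv. apply ex_derive_cder, Hg. right. exact Hv. }
  assert (Hbefore : forall t, 0 <= t < t1 -> ev (T t f) z = g (flow t z)).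
  { intros t Ht. destruct (follows_nearby z1 t ltac:(lra) Hz1 (Hfol t Ht)) as [d [Hd Fd]].
    apply Cminus_eq_zero.
    apply (hol_disc_vanishing (fun v => ev (T t f) v - g (flow t v))%C z1 R0 (Rmin d R0) HR0);
      [|apply Rmin_glb_lt; assumption| |lra].
    - apply hol_disc_minus.
      + apply (ev_hol_disc). intros v Hv. apply HR, Hv.
      + intros v Hv. destruct (Hgd (flow t v)) as [l Hl]; [apply Hin; [lra|exact Hv]|].
        eexists. apply (cder_comp g (flow t)); [exact Hl|].
        apply (ev_cder (T t e1)). apply HR, Hv.
    - intros v Hv.
      assert (H1 : Cmod (v - z1) < d) by (eapply Rlt_le_trans; [exact Hv|apply Rmin_l]).
      destruct (Fd v H1 t ltac:(lra)) as [Ov Ev]. specialize (Ev f 0 ltac:(lra)).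
      rewrite Rplus_0_r (C0_zero _ _ HT) in Ev. rewrite Ev (Egf _ Ov). ring. }
  assert (Oz : Omega z) by (apply HR; lra).
  apply C_eq_of_le. intros e He.
  destruct (Hgd (flow t1 z)) as [l Hl]; [apply Hin; lra|].
  destruct (cder_ccont _ _ _ Hl (e / 2) ltac:(lra)) as [d1 [Hd1 H1]].
  destruct (orbit_value_unif_cont e1 z t1 d1 Oz Hd1) as [d2 [Hd2 H2]].
  destruct (orbit_value_unif_cont f z t1 (e / 2) Oz ltac:(lra)) as [d3 [Hd3 H3]].
  set (t := Rmax 0 (t1 - Rmin d2 d3 / 2)).
  assert (Hm : 0 < Rmin d2 d3) by (apply Rmin_glb_lt; assumption).
  pose proof (Rmin_l d2 d3). pose proof (Rmin_r d2 d3).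
  assert (Ht : 0 <= t < t1 /\ t1 - t < d2 /\ t1 - t < d3).
  { unfold t, Rmax. destruct Rle_dec; lra. }
  clearbody t. destruct Ht as (A1 & A2 & A3).
  pose proof (H3 t t1 ltac:(lra) ltac:(lra) ltac:(rewrite Rabs_right; lra)) as B3.
  pose proof (H2 t t1 ltac:(lra) ltac:(lra) ltac:(rewrite Rabs_right; lra)) as B2.
  change (Cmod (flow t1 z - flow t z) < d1) in B2. rewrite Cmod_minus_sym in B2.
  specialize (H1 (flow t z) B2). rewrite (Hbefore t A1) in B3.
  pose proof (Cmod_minus_triangle (g (flow t z)) (ev (T t1 f) z) (g (flow t1 z))). lra.
Qed.

Context (Hnonconst : exists a b, Omega a /\ Omega b /\ flow t1 a <> flow t1 b)
  (Omega_connected : connected Omega).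

(** Every [v] near [w] is [flow t1 z] for some [z] near [z1], so that [g v]
    is the value at [z] of [T t1 f]. *)
Lemma exit_bound : exists eps' N, 0 < eps' <= eps /\ 0 < N /\
  forall f g, holomorphic (fun z => Omega z \/ open_disc w eps z) g ->
    (forall z, Omega z -> g z = ev f z) ->
    forall v, Cmod (v - w) < eps' -> Cmod (g v) <= N * norm f.
Proof.
  destruct exit_composition as [rho [Hrho [Hin Hcomp]]].
  destruct (ev_local_bound z1 Hz1) as [r [M [Hr [HM [_ HB]]]]].
  destruct (T_locally_bounded t1) as [K [HK HTB]].
  (* On this disc both the composition formula and the bound on evaluations hold. *)
  set (rho' := Rmin rho r). assert (Hrho' : 0 < rho') by (apply Rmin_glb_lt; assumption).
  assert (R1 : rho' <= rho) by apply Rmin_l. assert (R2 : rho' <= r) by apply Rmin_r.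
  destruct (open_mapping (flow t1) z1 rho' Hrho') as [e [He Hopen]].
  - apply (ev_hol_disc (T t1 e1)). intros z Hz. apply Hin. lra.
  - intros [d [Hd Hc]]. destruct Hnonconst as [a [b [Oa [Ob Hne]]]]. apply Hne.
    assert (Id : forall z, Omega z -> flow t1 z = flow t1 z1).
    { apply (identity_principle Omega (flow t1) (flow t1 z1) z1 d); try assumption.
      apply (ev_holomorphic _ _ _ HX (T t1 e1)). }
    rewrite (Id a Oa) (Id b Ob). reflexivity.
  - exists (Rmin e eps), (M * K). split; [split; [apply Rmin_glb_lt; assumption|apply Rmin_r]|].
    split; [apply Rmult_lt_0_compat; assumption|].
    intros f g Hg Egf v Hv. destruct (Hopen v) as [z [Hz Ez]].
    { rewrite Hw. eapply Rlt_le_trans; [exact Hv|apply Rmin_l]. }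
    rewrite -Ez -(Hcomp f g Hg Egf z); [|lra].
    eapply Rle_trans; [apply HB; lra|]. rewrite Rmult_assoc. apply Rmult_le_compat_l; [lra|].
    apply HTB. lra.
Qed.

(** The extensions of a sequence of extendable functions tending to [f]
    converge uniformly near [w], by [exit_bound] applied to differences. *)
Lemma exit_extends :
  (forall (f : X) eta, 0 < eta -> exists g : X, extends_to_disc Omega w eps (ev g) /\ norm (minus g f) < eta) ->
  exists eps', 0 < eps' /\ forall f, extends_to_disc Omega w eps' (ev f).
Proof.
  intro Hdense. destruct exit_bound as [eps' [N [[He' Hee] [HN Hbound]]]].
  exists eps'. split; [exact He'|]. intro f.
  destruct (functional_choice (fun (n : nat) (fg : X * (C -> C)) =>
     norm (minus (fst fg) f) < / (INR n + 1) /\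
     holomorphic (fun z => Omega z \/ open_disc w eps z) (snd fg) /\
     forall z, Omega z -> snd fg z = ev (fst fg) z)) as [s Hs].
  { intro n. pose proof (pos_INR n). destruct (Hdense f (/ (INR n + 1))) as [fn [[g [Hg Eg]] Hn]].
    { apply Rinv_0_lt_compat. lra. }
    exists (fn, g). split; [exact Hn|]. split; assumption. }
  set (fn := fun n => fst (s n)). set (gn := fun n => snd (s n)).
  assert (Hfn : forall n, norm (minus (fn n) f) < / (INR n + 1)) by (intro n; apply Hs).
  assert (Hgn : forall n, holomorphic (fun z => Omega z \/ open_disc w eps z) (gn n)) by (intro n; apply Hs).
  assert (Egn : forall n z, Omega z -> gn n z = ev (fn n) z) by (intro n; apply Hs).
  clearbody fn gn. clear s Hs.
  assert (Hinv : forall n : nat, 0 < / (INR n + 1)).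
  { intro n. apply Rinv_0_lt_compat. pose proof (pos_INR n). lra. }
  assert (Hmono : forall n m : nat, (n <= m)%nat -> / (INR m + 1) <= / (INR n + 1)).
  { intros n m H. apply Rinv_le_contravar; [pose proof (pos_INR n); lra|]. apply le_INR in H. lra. }
  assert (Hsmall : forall e, 0 < e -> exists n : nat, / (INR n + 1) < e).
  { intros e He. destruct (INR_unbounded (/ e)) as [n Hn]. exists n.
    rewrite -(Rinv_inv e). apply Rinv_lt_contravar; [|lra].
    apply Rmult_lt_0_compat; [apply Rinv_0_lt_compat, He|]. pose proof (pos_INR n). lra. }
  assert (Hdiff : forall n m, (n <= m)%nat -> forall v, Cmod (v - w) < eps' ->
     Cmod (gn m v - gn n v) <= N * (2 * / (INR n + 1))).
  { intros n m Hnm v Hv.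
    eapply Rle_trans; [apply (Hbound (minus (fn m) (fn n)) (fun v => gn m v - gn n v)%C)|]; [| |exact Hv|].
    - intros z Hz. apply ex_derive_cder.
      destruct (proj1 (ex_derive_cder _ _) (Hgn m z Hz)) as [l1 H1].
      destruct (proj1 (ex_derive_cder _ _) (Hgn n z Hz)) as [l2 H2].
      exists (l1 - l2)%C. apply cder_minus; assumption.
    - intros z Hz. rewrite (Egn m z Hz) (Egn n z Hz) (ev_minus _ _ _ Hz). reflexivity.
    - apply Rmult_le_compat_l; [lra|].
      pose proof (cnorm_triangle f (fn m) (fn n)) as Tr. rewrite (cnorm_minus_sym f (fn n)) in Tr.
      pose proof (Hfn m). pose proof (Hfn n). pose proof (Hmono n m Hnm). lra. }
  destruct (functional_choice (fun (v : C) (l : C) => Cmod (v - w) < eps' -> forall n,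
     Cmod (l - gn n v) <= N * (2 * / (INR n + 1)))) as [k Hk].
  { intro v. destruct (Rlt_dec (Cmod (v - w)) eps') as [Hv|Hv].
    2:{ exists (RtoC 0). intro; contradiction. }
    destruct (@cauchy_seq_limit C_CompleteNormedModule (fun n => gn n v)) as [l Hl].
    - intros e He. destruct (Hsmall (e / (2 * N))) as [n Hn]; [apply Rdiv_lt_0_compat; lra|].
      exists n. intros m Hm. pose proof (Hdiff n m Hm v Hv) as D.
      change (Cmod (gn m v - gn n v) < e).
      apply Rlt_div_r in Hn; [|lra]. lra.
    - exists l. intros _ n. apply le_epsilon. intros e He. destruct (Hl e He) as [m0 Hm0].
      specialize (Hm0 (n + m0)%nat ltac:(lia)).
      change (Cmod (gn (n + m0)%nat v - l) < e) in Hm0. rewrite Cmod_minus_sym in Hm0.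
      pose proof (Hdiff n (n + m0)%nat ltac:(lia) v Hv).
      pose proof (Cmod_minus_triangle (gn (n + m0)%nat v) l (gn n v)). lra. }
  assert (Hkhol : hol_disc k w eps').
  { apply (weierstrass gn k w eps').
    - intros n v Hv. apply ex_derive_cder, Hgn. right. unfold open_disc. lra.
    - intros e He. destruct (Hsmall (e / (2 * N))) as [n Hn]; [apply Rdiv_lt_0_compat; lra|].
      exists n. intros v Hv. rewrite Cmod_minus_sym. eapply Rle_trans; [apply Hk, Hv|].
      apply Rlt_div_r in Hn; [|lra]. lra. }
  assert (Ekf : forall v, Omega v -> Cmod (v - w) < eps' -> k v = ev f v).
  { intros v Ov Hv. destruct (real_linear_bound _ (ev_real_linear v Ov)) as [M [HM HB]].
    apply C_eq_of_le. intros e He.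
    destruct (Hsmall (e / (2 * N + M))) as [n Hn]; [apply Rdiv_lt_0_compat; lra|].
    pose proof (Hk v Hv n) as H1. pose proof (HB (minus (fn n) f)) as H2. cbv beta in H2.
    change (Cmod (ev (minus (fn n) f) v) <= M * norm (minus (fn n) f)) in H2.
    rewrite (ev_minus _ _ _ Ov) in H2. rewrite (Egn n v Ov) in H1.
    pose proof (Hfn n) as H3. pose proof (Cmod_minus_triangle (ev (fn n) v) (k v) (ev f v)).
    apply (Rmult_lt_compat_l M) in H3; [|exact HM].
    apply Rlt_div_r in Hn; [|lra]. lra. }
  exists (fun v => if excluded_middle_informative (Omega v) is left _ then ev f v else k v). split.
  - intros v Hv. apply ex_derive_cder.
    destruct (classic (Omega v)) as [Ov|NOv].
    + destruct (open_disc_of_open Omega v Omega_open Ov) as [r [Hr Hin]].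
      eexists. apply (cder_ext_loc (ev f) _ _ _ r Hr); [|apply (ev_cder), Ov].
      intros u Hu. destruct excluded_middle_informative as [_|N']; [reflexivity|].
      exfalso. apply N', Hin, Hu.
    + destruct Hv as [Ov|Hv]; [contradiction|]. unfold open_disc in Hv.
      destruct (Hkhol v Hv) as [l Hl]. exists l.
      apply (cder_ext_loc k _ _ _ (eps' - Cmod (v - w))); [lra| |exact Hl].
      intros u Hu. destruct excluded_middle_informative as [Ou|_]; [|reflexivity].
      apply Ekf; [exact Ou|]. pose proof (Cmod_minus_triangle v u w). lra.
  - intros v Ov. destruct excluded_middle_informative as [_|N']; [reflexivity|contradiction].
Qed.
End Exit.

Context (Omega_connected : connected Omega)
  (Omega_maximal : maximal_domain Omega X ev) (X_density : density_condition Omega X ev).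

(** At the supremum [tau] of the times up to which [z] is followed, [w =
    flow tau z] cannot lie in [Omega], by local existence. So it is a
    boundary point, and [exit_extends], applied to the orbit restarted a
    little before [tau], contradicts maximality. *)
Lemma follows_forever z s : Omega z -> 0 <= s -> follows z s.
Proof.
  intros Hz Hs0. apply NNPP. intro Hnot.
  set (S := fun t => 0 <= t /\ follows z t).
  destruct (completeness S) as [tau Htau].
  { exists s. intros t [Ht F]. destruct (Rle_dec t s); [assumption|]. exfalso. apply Hnot.
    apply (follows_le z t); [lra|exact F]. }
  { exists 0. split; [lra|]. apply follows_0, Hz. }
  assert (Htau0 : 0 <= tau). { apply Htau. split; [lra|apply follows_0, Hz]. }
  assert (Hbefore : forall t, 0 <= t < tau -> follows z t).
  { intros t Ht. destruct (lub_approx S tau (tau - t) Htau ltac:(lra)) as [x [[_ F] Hx]].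
    apply (follows_le z x); [lra|exact F]. }
  set (w := flow tau z).
  assert (Hout : ~ Omega w).
  { intro Ow. destruct (follows_local w Ow) as [r [delta [Hr [Hd H]]]].
    destruct (orbit_value_unif_cont e1 z tau r Hz Hr) as [c [Hc Hcont]].
    destruct (lub_approx S tau (Rmin delta c) Htau) as [t [[Ht F] Htt]].
    { apply Rmin_glb_lt; assumption. }
    pose proof (Rmin_l delta c). pose proof (Rmin_r delta c).
    assert (t + delta <= tau); [|lra]. apply Htau. split; [lra|].
    apply follows_concat; [exact Ht|exact F|]. apply H.
    rewrite Cmod_minus_sym. apply Hcont; [lra|lra|]. rewrite Rabs_right; lra. }
  assert (Htau1 : 0 < tau).
  { destruct Htau0 as [?|E]; [assumption|]. exfalso. apply Hout. unfold w. rewrite -E flow_0; assumption. }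
  assert (Happroach : forall e, 0 < e -> exists d, 0 < d <= tau /\
     forall t, tau - d < t <= tau -> Cmod (flow t z - w) < e).
  { intros e He. destruct (orbit_value_unif_cont e1 z tau e Hz He) as [c [Hc Hcont]].
    exists (Rmin c tau). pose proof (Rmin_l c tau). pose proof (Rmin_r c tau).
    split; [split; [apply Rmin_glb_lt; assumption|assumption]|].
    intros t Ht. apply Hcont; [lra|lra|]. rewrite Rabs_left1; lra. }
  assert (Hbd : boundary Omega w).
  { intros e He. split.
    - destruct (Happroach e He) as [d [Hd H]]. exists (flow (tau - d / 2) z). split.
      + apply (Hbefore (tau - d / 2)); lra.
      + apply H. lra.
    - exists w. split; [exact Hout|]. unfold open_disc. rewrite Cmod_minus_self. exact He. }
  destruct (X_density w Hbd) as [eps [Heps Hdense]].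
  destruct (Happroach (eps / 2) ltac:(lra)) as [d1 [Hd1 Hnear]].
  destruct (open_disc_of_open Omega z Omega_open Hz) as [r [Hr Hin]].
  (* Two points that [flow x] keeps apart for small [x], so that it is not constant. *)
  set (b := (z + RtoC (r / 2))%C).
  assert (Hb : Cmod (b - z) = r / 2).
  { unfold b. replace (z + RtoC (r / 2) - z)%C with (RtoC (r / 2)) by ring. rewrite Cmod_R Rabs_right; lra. }
  assert (Ob : Omega b) by (apply Hin; lra).
  destruct (orbit_value_unif_cont e1 z 1 (r / 4) Hz ltac:(lra)) as [c1 [Hc1 Hcont1]].
  destruct (orbit_value_unif_cont e1 b 1 (r / 4) Ob ltac:(lra)) as [c2 [Hc2 Hcont2]].
  set (x := Rmin (Rmin d1 1) (Rmin c1 c2) / 2).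
  assert (Hx : 0 < x /\ x < d1 /\ x < 1 /\ x < c1 /\ x < c2).
  { unfold x. pose proof (Rmin_l (Rmin d1 1) (Rmin c1 c2)). pose proof (Rmin_r (Rmin d1 1) (Rmin c1 c2)).
    pose proof (Rmin_l d1 1). pose proof (Rmin_r d1 1). pose proof (Rmin_l c1 c2). pose proof (Rmin_r c1 c2).
    assert (0 < Rmin (Rmin d1 1) (Rmin c1 c2)) by (repeat apply Rmin_glb_lt; lra). lra. }
  clearbody x.
  assert (F0 : follows z (tau - x)) by (apply Hbefore; lra).
  assert (Eflow : forall y, 0 <= y -> flow y (flow (tau - x) z) = flow (tau - x + y) z).
  { intros y Hy. symmetry. apply (flow_add z (tau - x)); [exact F0|lra|exact Hy]. }
  destruct (exit_extends (flow (tau - x) z) w x eps) as [eps' [He' Hext]].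
  - apply (F0 (tau - x)). lra.
  - lra.
  - exact Heps.
  - intros t Ht. apply follows_shift; [lra|lra|]. apply Hbefore. lra.
  - rewrite Eflow; [|lra]. unfold w. f_equal. ring.
  - intros t Ht. rewrite Eflow; [|lra]. apply Hnear. lra.
  - exists z, b. split; [exact Hz|]. split; [exact Ob|]. intro E.
    pose proof (Hcont1 0 x ltac:(lra) ltac:(lra) ltac:(rewrite Rabs_right; lra)) as K1.
    pose proof (Hcont2 0 x ltac:(lra) ltac:(lra) ltac:(rewrite Rabs_right; lra)) as K2.
    change (Cmod (flow x z - flow 0 z) < r / 4) in K1. change (Cmod (flow x b - flow 0 b) < r / 4) in K2.
    rewrite (flow_0 z Hz) E in K1. rewrite (flow_0 b Ob) in K2. rewrite Cmod_minus_sym in K2.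
    pose proof (Cmod_minus_triangle (flow x b) b z). lra.
  - exact Omega_connected.
  - exact Hdense.
  - destruct (Omega_maximal w Hbd eps' He') as [f Hf]. apply Hf, Hext.
Qed.

Lemma T_composition f z t : Omega z -> 0 <= t -> ev (T t f) z = ev f (flow t z).
Proof.
  intros Hz Ht. pose proof (proj2 (follows_forever z t Hz Ht t ltac:(lra)) f 0 ltac:(lra)) as E.
  rewrite Rplus_0_r (C0_zero _ _ HT) in E. exact E.
Qed.

(** [T t f - f] and the integral of [T s g] take the same values: both
    vanish at time [0] and have the derivative [g (flow t z)]. *)
Lemma generator_of_derivation f g :
  (forall z, Omega z -> ev g z = (G z * C_derive (ev f) z)%C) -> generator T f g.
Proof.
  intro Hg. apply (generator_of_rderiv).
  assert (E : forall s, 0 <= s -> plus f (orbit_int g s) = T s f).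
  { intros s Hs. apply (ev_inj _ _ _ HX). intros z Hz.
    rewrite (ev_plus _ _ _ HX _ _ _ Hz) (T_composition f z s Hz Hs).
    set (chi := fun x => (ev f (flow x z) - ev (orbit_int g x) z)%C).
    assert (Echi : chi s = chi 0).
    { apply (@rderiv_zero_const C_NormedModule chi 0 s Hs). intros x Hx.
      change (@zero C_NormedModule) with (RtoC 0).
      pose proof (proj1 (follows_forever z x Hz ltac:(lra) x ltac:(lra))) as Ox.
      replace (RtoC 0) with (C_derive (ev f) (flow x z) * G (flow x z) - ev (T x g) z)%C.
      - apply (@rderiv_minus C_NormedModule _ (fun x => ev f (flow x z)) (fun x => ev (orbit_int g x) z)).
        + apply (rderiv_comp (ev f) _ (fun x => flow x z)); [apply (ev_cder), Ox|].
          apply (rderiv_mono (fun x => 0 <= x)); [intros; lra|].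
          apply follows_rderiv; [exact Hz| |lra]. intros y Hy. apply follows_forever; assumption.
        + apply (@rderiv_linear X C_NormedModule (fun h => ev h z)); [apply (ev_real_linear), Hz|].
          apply (rderiv_mono (fun x => 0 <= x)); [intros; lra|].
          apply (orbit_int_rderiv); lra.
      - rewrite (T_composition g z x Hz); [|lra]. rewrite (Hg _ Ox). ring. }
    unfold chi in Echi. rewrite orbit_int_0 (flow_0 z Hz) in Echi.
    assert (Z : ev zero z = 0).
    { assert (Z2 : ev (minus zero zero) z = (ev zero z - ev zero z)%C) by apply (ev_minus _ _ _ Hz).
      transitivity (ev (minus zero zero) z); [|rewrite Z2; ring].
      apply (f_equal (fun h => ev h z)). symmetry. exact (minus_eq_zero (zero : X)). }
    rewrite Z in Echi. apply Cminus_eq_zero.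
    replace (ev f z + ev (orbit_int g s) z - ev f (flow s z))%C with
      ((ev f z - 0) - (ev f (flow s z) - ev (orbit_int g s) z))%C by ring.
    rewrite Echi. ring. }
  refine (rderiv_local _ (fun s => plus f (orbit_int g s)) _ 0 _ 1 ltac:(lra) _ _ _).
  - intros s Hs _. apply E, Hs.
  - apply E. lra.
  - assert (Eg : g = plus zero (T 0 g)).
    { rewrite (C0_zero _ _ HT). symmetry. exact (plus_zero_l g). }
    rewrite {2}Eg.
    apply (rderiv_plus _ (fun _ => f) (orbit_int g)); [exact (rderiv_const _ f 0)|].
    apply (orbit_int_rderiv). lra.
Qed.

End Flow.

(** * The semiflow and the domain of the generator *)

Lemma norm_C_R (z : C) : @norm _ C_R_NormedModule z = Cmod z.
Proof. symmetry. apply Cmod_norm. Qed.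

Lemma scal_C_R (h : R) (z : C) : @scal _ C_R_NormedModule h z = (RtoC h * z)%C.
Proof.
  destruct z as [a b]. unfold RtoC, Cmult; simpl.
  change ((h * a, h * b) = (h * a - 0 * b, h * b + 0 * a)). f_equal; ring.
Qed.

(** The limits of the filter of nonnegative times near [t] are just [t],
    since [t] itself is nonnegative. *)
Lemma filterdiff_crderiv (u : R -> C) t (l : C) : 0 <= t ->
  filterdiff (K := R_AbsRing) (U := R_NormedModule) (V := C_R_NormedModule)
      u (within (fun s => 0 <= s) (locally t)) (fun h : R => scal h (l : C_R_NormedModule))
  <-> crderiv (fun s => 0 <= s) u t l.
Proof.
  intro Ht. split.
  - intros [_ H] eta He.
    specialize (H t).
    destruct (H) with (eps := mkposreal eta He) as [d Hd].
    { intros P [d Hd]. exists d. intros y Hy _. apply Hd, Hy. }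
    exists d. split; [apply cond_pos|]. intros s Ds Hs. specialize (Hd s Hs Ds). simpl in Hd.
    rewrite scal_C_R norm_C_R in Hd. exact Hd.
  - intro H. split; [exact (is_linear_scal_l (K := R_AbsRing) (V := C_R_NormedModule) l)|].
    intros x Hx.
    assert (E : x = t).
    { apply NNPP. intro Hne.
      assert (Hpos : 0 < Rabs (t - x) / 2). { assert (0 < Rabs (t - x)) by (apply Rabs_pos_lt; lra). lra. }
      destruct (Hx (ball x (mkposreal _ Hpos))) as [d Hd].
      { exists (mkposreal _ Hpos). intros y Hy. exact Hy. }
      specialize (Hd t (ball_center t d) Ht). change (Rabs (t - x) < Rabs (t - x) / 2) in Hd. lra. }
    subst x. intros [eta He]. destruct (H eta He) as [d [Hd Hs]].
    exists (mkposreal d Hd). intros s Hsd Ds. specialize (Hs s Ds Hsd). simpl.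
    rewrite scal_C_R norm_C_R. exact Hs.
Qed.

Theorem theorem4p1
  (Omega : C -> Prop)
  (Omega_nonempty : exists z, Omega z)
  (Omega_open : open Omega)
  (Omega_connected : connected Omega)
  (Omega_bounded : bounded_set Omega)
  (Omega_no_puncture : forall (z : C) (r : R), 0 < r ->
     (forall w, open_disc z r w -> w <> z -> Omega w) -> Omega z)
  (X : CompleteNormedModule C_AbsRing)
  (ev : X -> C -> C)
  (X_embeds : embeds_in_Hol Omega X ev)
  (Omega_maximal : maximal_domain Omega X ev)
  (e1_in_X : exists e1 : X, forall z, Omega z -> ev e1 z = z)
  (X_density : density_condition Omega X ev)
  (G : C -> C)
  (G_holomorphic : holomorphic Omega G)
  (T : R -> X -> X)
  (T_semigroup : C0_semigroup X T)
  (T_generator : forall f g : X, generator T f g ->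
     forall z, Omega z -> ev g z = (G z * C_derive (ev f) z)%C) :
  (exists (tau : C -> Rbar) (phi : R -> C -> C),
     is_semiflow Omega G tau phi /\
     (forall z, Omega z -> tau z = p_infty) /\
     (forall (f : X) (z : C) (t : R), Omega z -> 0 <= t ->
        ev (T t f) z = ev f (phi t z))) /\
  (forall f : X,
     generator_dom T f <->
     exists g : X, forall z, Omega z -> ev g z = (G z * C_derive (ev f) z)%C).
Proof.
  destruct e1_in_X as [e1 He1].
  assert (Forever : forall z s, Omega z -> 0 <= s -> follows Omega X ev T e1 z s).
  { intros z s. eapply follows_forever; eassumption. }
  split.
  2:{ intro f. split.
    - intros [g Hg]. exists g. apply T_generator, Hg.
    - intros [g Hg]. exists g. eapply generator_of_derivation; eassumption. }
  set (phi := flow X ev T e1).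
  assert (Hphi : forall z, Omega z -> is_solution Omega G z p_infty (fun t => phi t z)).
  { intros z Hz. split; [eapply flow_0; eassumption|].
    intros t Ht _. split; [apply (Forever z t Hz Ht t); lra|].
    apply filterdiff_crderiv; [exact Ht|].
    eapply follows_rderiv; try eassumption. intros s Hs. apply Forever; assumption. }
  exists (fun _ => p_infty), phi. split; [|split; [reflexivity|]].
  2:{ intros f z t Hz Ht. eapply T_composition; eassumption. }
  intros z Hz. split.
  - split; [exact I|]. split; [apply Hphi, Hz|].
    intros [r| |] v Hle _ _; [destruct Hle|reflexivity|destruct Hle].
  - intros sigma u [Hpos [[Hu0 Hu] Hmax]].
    assert (Eu : forall t, 0 <= t -> Rbar_lt t sigma -> u t = phi t z).
    { intros t Ht Hts. unfold phi. rewrite -Hu0. eapply solution_follows; try eassumption.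
      intros s Hs. destruct (Hu s) as [Os Ds]; [lra| |].
      - apply (Rbar_le_lt_trans s t sigma); [simpl; lra|exact Hts].
      - split; [exact Os|]. apply (rderiv_mono (fun x => 0 <= x)); [intros; lra|].
        apply filterdiff_crderiv; [lra|exact Ds]. }
    split; [|exact Eu].
    symmetry. apply (Hmax p_infty (fun t => phi t z)).
    + destruct sigma; simpl; exact I.
    + apply Hphi, Hz.
    + intros t Ht Hts. symmetry. apply Eu; assumption.
Qed.
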